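(* Let $\mathcal L\subset\operatorname{Lip}_1(\mathbb R)$ be a monoidal subfamily with $\mathcal{TB}\subset\mathcal L$. For pyramids $\mathcal P,\mathcal Q$ in $\mathcal L\circ\mathcal D$, define $$d_{\Pi}^{\mathcal M}(\mathcal P,\mathcal Q)=\sum_{N=1}^{\infty}\frac{1}{N\cdot2^N}\,(d_{\mathrm P})_H\bigl(\mathcal M(\mathcal P;N,N),\mathcal M(\mathcal Q;N,N)\bigr).$$ This defines a metric on the space of pyramids in $\mathcal L\circ\mathcal D$. For pyramids $\mathcal P_n$ ($n=1,2,\dots$) and $\mathcal P$ in $\mathcal L\circ\mathcal D$, the following are equivalent. (i) $\mathcal P_n$ converges weakly to $\mathcal P$. (ii) For every positive integer $N$ and every real $R>0$, $(d_{\mathrm P})_H(\mathcal M(\mathcal P_n;N,R),\mathcal M(\mathcal P;N,R))\to0$. (iii) $d_{\Pi}^{\mathcal M}(\mathcal P_n,\mathcal P)\to0$. Moreover, for $X_n,X\in\mathcal L\circ\mathcal D$, the following are equivalent. (a) For every positive integer $N$ and every real $R>0$, $(d_{\mathrm P})_H(\mathcal M(X_n;N,R),\mathcal M(X;N,R))\to0$. (b) The associated pyramid $\mathcal P_{\mathcal L\circ\mathcal D}(X_n)$ converges weakly to $\mathcal P_{\mathcal L\circ\mathcal D}(X)$. (c) $d_{\Pi}^{\mathcal M}(\mathcal P_{\mathcal L\circ\mathcal D}(X_n),\mathcal P_{\mathcal L\circ\mathcal D}(X))\to0$.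
   Context: A gd-set is a triple $(X,F_X,\mu_X)$ where $F_X$ is a nonempty family of real functions on $X$, $d_{F_X}(x,x')=\sup_{f\in F_X}|f(x)-f(x')|$ is a complete separable metric on $X$, and $\mu_X$ is a Borel probability measure on $(X,d_{F_X})$ with full support. $\overline{F_X}$ is the closure of $F_X$ for pointwise convergence. Gd-sets $X,Y$ are isomorphic if there is a Borel map $u\colon X\to Y$ with $u_*\mu_X=\mu_Y$ and $\overline{F_Y}\circ u=\overline{F_X}$; objects are not distinguished from their isomorphism classes. $Y\preceq X$ means there is a Borel map $u\colon X\to Y$ (a domination) with $u_*\mu_X=\mu_Y$ and $F_Y\circ u\subset\overline{F_X}$. $\operatorname{Lip}_1(\mathbb R)$ is the set of $1$-Lipschitz functions $\mathbb R\to\mathbb R$. A subfamily $\mathcal L\subset\operatorname{Lip}_1(\mathbb R)$ is monoidal if it contains the identity and is closed under composition and pointwise convergence. $\mathcal{TB}=\{t\mapsto\max\{l,\min\{t+c,u\}\}\mid c\in\mathbb R,\ l\in[-\infty,+\infty),\ u\in(-\infty,+\infty],\ l\leq u\}$. $\mathcal L\circ\mathcal D$ is the category (also its set of isomorphism classes) of gd-sets $X$ with $p\circ f\in\overline{F_X}$ for all $p\in\mathcal L$, $f\in\overline{F_X}$; morphisms are dominations. $\mathcal T(\mu,\nu)$ is the set of couplings; $\operatorname{pr}_i$ are the projections; $(d)_H$ is the Hausdorff (pseudo)distance induced by $d$. For closed $S\subset X\times Y$, $d^S_\infty(h,k)=\sup_S|h-k|$, and $(d^S_\infty)_H$ is set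 to $0$ if $S=\emptyset$. The box distance of gd-sets is $\Box(X,Y)=\inf\max\{1-\pi(S),2(d^S_\infty)_H(\overline{F_X}\circ\operatorname{pr}_1,\overline{F_Y}\circ\operatorname{pr}_2)\}$ over $\pi\in\mathcal T(\mu_X,\mu_Y)$ and closed $S\subset X\times Y$; it is a metric on isomorphism classes of gd-sets. $\Box(A,\mathcal E)=\inf_{B\in\mathcal E}\Box(A,B)$. A pyramid in $\mathcal L\circ\mathcal D$ is a nonempty, $\preceq$-downward closed, $\Box$-closed subset in which any two elements have a common upper bound. Pyramids $\mathcal P_n$ converge weakly to a pyramid $\mathcal P$ if $\Box(A,\mathcal P_n)\to0$ for every $A\in\mathcal P$ and $\liminf_n\Box(A,\mathcal P_n)>0$ for every $A\in(\mathcal L\circ\mathcal D)\setminus\mathcal P$. $\mathcal P_{\mathcal L\circ\mathcal D}(X)=\{W\in\mathcal L\circ\mathcal D\mid W\preceq X\}$; it is a pyramid, called the associated pyramid of $X$. For $N\geq1$ and $R>0$, $d_{\mathrm P}$ is the Prokhorov distance on Borel probability measures on $[-R,R]^N$ with the $\ell^\infty$ distance, $b_R(t)=\max\{-R,\min\{t,R\}\}$, $\mathcal M(X;N,R)=\{(b_R\circ f_1,\dots,b_R\circ f_N)_*\mu_X\mid f_1,\dots,f_N\in F_X\}$ for a gd-set $X$, and $\mathcal M(\mathcal E;N,R)$ is the union of $\mathcal M(X;N,R)$ over all gd-sets $X$ belonging (up to isomorphism) to the family $\mathcal E$. *)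

(* Defs.v *)
From HB Require Import structures.
From mathcomp Require Import all_boot all_order all_algebra.
From mathcomp Require Import all_classical all_reals all_analysis.

Set Implicit Arguments.
Unset Strict Implicit.
Unset Printing Implicit Defensive.

Import Order.TTheory GRing.Theory Num.Theory.
Import numFieldNormedType.Exports.

Local Open Scope classical_set_scope.
Local Open Scope ring_scope.
Local Open Scope ereal_scope.

HB.instance Definition _ (X Y : ptopologicalType) := Pointed.on (X * Y)%type.
HB.instance Definition _ (R : numDomainType) (T : pseudoPMetricType R)
  (m n : nat) := Pointed.on 'M[T]_(m, n).

Notation borelType T := (g_sigma_algebraType (@open T)).

Definition borel_map (X Y : ptopologicalType) (u : X -> Y) : Prop :=
  measurable_fun [set: borelType X] (u : borelType X -> borelType Y).

(* A [probability] carries junk values on non-measurable sets, so equality of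
   Borel measures is required on Borel sets only. *)
Definition pushes_to (R : realType) (X Y : ptopologicalType) (u : X -> Y)
    (mu : set (borelType X) -> \bar R) (nu : set (borelType Y) -> \bar R) :
    Prop :=
  forall A : set (borelType Y), measurable A ->
    pushforward mu (u : borelType X -> borelType Y) A = nu A.

Definition hausdorff_dist (R : realType) (T : Type) (d : T -> T -> \bar R)
    (A B : set T) : \bar R :=
  maxe (ereal_sup [set ereal_inf [set d a b | b in B] | a in A])
       (ereal_sup [set ereal_inf [set d a b | a in A] | b in B]).

(* [F] is seen as a subset of [X -> R] with the product topology. *)
Definition ptws_closure (R : realType) (X : Type) (F : set (X -> R)) :
    set (X -> R) :=
  closure (F : set {ptws X -> R}).

Definition fam_dist (R : realType) (X : Type) (F : set (X -> R)) (x y : X) :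
    \bar R :=
  ereal_sup [set `|f x - f y|%:E | f in F].

(* The library requires the underlying types of its complete spaces and of its
   measurable spaces to be pointed; a gd-set is nonempty since it carries a
   probability measure. *)
#[short(type="completeMetricType")]
HB.structure Definition CompleteMetric (R : realType) :=
  {T of CompletePseudoMetric R T & Metric R T}.

(* The topology, uniform structure and distance [mdist] of the carrier are all
   determined by the family, through [gd_mdistE]. *)
Record gdset (R : realType) := GDSet {
  gd_carrier :> completeMetricType R ;
  gd_fam : set (gd_carrier -> R) ;
  gd_mu : probability (borelType gd_carrier) R ;
  gd_fam_nonempty : gd_fam !=set0 ;
  gd_mdistE : forall x y : gd_carrier, (mdist x y)%:E = fam_dist gd_fam x y ;
  gd_separable : exists2 D : set gd_carrier, countable D & dense D ;
  gd_full_support : forall U : set gd_carrier,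
    open U -> U !=set0 -> 0 < gd_mu U
}.
Arguments gd_fam {R} g.
Arguments gd_mu {R} g.

Definition gd_closure (R : realType) (X : gdset R) : set (X -> R) :=
  ptws_closure (gd_fam X).
Arguments gd_closure {R} X.

Definition gd_iso (R : realType) (X Y : gdset R) : Prop :=
  exists u : X -> Y, [/\ borel_map u, pushes_to u (gd_mu X) (gd_mu Y) &
    [set f \o u | f in gd_closure Y] = gd_closure X].

(* [gd_le Y X] is Y <= X: there is a domination X -> Y. *)
Definition gd_le (R : realType) (Y X : gdset R) : Prop :=
  exists u : X -> Y, [/\ borel_map u, pushes_to u (gd_mu X) (gd_mu Y) &
    [set f \o u | f in gd_fam Y] `<=` gd_closure X].

Definition Lip1 (R : realType) : set (R -> R) := [set p | 1.-lipschitz p].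

Definition monoidal (R : realType) (L : set (R -> R)) : Prop :=
  [/\ L `<=` @Lip1 R,
      L id,
      (forall p q, L p -> L q -> L (p \o q)) &
      closed (L : set {ptws R -> R})].

Definition TB (R : realType) : set (R -> R) :=
  [set p | exists (c : R) (l u : \bar R), [/\ l != +oo, u != -oo, l <= u &
    forall t, (p t)%:E = maxe l (mine (t + c)%:E u)]].

(* The class L o D. All the classes of gd-sets of interest are stable under
   isomorphism, which is how sets of isomorphism classes are encoded. *)
Definition LD (R : realType) (L : set (R -> R)) : set (gdset R) :=
  [set X | forall p f, L p -> gd_closure X f -> gd_closure X (p \o f)].

Definition coupling (R : realType) (X Y : gdset R)
    (pi : probability (borelType (X * Y)%type) R) : Prop :=
  pushes_to (fst : X * Y -> X) pi (gd_mu X) /\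
  pushes_to (snd : X * Y -> Y) pi (gd_mu Y).

Definition sup_dist_on (R : realType) (Z : Type) (S : set Z) (h k : Z -> R) :
    \bar R :=
  ereal_sup [set `|h z - k z|%:E | z in S].

Definition hausdorff_sup_dist_on (R : realType) (Z : Type) (S : set Z)
    (A B : set (Z -> R)) : \bar R :=
  if S == set0 then 0 else hausdorff_dist (sup_dist_on S) A B.

Definition box (R : realType) (X Y : gdset R) : \bar R :=
  ereal_inf [set b | exists (pi : probability (borelType (X * Y)%type) R)
      (S : set (X * Y)), [/\ coupling pi, closed S &
    b = maxe (1 - pi S)
          (2%:E * hausdorff_sup_dist_on S
             [set f \o (fst : X * Y -> X) | f in gd_closure X]
             [set g \o (snd : X * Y -> Y) | g in gd_closure Y])]].

Definition box_to (R : realType) (A : gdset R) (E : set (gdset R)) : \bar R :=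
  ereal_inf [set box A B | B in E].

Definition pyramid (R : realType) (L : set (R -> R)) (P : set (gdset R)) :
    Prop :=
  [/\ P `<=` LD L,
      P !=set0,
      (forall X Y, P X -> LD L Y -> gd_le Y X -> P Y),
      (forall A, LD L A ->
        (forall e : R, (0 < e)%R -> exists2 B, P B & box A B < e%:E) -> P A) &
      (forall X Y, P X -> P Y -> exists Z, [/\ P Z, gd_le X Z & gd_le Y Z])].

Definition weakly_converges (R : realType) (L : set (R -> R))
    (Pn : nat -> set (gdset R)) (P : set (gdset R)) : Prop :=
  (forall A, P A -> (fun n => box_to A (Pn n)) @ \oo --> 0) /\
  (forall A, LD L A -> ~ P A -> 0 < limn_einf (fun n => box_to A (Pn n))).

Definition assoc_pyramid (R : realType) (L : set (R -> R)) (X : gdset R) :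
    set (gdset R) :=
  [set W | LD L W /\ gd_le W X].

(* The Prokhorov distance of the metric subspace [K] of [T] (with [K] closed),
   for Borel measures of [T] concentrated on [K]. *)
Definition prokhorov (R : realType) (T : pseudoPMetricType R) (K : set T)
    (mu nu : set (borelType T) -> \bar R) : \bar R :=
  let nbhd (A : set T) e := K `&` [set y | exists2 x, A x & ball x e y] in
  ereal_inf [set e%:E | e in [set e : R | (0 < e)%R /\
    forall A : set (borelType T), measurable A -> A `<=` K ->
      mu A <= nu (nbhd A e) + e%:E /\ nu A <= mu (nbhd A e) + e%:E]].

(* The library's metric on ['rV[R]_N] is the l^oo one. *)
Definition cube (R : realType) (N : nat) (r : R) : set 'rV[R]_N :=
  [set v | forall i, (- r <= v ord0 i <= r)%R].
Arguments cube {R} N r.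

Definition truncation (R : realType) (r t : R) : R :=
  Num.max (- r)%R (Num.min t r).

(* Elements of [measurement X N r] are Borel measures on [cube N r], seen as
   measures on ['rV[R]_N] concentrated on it. *)
Definition measurement (R : realType) (X : gdset R) (N : nat) (r : R) :
    set (set (borelType 'rV[R]_N) -> \bar R) :=
  [set pushforward (gd_mu X)
         ((fun x => \row_i truncation r (f i x)) :
            borelType X -> borelType 'rV[R]_N)
     | f in [set f : 'I_N -> X -> R | forall i, gd_fam X (f i)]].
Arguments measurement {R} X N r.

Definition measurements (R : realType) (E : set (gdset R)) (N : nat) (r : R) :
    set (set (borelType 'rV[R]_N) -> \bar R) :=
  [set nu | exists2 X, (exists2 Y, E Y & gd_iso X Y) & measurement X N r nu].
Arguments measurements {R} E N r.

Definition prokhorov_hausdorff (R : realType) (N : nat) (r : R) :=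
  hausdorff_dist (prokhorov (cube N r)).

Definition dPiM (R : realType) (P Q : set (gdset R)) : \bar R :=
  \sum_(1 <= N <oo) ((N%:R * 2 ^+ N)^-1)%:E *
    prokhorov_hausdorff N%:R
      (measurements P N N%:R) (measurements Q N N%:R).
Arguments dPiM {R} P Q.

Definition is_metric_on (R : realType) (T : Type) (D : set T)
    (d : T -> T -> \bar R) : Prop :=
  [/\ (forall x y, D x -> D y -> d x y \is a fin_num /\ 0 <= d x y),
      (forall x y, D x -> D y -> d x y = 0 <-> x = y),
      (forall x y, D x -> D y -> d x y = d y x) &
      (forall x y z, D x -> D y -> D z -> d x z <= d x y + d y z)].

(* Main.v *)
Require Import Defs.
From HB Require Import structures.
From mathcomp Require Import all_boot all_order all_algebra.
From mathcomp Require Import all_classical all_reals all_analysis.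
From mathcomp Require Import lra.
Set Implicit Arguments.
Unset Strict Implicit.
Unset Printing Implicit Defensive.
Import Order.TTheory GRing.Theory Num.Theory.
Import numFieldNormedType.Exports.

Local Open Scope classical_set_scope.
Local Open Scope ring_scope.
Local Open Scope ereal_scope.

(** A measurement of a gd-set [X] is the law of finitely many truncated functions
of [X], so everything rests on translating between such laws, up to the
Prokhorov distance, and the gd-sets themselves.

From box distance and domination to laws the passage is easy: a coupling that
witnesses a small box distance also couples the laws of corresponding functions
([gd_law_box]), and a domination transports functions up to pointwise closure,
which changes laws by as little as wished ([gd_law_closure], [gd_law_le]).

From laws to gd-sets there are two tools. A law [P] on a cube has a coordinate
gd-set: the support of [P] with the functions [p o x_i] for [p] in [L]
([is_coordinate_gdset]). It is dominated by every gd-set of [L o D] that has [P]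
as a measurement ([coord_le]), hence it belongs to every pyramid that has [P] as a
measurement. Conversely each [A] in [L o D] is approximated in box distance by
the coordinate gd-sets of its measurements, and also by those of all laws close
enough to a suitable measurement ([box_from_measurement]). For this, finitely
many functions of [A] approximate all the others up to additive constants on a
finite net; the translations and truncations in [L] make these constants and the
restriction to a cube harmless; and close laws are coupled so that corresponding
points are close on a set of large measure ([stable_cells], [cell_coupling]).

If the measurements of [P_n] converge to those of [P] in the Hausdorff sense,
then a member of [P] is approximated by members of [P_n] built from nearby
measurements, and a gd-set approximated by members of infinitely many [P_n] is
approximated by members of [P], so belongs to it ([laws_weak]). Conversely, laws on a cube
are sequentially compact ([prokhorov_compact]). If the Hausdorff convergence
fails, a bad sequence of measurements has a limit point [Q]. If the bad laws are
measurements of the [P_n], the coordinate gd-set of [Q] is a limit of the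
coordinate gd-sets of these laws, which lie in [P_n], so that it lies in [P]; if
they are measurements of [P], the first half of weak convergence approximates
them in [P_n] ([weak_laws]).

The series is a weighted sum of distances bounded by 1, so that its convergence
amounts to the convergence of each term, and by truncation a term of large index
controls the lower dimensions and ranges ([PH_contraction]). It vanishes only
for equal pyramids since the constant sequence would converge weakly
([dPiM_eq0_sub]).

The statement on gd-sets reduces to the one on pyramids, since the measurements
of the associated pyramid lie in the closure of those of the gd-set
([PH_assoc]). That the associated pyramid is closed in box distance is the
remaining point: a gd-set whose measurements are all limits of measurements of
[X] is dominated by [X] ([gd_le_of_laws]). *)

(** * Pointwise closure and Borel maps *)

Section ptws_closure.
Context {R : realType}.

Lemma ptws_closureP (X : eqType) (F : set (X -> R)) (f : X -> R) :
  ptws_closure F f <->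
  forall (s : seq X) (e : R), (0 < e)%R ->
    exists2 g, F g & forall x, x \in s -> (`|f x - g x| < e)%R.
Proof.
split=> [clf s e e0|clf].
  have nx x : nbhs (f : {ptws X -> R}) [set g | (`|f x - g x| < e)%R].
    exact: (@proj_continuous X (fun=> R) x f (ball (f x) e) (nbhsx_ballx _ _ e0)).
  have nb : nbhs (f : {ptws X -> R})
      [set g | forall x, x \in s -> (`|f x - g x| < e)%R].
    have FG : Filter (nbhs (f : {ptws X -> R})) by exact: nbhs_filter.
    move: (nbhs _) FG nx => G FG nx.
    elim: s => [|x s IH]; first by apply: filterS filterT => g _ x; rewrite in_nil.
    apply: filterS (filterI (nx x) IH) => g [gx gs] y.
    by rewrite inE => /orP[/eqP->//|]; apply: gs.
  by have [g [Fg gs]] := clf _ nb; exists g.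
rewrite /ptws_closure closureEcvg/=.
pose D := [set p : seq X * R | (0 < p.2)%R].
pose B (p : seq X * R) :=
  [set g | F g /\ forall x, x \in p.1 -> (`|f x - g x| < p.2)%R].
have FG : ProperFilter (filter_from D B).
  apply: filter_from_proper.
    apply: filter_from_filter; first by exists ([::], 1%R); rewrite /D/=.
    move=> [s1 e1] [s2 e2]; rewrite /D/= => e10 e20.
    exists (s1 ++ s2, Num.min e1 e2); first by rewrite /= lt_min e10.
    move=> g [Fg gs]; split; split=> // x xs.
      by have := gs x; rewrite mem_cat xs lt_min => /(_ isT)/andP[].
    by have := gs x; rewrite mem_cat xs orbT lt_min => /(_ isT)/andP[].
  by move=> [s e] /= e0; have [g Fg gs] := clf s e e0; exists g.
exists (filter_from D B) => //; split.
  apply/cvg_sup => x A /=; rewrite (@nbhsE (initial_topology (fun g : X -> R => g x))).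
  case=> C [[V oV <-] Cf] CA.
  move: oV; rewrite openE => /(_ _ Cf); rewrite /interior => /nbhs_ballP[e e0 Ve].
  exists ([:: x], e) => // g [Fg gs]; apply: CA; apply: Ve => /=.
  by apply: gs; rewrite inE.
by move=> A FA; exists ([::], 1%R); rewrite /D//= => g [/FA].
Qed.

Lemma sub_ptws_closure (X : Type) (F : set (X -> R)) : F `<=` ptws_closure F.
Proof. by move=> f Ff; apply: (@subset_closure {ptws X -> R} F). Qed.

Lemma fam_dist_ub (X : Type) (F : set (X -> R)) f x y : F f ->
  `|f x - f y|%:E <= fam_dist F x y.
Proof. by move=> Ff; apply: ereal_sup_ubound; exists f. Qed.

End ptws_closure.

Definition nonexpansive (R : realType) (X Y : pseudoPMetricType R) (u : X -> Y) :=
  forall x y e, ball x e y -> ball (u x) e (u y).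

Section borel.
Context {R : realType}.

Lemma continuous_borel (X Y : ptopologicalType) (u : X -> Y) :
  continuous u -> borel_map u.
Proof.
move=> cu.
apply: (@measurability _ _ (borelType X) (borelType Y) setT u (@open Y)) => //.
move=> _ [U oU <-]; rewrite setTI; apply: sub_sigma_algebra.
by move/continuousP : cu; exact.
Qed.

Lemma nonexpansive_continuous (X Y : pseudoPMetricType R) (u : X -> Y) :
  nonexpansive u -> continuous u.
Proof.
move=> nu x A /nbhs_ballP[e e0 eA]; apply/nbhs_ballP; exists e => // y xy.
by apply: eA; apply: nu.
Qed.

Lemma open_borel (X : ptopologicalType) (U : set X) :
  open U -> measurable (U : set (borelType X)).
Proof. exact: sub_sigma_algebra. Qed.

Lemma closed_borel (X : ptopologicalType) (U : set X) :
  closed U -> measurable (U : set (borelType X)).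
Proof.
by move=> cU; rewrite -[U]setCK; apply: measurableC; apply: open_borel; exact: closed_openC.
Qed.

Lemma borel_preimage (X Y : ptopologicalType) (u : X -> Y) (A : set Y) :
  borel_map u -> measurable (A : set (borelType Y)) ->
  measurable (u @^-1` A : set (borelType X)).
Proof. by move=> mu mA; rewrite -[X in measurable X]setTI; exact: mu. Qed.

Lemma borel_comp (X Y Z : ptopologicalType) (u : X -> Y) (v : Y -> Z) :
  borel_map u -> borel_map v -> borel_map (v \o u).
Proof. by move=> mu mv; exact: (measurableT_comp mv mu). Qed.

Lemma pushforward_probability d d' (O : measurableType d) (T : measurableType d')
    (mu : probability O R) (u : O -> T) : measurable_fun setT u ->
  exists nu : probability T R, pushforward mu u = nu.
Proof.
move=> bu.
pose nu0 := measure_function_pushforward__canonical__measure_function_Measure mu bu.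
have nuT : nu0 setT = 1 by rewrite /nu0/= /pushforward preimage_setT probability_setT.
pose H := Measure_isProbability.Build _ _ _ nu0 nuT.
pose nu := HB.pack_for (probability T R) (nu0 : set _ -> _) nu0 H.
by exists nu.
Qed.

End borel.

(** * The Prokhorov relation *)

Section prokhorov_relation.
Context {R : realType} {N : nat}.
Local Notation V := 'rV[R]_N.
Implicit Types (K : set V) (e : R) (mu nu rho : set (borelType V) -> \bar R).

Definition fatten (K A : set V) (e : R) : set V :=
  K `&` [set y | exists2 x, A x & ball x e y].

(** The condition on [e] in the definition of the Prokhorov distance; by
[pclose_mono] it holds for all [e] above that distance. *)
Definition pclose K e mu nu :=
  forall A : set (borelType V), measurable A -> A `<=` K ->
    mu A <= nu (fatten K A e) + e%:E /\ nu A <= mu (fatten K A e) + e%:E.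

(** Measurements are bare set functions; this recovers the probability measure
behind them and its concentration on [K]. *)
Definition law_on K mu :=
  exists2 P : probability (borelType V) R, mu = P & P K = 1.

Lemma fatten_sub K A e : fatten K A e `<=` K.
Proof. exact: subIsetl. Qed.

Lemma open_enlargement (A : set V) e : open [set y | exists2 x, A x & ball x e y].
Proof.
rewrite (_ : mkset _ = \bigcup_(x in A) ball x e); last first.
  by apply/seteqP; split=> y [x]; exists x.
by apply: bigcup_open => x _; exact: ball_open.
Qed.

Lemma fatten_measurable K (A : set V) e :
  measurable (K : set (borelType V)) ->
  measurable (fatten K A e : set (borelType V)).
Proof. by move=> mK; apply: measurableI => //; apply: open_borel; exact: open_enlargement. Qed.

Lemma fattenS K (A B : set V) d e : A `<=` B -> (d <= e)%R ->
  fatten K A d `<=` fatten K B e.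
Proof.
move=> AB de y [Ky [x Ax xy]]; split=> //; exists x; first exact: AB.
exact: le_ball xy.
Qed.

Lemma fatten_fatten K (A : set V) d e :
  fatten K (fatten K A d) e `<=` fatten K A (d + e).
Proof.
move=> y [Ky [x [Kx [z Az zx]] xy]]; split=> //; exists z => //.
exact: ball_triangle xy.
Qed.

Lemma law_le K mu (A B : set (borelType V)) : law_on K mu ->
  measurable A -> measurable B -> A `<=` B -> mu A <= mu B.
Proof. by move=> [P -> _] mA mB AB; rewrite le_measure// inE. Qed.

Lemma law_ge0 K mu A : law_on K mu -> 0 <= mu A.
Proof. by move=> [P -> _]; exact: measure_ge0. Qed.

Lemma law_le1 K mu (A : set (borelType V)) : law_on K mu -> measurable A ->
  mu A <= 1.
Proof. by move=> [P -> _]; exact: probability_le1. Qed.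

Lemma prob_setI_full (P : probability (borelType V) R)
    (K A : set (borelType V)) : measurable K -> measurable A -> P K = 1 ->
  P (A `&` K) = P A.
Proof.
move=> mK mA PK; apply/eqP; rewrite eq_le; apply/andP; split.
  by rewrite le_measure ?inE//; exact: measurableI.
rewrite [leLHS](_ : _ = P (A `&` K) + P (A `\` K)); last first.
  by rewrite addeC (measureDI _ mA mK).
have PCK : P (~` K) = 0.
  by rewrite probability_setC// PK subee.
suff -> : P (A `\` K) = 0 by rewrite adde0.
apply/eqP; rewrite eq_le measure_ge0 andbT -PCK le_measure ?inE//.
- exact: measurableD.
- exact: measurableC.
Qed.

Lemma pclose_sym K e mu nu : pclose K e mu nu -> pclose K e nu mu.
Proof. by move=> h A mA AK; have [] := h A mA AK. Qed.

Lemma pclose_mono K d e mu nu : measurable (K : set (borelType V)) ->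
  law_on K mu -> law_on K nu -> (d <= e)%R -> pclose K d mu nu -> pclose K e mu nu.
Proof.
move=> mK lm ln de h A mA AK; have [h1 h2] := h A mA AK.
by split; [apply: le_trans h1 _|apply: le_trans h2 _];
  rewrite leeD ?lee_fin//;
  [apply: (law_le ln)|apply: (law_le lm)];
  by [exact: fatten_measurable|exact: fattenS].
Qed.

Lemma pclose_refl K e mu : measurable (K : set (borelType V)) ->
  law_on K mu -> (0 < e)%R -> pclose K e mu mu.
Proof.
move=> mK lm e0; suff h A : measurable (A : set (borelType V)) -> A `<=` K ->
    mu A <= mu (fatten K A e) + e%:E by move=> A mA AK; split; exact: h.
move=> mA AK; rewrite -[leLHS]adde0 leeD ?lee_fin ?(ltW e0)//.
apply: (law_le lm) => //; first exact: fatten_measurable.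
by move=> x Ax; split; [exact: AK|exists x => //; exact: ballxx].
Qed.

Lemma pclose_trans K d e mu nu rho : measurable (K : set (borelType V)) ->
  law_on K mu -> law_on K nu -> law_on K rho ->
  pclose K d mu nu -> pclose K e nu rho -> pclose K (d + e) mu rho.
Proof.
move=> mK lm ln lr h1 h2.
have key m1 m2 m3 c c' : law_on K m3 -> pclose K c m1 m2 -> pclose K c' m2 m3 ->
    forall A : set (borelType V), measurable A -> A `<=` K ->
      m1 A <= m3 (fatten K A (c + c')) + (c + c')%:E.
  move=> l3 h12 h23 A mA AK.
  have [+ _] := h12 A mA AK => /le_trans; apply.
  have mf := fatten_measurable A c mK.
  have [+ _] := h23 _ mf (@fatten_sub _ _ _) => /(leeD2r c%:E)/le_trans; apply.
  rewrite -addeA -EFinD [(c' + c)%R]addrC leeD2r//; apply: (law_le l3);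
    by [exact: fatten_measurable|exact: fatten_fatten].
move=> A mA AK; split; first exact: key h1 h2 A mA AK.
by rewrite [(d + e)%R]addrC; apply: (key _ _ _ _ _ lm (pclose_sym h2) (pclose_sym h1)).
Qed.

Lemma pclose_meq K e mu nu mu' nu' : measurable (K : set (borelType V)) ->
  (forall A : set (borelType V), measurable A -> mu A = mu' A) ->
  (forall A : set (borelType V), measurable A -> nu A = nu' A) ->
  pclose K e mu nu -> pclose K e mu' nu'.
Proof.
move=> mK mm nn h A mA AK; have [h1 h2] := h A mA AK.
by rewrite -!mm -?nn//; exact: fatten_measurable.
Qed.

Lemma prokhorov_le K e mu nu : (0 < e)%R -> pclose K e mu nu ->
  prokhorov K mu nu <= e%:E.
Proof. by move=> e0 h; apply: ereal_inf_lbound; exists e. Qed.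

Lemma prokhorov_ge0 K mu nu : 0 <= prokhorov K mu nu.
Proof. by apply: le_ereal_inf_tmp => _ [e [e0 _] <-]; rewrite lee_fin ltW. Qed.

Lemma prokhorov_sym K mu nu : prokhorov K mu nu = prokhorov K nu mu.
Proof.
by congr ereal_inf; apply/seteqP; split=> x [e [e0 h] <-]; exists e => //;
  split=> // A mA AK; have [] := h A mA AK.
Qed.

Lemma prokhorov_lt K e mu nu : measurable (K : set (borelType V)) ->
  law_on K mu -> law_on K nu ->
  prokhorov K mu nu < e%:E -> (0 < e)%R /\ pclose K e mu nu.
Proof.
move=> mK lm ln /ereal_inf_lt[_ [d [d0 h] <-]]; rewrite lte_fin => de.
by split; [exact: lt_trans de|apply: (pclose_mono mK lm ln (ltW de))].
Qed.

Lemma prokhorov_le1 K mu nu : measurable (K : set (borelType V)) ->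
  law_on K mu -> law_on K nu -> prokhorov K mu nu <= 1.
Proof.
move=> mK lm ln; apply: prokhorov_le => // A mA AK.
split.
  by apply: le_trans (law_le1 lm mA) _; apply: leeDr; exact: law_ge0 ln.
by apply: le_trans (law_le1 ln mA) _; apply: leeDr; exact: law_ge0 lm.
Qed.

(** The easy half of the theorem of Strassen: two random points that are
[e]-close with probability at least [1 - e] have [e]-close laws. *)
Lemma pclose_coupling K d (O : measurableType d) (pi : probability O R)
    (S : set O) (a b : O -> V) e :
  measurable S -> 1 - e%:E <= pi S ->
  measurable_fun setT (a : O -> borelType V) ->
  measurable_fun setT (b : O -> borelType V) ->
  measurable (K : set (borelType V)) ->
  (forall w, S w -> [/\ K (a w), K (b w) & ball (a w) e (b w)]) ->
  pclose K e (pushforward pi (a : O -> borelType V))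
             (pushforward pi (b : O -> borelType V)).
Proof.
move=> mS piS ma mb mK Sab.
have key (a' b' : O -> V) : measurable_fun setT (a' : O -> borelType V) ->
  measurable_fun setT (b' : O -> borelType V) ->
  (forall w, S w -> K (b' w) /\ ball (a' w) e (b' w)) ->
  forall A : set (borelType V), measurable A -> A `<=` K ->
    pi (a' @^-1` A) <= pi (b' @^-1` fatten K A e) + e%:E.
  move=> ma' mb' S' A mA AK.
  have mA' : measurable (a' @^-1` A) by rewrite -[X in measurable X]setTI; exact: ma'.
  have mB' : measurable (b' @^-1` fatten K A e).
    by rewrite -[X in measurable X]setTI; apply: mb' => //; exact: fatten_measurable.
  have piCS : pi (~` S) <= e%:E.
    by rewrite probability_setC// leeBlDr ?fin_num_measure// addeC -leeBlDr.
  apply: (@le_trans _ _ (pi (b' @^-1` fatten K A e `|` ~` S))).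
    rewrite le_measure ?inE//; first by apply: measurableU => //; exact: measurableC.
    move=> w Aw; have [Sw|Sw] := pselect (S w); [left|by right].
    by have [Kb bab] := S' w Sw; split=> //; exists (a' w).
  apply: le_trans (@measureU2 _ _ _ pi _ _ mB' (measurableC mS)) _.
  by rewrite leeD2l.
move=> A mA AK; split; apply: key => // w /Sab[Ka Kb ab]; split=> //.
exact: ball_sym.
Qed.

End prokhorov_relation.

Section prokhorov_contraction.
Context {R : realType} {M N : nat}.

(** The preimage of an enlargement of [A] contains the enlargement of the
preimage of [A], because [T] does not increase distances. *)
Lemma pclose_pushforward (K : set 'rV[R]_M) (K' : set 'rV[R]_N)
    (T : 'rV[R]_M -> 'rV[R]_N) e mu nu :
  closed K -> closed K' -> nonexpansive T -> (forall x, K x -> K' (T x)) ->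
  law_on K mu -> law_on K nu -> pclose K e mu nu ->
  pclose K' e
    (pushforward mu (T : borelType 'rV[R]_M -> borelType 'rV[R]_N))
    (pushforward nu (T : borelType 'rV[R]_M -> borelType 'rV[R]_N)).
Proof.
move=> cK cK' nT KT lm ln h.
have [mK mK'] := (closed_borel cK, closed_borel cK').
have bT : borel_map T by apply: continuous_borel; exact: nonexpansive_continuous.
have key m1 m2 : law_on K m1 -> law_on K m2 -> pclose K e m1 m2 ->
  forall A : set (borelType 'rV[R]_N), measurable A -> A `<=` K' ->
    m1 (T @^-1` A) <= m2 (T @^-1` fatten K' A e) + e%:E.
  move=> l1 l2 h12 A mA AK.
  have mTA := borel_preimage bT mA.
  have -> : m1 (T @^-1` A) = m1 (T @^-1` A `&` K).
    by case: l1 => P -> PK; rewrite prob_setI_full.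
  have [+ _] := h12 _ (measurableI _ _ mTA mK) (@subIsetr _ _ _).
  move/le_trans; apply; rewrite leeD2r//; apply: (law_le l2) => //.
  - exact: fatten_measurable.
  - by apply: borel_preimage => //; exact: fatten_measurable.
  - move=> y [Ky [x [Ax Kx] xy]]; split; first exact: KT.
    by exists (T x) => //; exact: nT.
move=> A mA AK; split; first exact: key.
exact: (key _ _ ln lm (pclose_sym h)).
Qed.

End prokhorov_contraction.

(** * Truncation and laws of finitely many functions *)

Section measure_facts.
Context {R : realType} d (O : measurableType d) (pi : probability O R).

Lemma prob_increasing_cover (F : nat -> set O) (e : R) :
  (forall n, measurable (F n)) -> nondecreasing_seq F ->
  pi (\bigcup_n F n) = 1 -> (0 < e)%R -> exists n, 1 - e%:E < pi (F n).
Proof.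
move=> mF ndF pF e0; apply: contrapT => /forallNP nF.
have mU : measurable (\bigcup_n F n) by exact: bigcupT_measurable.
have cF := nondecreasing_cvg_mu (mu := pi) mF mU ndF.
have : limn (pi \o F) <= 1 - e%:E.
  apply: lime_le; first by apply/cvg_ex; eexists; exact: cF.
  by apply: nearW => n /=; rewrite leNgt; apply/negP/nF.
have -> : limn (pi \o F) = 1 by rewrite -pF; apply: cvg_lim.
rewrite leNgt => /negP; apply.
by rewrite -EFinB lte_fin ltrBlDr ltrDl.
Qed.

End measure_facts.

Lemma closed_exists_in (T : topologicalType) (I : eqType) (s : seq I)
    (P : I -> set T) : (forall c, closed (P c)) ->
  closed [set x | exists2 c, c \in s & P c x].
Proof.
move=> cP; elim: s => [|c s IH].
  rewrite [X in closed X](_ : _ = set0); first exact: closed0.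
  by apply/seteqP; split=> x// [].
rewrite [X in closed X](_ : _ = P c `|` [set x | exists2 c, c \in s & P c x]).
  exact: closedU.
apply/seteqP; split=> x.
  by move=> [k]; rewrite inE => /orP[/eqP->|ks] Pk; [left|right; exists k].
move=> [Pc|[k ks Pk]]; first by exists c; rewrite ?inE ?eqxx.
by exists k; rewrite ?inE ?ks ?orbT.
Qed.

Section truncation.
Context {R : realType}.
Implicit Types r s t : R.

Let truncE r t : truncation r t =
  if (t <= r)%R then if (- r <= t)%R then t else (- r)%R
  else if (- r <= r)%R then r else (- r)%R.
Proof. by rewrite /truncation minEle maxEle; case: (leP t r). Qed.

Lemma truncation_lip r s t : (`|truncation r s - truncation r t| <= `|s - t|)%R.
Proof.
rewrite !truncE ler_norml; case: (ger0P (s - t)%R);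
  case: (leP s r); case: (leP t r); case: (leP (- r)%R r);
  case: (leP (- r)%R s); case: (leP (- r)%R t) => *; apply/andP; split; lra.
Qed.

Lemma truncation_bound r t : (0 <= r -> - r <= truncation r t <= r)%R.
Proof.
rewrite !truncE; case: (leP t r); case: (leP (- r)%R r);
  case: (leP (- r)%R t) => *; apply/andP; split; lra.
Qed.

Lemma truncation_id r t : (- r <= t <= r -> truncation r t = t)%R.
Proof. by rewrite truncE => /andP[-> ->]. Qed.

Lemma truncation_inv r t : (`|truncation r t| < r -> truncation r t = t)%R.
Proof.
rewrite truncE ltr_norml; case: (leP t r); case: (leP (- r)%R t);
  case: (leP (- r)%R r) => *; lra.
Qed.

Lemma truncation_truncation r s t : (0 <= r <= s)%R ->
  truncation r (truncation s t) = truncation r t.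
Proof.
move=> /andP[r0 rs].
rewrite !truncE; case: (leP t s); case: (leP (- s)%R s);
  case: (leP (- s)%R t); case: (leP t r); case: (leP (- r)%R r);
  case: (leP (- r)%R t) => * //; do ?case: ifPn => //; rewrite -?ltNge => *; lra.
Qed.

Lemma closed_cube N r : closed (cube N r).
Proof.
have -> : cube N r = \bigcap_i (fun v : 'rV[R]_N => v ord0 i) @^-1` `[(- r)%R, r].
  apply/seteqP; split=> v /= h i; first by move=> _; rewrite /= in_itv/=; exact: h.
  by have := h i I; rewrite /= in_itv.
apply: closed_bigI => i _; apply: closed_comp => [v _|]; last exact: itv_closed.
exact: coord_continuous.
Qed.

End truncation.

Definition lip1 (R : realType) (X : metricType R) (f : X -> R) :=
  forall x y, (`|f x - f y| <= mdist x y)%R.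

Section rows.
Context {R : realType} (X : completeMetricType R) (N : nat).

Definition row_fun (r : R) (f : 'I_N -> X -> R) (x : X) : 'rV[R]_N :=
  \row_i truncation r (f i x).

Lemma nonexpansive_row (f : 'I_N -> X -> R) : (forall i, lip1 (f i)) ->
  nonexpansive (fun x => \row_i f i x : 'rV[R]_N).
Proof.
move=> lf x y e; rewrite ballEmdist/= => xy.
split; first exact: le_lt_trans (mdist_ge0 x y) xy.
by move=> i j; rewrite !mxE; exact: le_lt_trans (lf _ _ _) xy.
Qed.

Lemma lip1_truncation r (f : X -> R) : lip1 f -> lip1 (truncation r \o f).
Proof. by move=> lf x y; exact: le_trans (truncation_lip _ _ _) (lf _ _). Qed.

Lemma nonexpansive_row_fun r (f : 'I_N -> X -> R) : (forall i, lip1 (f i)) ->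
  nonexpansive (row_fun r f).
Proof. by move=> lf; apply: nonexpansive_row => i; exact: lip1_truncation. Qed.

Lemma borel_row_fun r (f : 'I_N -> X -> R) : (forall i, lip1 (f i)) ->
  borel_map (row_fun r f).
Proof.
by move=> lf; apply: continuous_borel; apply: nonexpansive_continuous;
  exact: nonexpansive_row_fun.
Qed.

Lemma row_fun_cube r (f : 'I_N -> X -> R) x : (0 <= r)%R ->
  cube N r (row_fun r f x).
Proof. by move=> r0 i; rewrite mxE; exact: truncation_bound. Qed.

End rows.

Lemma ball_row_fun (R : realType) (X Y : completeMetricType R) N (r e : R)
    (f : 'I_N -> X -> R) (g : 'I_N -> Y -> R) x y : (0 < e)%R ->
  (forall i, (`|f i x - g i y| < e)%R) -> ball (row_fun r f x) e (row_fun r g y).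
Proof.
move=> e0 fg; split=> // i j; rewrite !mxE.
exact: le_lt_trans (truncation_lip _ _ _) (fg _).
Qed.

Section gd_basics.
Context {R : realType}.
Implicit Types (X Y : gdset R).

Definition gd_law X N (r : R) (f : 'I_N -> X -> R) :
    set (borelType 'rV[R]_N) -> \bar R :=
  pushforward (gd_mu X) (row_fun r f : borelType X -> borelType 'rV[R]_N).

Lemma gd_fam_lip1 X f : gd_fam X f -> lip1 f.
Proof. by move=> Ff x y; rewrite -lee_fin gd_mdistE; exact: fam_dist_ub. Qed.

Lemma gd_fam_closure X f : gd_fam X f -> gd_closure X f.
Proof. exact: sub_ptws_closure. Qed.

Lemma gd_closureP X f : gd_closure X f <->
  forall (s : seq X) (e : R), (0 < e)%R ->
    exists2 g, gd_fam X g & forall x, x \in s -> (`|f x - g x| < e)%R.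
Proof. exact: ptws_closureP. Qed.

(** The pointwise closure is closed. *)
Lemma gd_closure_idem X f :
  (forall (s : seq X) (e : R), (0 < e)%R ->
    exists2 g, gd_closure X g & forall x, x \in s -> (`|f x - g x| < e)%R) ->
  gd_closure X f.
Proof.
move=> h; apply/gd_closureP => s e e0.
have e20 : (0 < e / 2)%R by rewrite divr_gt0.
have [g /gd_closureP/(_ s _ e20)[k Fk gk] fg] := h s _ e20.
exists k => // x xs; rewrite [e]splitr.
apply: le_lt_trans (ler_distD (g x) _ _) _.
by rewrite ltrD ?fg ?gk.
Qed.

Lemma gd_closure_lip1 X f : gd_closure X f -> lip1 f.
Proof.
move=> /gd_closureP clf x y; apply/ler_addgt0Pr => e e0.
have e20 : (0 < e / 2)%R by rewrite divr_gt0.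
have [g Fg gs] := clf [:: x; y] _ e20.
have gx : (`|f x - g x| < e / 2)%R by apply: gs; rewrite !inE eqxx.
have gy : (`|f y - g y| < e / 2)%R by apply: gs; rewrite !inE eqxx orbT.
have := gd_fam_lip1 Fg x y; move: gx gy; rewrite !ltr_norml !ler_norml; lra.
Qed.

Lemma gd_law_on X N (r : R) (f : 'I_N -> X -> R) : (0 <= r)%R ->
  (forall i, lip1 (f i)) -> law_on (cube N r) (gd_law r f).
Proof.
move=> r0 lf; have [P PE] := pushforward_probability (gd_mu X) (borel_row_fun r lf).
exists P => //; rewrite -PE /pushforward (_ : _ @^-1` _ = setT) ?probability_setT//.
by apply/seteqP; split=> // x _; exact: row_fun_cube.
Qed.

Lemma gd_fam_law X N r (f : 'I_N -> X -> R) : (0 < r)%R ->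
  (forall i, gd_fam X (f i)) -> law_on (cube N r) (gd_law r f).
Proof. by move=> r0 Ff; apply: gd_law_on => [|i]; [exact: ltW|exact: gd_fam_lip1]. Qed.

(** Closed balls around the points of a finite net; closed so that the sets that
witness a box distance are closed. *)
Definition near_seq X (s : seq X) (e : R) : set X :=
  [set x | exists2 y, y \in s & (mdist y x <= e)%R].

Lemma ball_mopen X (x : X) e : open (ball x e).
Proof.
rewrite openE => y; rewrite ballEmdist/= => xy; apply/nbhs_ballP.
exists (e - mdist x y)%R => /=; first by rewrite subr_gt0.
move=> z; rewrite !ballEmdist/= ltrBrDl; apply: le_lt_trans.
exact: metric_triangle.
Qed.

Lemma continuous_mdist X (x : X) : continuous (mdist x : X -> R).
Proof.
move=> y A /nbhs_ballP[e e0 eA]; apply/nbhs_ballP; exists e => // z.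
rewrite ballEmdist/= => yz; apply: eA => /=.
have := metric_triangle x y z; have := metric_triangle x z y.
rewrite (metric_sym z y) /ball/= ltr_norml; lra.
Qed.

Lemma closed_near_seq X (s : seq X) e : closed (near_seq s e).
Proof.
apply: closed_exists_in => y.
rewrite (_ : (fun _ => _) = mdist y @^-1` [set t | (t <= e)%R])//.
by apply: closed_comp => [x _|]; [exact: continuous_mdist|exact: closed_le].
Qed.

Lemma measurable_near_seq X (s : seq X) e :
  measurable (near_seq s e : set (borelType X)).
Proof. by apply: closed_borel; exact: closed_near_seq. Qed.

Lemma gd_dense_seq X : exists g : nat -> X, forall x (e : R), (0 < e)%R ->
  exists n, ball (g n) e x.
Proof.
have [D cD dD] := gd_separable X.
have [g Dg] : exists g : nat -> X, forall x, D x -> exists n, g n = x.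
  have /pfcard_geP[D0|[g]] := cD; last by exists g => x /(@surj _ _ _ _ g)[n _ <-]; exists n.
  by exists (fun=> point) => x; rewrite D0.
exists g => x e e0; have [y [xy Dy]] : (ball x e `&` D) !=set0.
  by apply: dD; [exists x; exact: ballxx|exact: ball_mopen].
by have [n gn] := Dg _ Dy; exists n; rewrite gn; exact: ball_sym.
Qed.

(** A separable space is covered, up to small measure, by finitely many small
balls. *)
Lemma gd_finite_net X (e : R) : (0 < e)%R ->
  exists s : seq X, 1 - e%:E < gd_mu X (near_seq s e).
Proof.
move=> e0; have [g gP] := gd_dense_seq X.
pose F n := near_seq [seq g k | k <- iota 0 n] e.
have [||| n nP] := @prob_increasing_cover R _ (borelType X) (gd_mu X) F e _ _ _ e0.
- by move=> n; exact: measurable_near_seq.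
- move=> m n mn; apply/subsetPset => x [y /mapP[k km ->] gk].
  exists (g k) => //; apply: map_f; move: km; rewrite !mem_iota !add0n => /leq_trans; exact.
- rewrite (_ : \bigcup_n _ = setT) ?probability_setT//.
  apply/seteqP; split=> // x _; have [n xn] := gP x e e0.
  exists n.+1 => //; exists (g n); first by apply: map_f; rewrite mem_iota/= add0n.
  by move: xn; rewrite ballEmdist/= => /ltW.
by exists [seq g k | k <- iota 0 n].
Qed.

End gd_basics.

Section law_transfer.
Context {R : realType}.
Implicit Types (X Y W : gdset R).

(** Two 1-Lipschitz functions close on the points of [s] are close around them. *)
Lemma lip1_near_seq X (f g : X -> R) (s : seq X) (d e : R) (x : X) :
  lip1 f -> lip1 g -> (forall y, y \in s -> (`|f y - g y| <= d)%R) ->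
  near_seq s e x -> (`|f x - g x| <= d + (e + e))%R.
Proof.
move=> lf lg fg [y ys yx].
have := fg y ys; have := lf y x; have := lg y x.
by move: yx; rewrite !ler_norml => ? /andP[? ?] /andP[? ?] /andP[? ?]; apply/andP; split; lra.
Qed.

(** Pointwise approximation on a finite net of points is approximation in
probability. *)
Lemma gd_law_closure X N (r e : R) (f : 'I_N -> X -> R) : (0 <= r)%R -> (0 < e)%R ->
  (forall i, gd_closure X (f i)) ->
  exists2 g : 'I_N -> X -> R, (forall i, gd_fam X (g i)) &
    pclose (cube N r) e (gd_law r f) (gd_law r g).
Proof.
move=> r0 e0 clf; have e40 : (0 < e / 4)%R by rewrite divr_gt0.
have [s Ps] := gd_finite_net X e40.
have /choice[g gP] : forall i, exists g, gd_fam X g /\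
    forall x, x \in s -> (`|f i x - g x| < e / 4)%R.
  by move=> i; have /gd_closureP/(_ s _ e40)[g Fg gs] := clf i; exists g.
exists g => [i|]; first by have [] := gP i.
apply: (@pclose_coupling _ _ _ _ (borelType X) (gd_mu X) (near_seq s (e / 4)%R)).
- exact: measurable_near_seq.
- apply: le_trans (ltW Ps); rewrite -!EFinB lee_fin lerD2l lerN2; lra.
- by apply: borel_row_fun => i; apply: gd_closure_lip1; exact: clf.
- by apply: borel_row_fun => i; apply: gd_fam_lip1; have [] := gP i.
- by apply: closed_borel; exact: closed_cube.
move=> x sx; split; [exact: row_fun_cube|exact: row_fun_cube|].
apply: ball_row_fun => // i; have [Fg gs] := gP i.
have := lip1_near_seq (gd_closure_lip1 (clf i)) (gd_fam_lip1 Fg) (fun y ys => ltW (gs y ys)) sx.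
move/le_lt_trans; apply; lra.
Qed.

Lemma gd_law_comp X Y N (r : R) (u : X -> Y) (g : 'I_N -> Y -> R) :
  borel_map u -> pushes_to u (gd_mu X) (gd_mu Y) -> (forall i, lip1 (g i)) ->
  forall A : set (borelType 'rV[R]_N), measurable A ->
    gd_law r (fun i => g i \o u) A = gd_law r g A.
Proof.
move=> bu pu lg A mA; rewrite /gd_law /pushforward -pu//.
by apply: borel_preimage => //; exact: borel_row_fun.
Qed.

Lemma borel_cube N r : measurable (cube N r : set (borelType 'rV[R]_N)).
Proof. by apply: closed_borel; exact: closed_cube. Qed.

(** The functions of the dominated gd-set become, by composition with the
domination, elements of the closure of the family of [X] with the same laws. *)
Lemma gd_law_le W X N (r e : R) (f : 'I_N -> W -> R) : (0 <= r)%R -> (0 < e)%R ->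
  gd_le W X -> (forall i, gd_fam W (f i)) ->
  exists2 g : 'I_N -> X -> R, (forall i, gd_fam X (g i)) &
    pclose (cube N r) e (gd_law r f) (gd_law r g).
Proof.
move=> r0 e0 [u [bu pu uF]] Ff.
have clfu i : gd_closure X (f i \o u) by apply: uF; exists (f i).
have [g Fg fg] := gd_law_closure r0 e0 clfu; exists g => //.
apply: pclose_meq fg => //; first exact: borel_cube.
by apply: gd_law_comp => // i; exact: gd_fam_lip1.
Qed.

Lemma gd_law_iso X Y N (r e : R) (f : 'I_N -> X -> R) : (0 <= r)%R -> (0 < e)%R ->
  gd_iso X Y -> (forall i, gd_fam X (f i)) ->
  exists2 g : 'I_N -> Y -> R, (forall i, gd_fam Y (g i)) &
    pclose (cube N r) e (gd_law r f) (gd_law r g).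
Proof.
move=> r0 e0 [u [bu pu uF]] Ff.
have /choice[h hP] : forall i, exists h, gd_closure Y h /\ h \o u = f i.
  move=> i; have : gd_closure X (f i) by exact: gd_fam_closure.
  by rewrite -uF => -[h clh hu]; exists h.
have clh i : gd_closure Y (h i) by have [] := hP i.
have [g Fg hg] := gd_law_closure r0 e0 clh; exists g => //.
have -> : f = fun i => h i \o u by apply/funext => i; have [] := hP i.
apply: pclose_meq hg => //; first exact: borel_cube.
move=> A mA; apply/esym; apply: gd_law_comp => // i.
by apply: gd_closure_lip1; have [] := hP i.
Qed.

(** A coupling that witnesses a small box distance couples the laws of
corresponding functions. *)
Lemma gd_law_box X Y N (r e : R) (f : 'I_N -> X -> R) : (0 <= r)%R ->
  (0 < e <= 1)%R -> box X Y < e%:E -> (forall i, gd_closure X (f i)) ->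
  exists2 g : 'I_N -> Y -> R, (forall i, gd_closure Y (g i)) &
    pclose (cube N r) e (gd_law r f) (gd_law r g).
Proof.
move=> r0 /andP[e0 e1] /ereal_inf_lt[_ [pi [S [[pi1 pi2] cS ->]]]].
rewrite gt_max => /andP[piS hS] clf.
have mS : measurable (S : set (borelType (X * Y)%type)) by exact: closed_borel.
have piS' : 1 - e%:E < pi S.
  by rewrite lteBlDr// addeC -lteBlDr ?fin_num_measure.
have SN0 : S != set0.
  apply/negP => /eqP S0; move: piS'; rewrite S0 measure0.
  by rewrite ltNge -EFinB lee_fin subr_ge0 e1.
move: hS; rewrite /hausdorff_sup_dist_on (negbTE SN0) => hS.
have /choice[g gP] : forall i, exists g, gd_closure Y g /\
    forall z, S z -> (`|f i z.1 - g z.2| < e)%R.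
  move=> i; have : ereal_inf [set sup_dist_on S (f i \o fst) b | b in
      [set g \o (snd : X * Y -> Y) | g in gd_closure Y]] < (e / 2)%:E.
    rewrite mulrC EFinM lte_pdivlMl//; apply: le_lt_trans hS.
    rewrite lee_pmul2l// le_max; apply/orP; left.
    by apply: ereal_sup_ubound; exists (f i \o fst) => //; exists (f i).
  case/ereal_inf_lt => _ [_ [g clg <-] <-] dg; exists g; split=> // z Sz.
  rewrite -lte_fin; apply: (@le_lt_trans _ _ (e / 2)%:E); last first.
    by rewrite lte_fin ltr_pdivrMr// ltr_pMr// ltr1n.
  apply: le_trans (ltW dg).
  by apply: ereal_sup_ubound; exists z.
exists g => [i|]; first by have [] := gP i.
have lf i : lip1 (f i) by exact: gd_closure_lip1.
have lg i : lip1 (g i) by apply: gd_closure_lip1; have [] := gP i.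
have bfst : borel_map (fst : X * Y -> X).
  by apply: continuous_borel => z; exact: cvg_fst.
have bsnd : borel_map (snd : X * Y -> Y).
  by apply: continuous_borel => z; exact: cvg_snd.
apply: (@pclose_meq _ _ _ _
  (pushforward pi ((row_fun r f \o fst) : borelType (X * Y)%type -> borelType 'rV[R]_N))
  (pushforward pi ((row_fun r g \o snd) : borelType (X * Y)%type -> borelType 'rV[R]_N))).
- exact: borel_cube.
- move=> A mA; rewrite /gd_law /pushforward -pi1//.
  by apply: borel_preimage => //; exact: borel_row_fun.
- move=> A mA; rewrite /gd_law /pushforward -pi2//.
  by apply: borel_preimage => //; exact: borel_row_fun.
apply: (@pclose_coupling _ _ _ _ (borelType (X * Y)%type) pi S) => //.
- exact: ltW.
- by apply: borel_comp => //; exact: borel_row_fun.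
- by apply: borel_comp => //; exact: borel_row_fun.
- exact: borel_cube.
- move=> z Sz; split; [exact: row_fun_cube|exact: row_fun_cube|].
  by apply: ball_row_fun => // i; have [_ h] := gP i; exact: h.
Qed.

Lemma gd_iso_refl X : gd_iso X X.
Proof.
exists id; split; first exact: measurable_id.
  by move=> A mA.
by apply/seteqP; split=> [_ [f clf <-]//|f clf]; exists f.
Qed.

Lemma measurement_law X N r nu : (0 <= r)%R -> measurement X N r nu ->
  law_on (cube N r) nu.
Proof. by move=> r0 [f Ff <-]; apply: gd_law_on => // i; exact: gd_fam_lip1. Qed.

Lemma measurements_law (E : set (gdset R)) N r nu : (0 <= r)%R ->
  measurements E N r nu -> law_on (cube N r) nu.
Proof. by move=> r0 [X _]; exact: measurement_law. Qed.

Lemma measurement_nonempty X N r : measurement X N r !=set0.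
Proof.
have [f Ff] := gd_fam_nonempty X.
by eexists; exists (fun=> f).
Qed.

Lemma measurement_sub (E : set (gdset R)) X N r : E X ->
  measurement X N r `<=` measurements E N r.
Proof. by move=> EX nu Xnu; exists X => //; exists X => //; exact: gd_iso_refl. Qed.

(** The measurements of [E] range over gd-sets isomorphic to a member of [E], and an
isomorphism only matches the closures of the families: hence the error [e]. *)
Lemma measurements_approx (E : set (gdset R)) N r nu e : (0 <= r)%R -> (0 < e)%R ->
  measurements E N r nu ->
  exists2 X, E X & exists2 f : 'I_N -> X -> R, (forall i, gd_fam X (f i)) &
    pclose (cube N r) e nu (gd_law r f).
Proof.
move=> r0 e0 [X [Y EY XY] [f Ff <-]]; exists Y => //.
exact: gd_law_iso r0 e0 XY Ff.
Qed.

End law_transfer.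

(** * Coordinate gd-sets *)

Section rV_separable.
Context {R : realType} {N : nat}.
Local Notation V := 'rV[R]_N.

Lemma rV_dense_seq : exists g : nat -> V, forall x (e : R), (0 < e)%R ->
  exists n, ball (g n) e x.
Proof.
pose h (q : {ffun 'I_N -> rat}) : V := \row_i ratr (q i).
exists (fun n => oapp h 0%R (@unpickle {ffun 'I_N -> rat} n)) => x e e0.
have /choice[q qP] : forall i : 'I_N, exists q : rat, (`|ratr q - x ord0 i| < e)%R.
  move=> i; have /rat_in_itvoo[q] : (x ord0 i - e < x ord0 i + e)%R by lra.
  rewrite in_itv/= => /andP[q1 q2]; exists q; rewrite ltr_norml; lra.
exists (pickle [ffun i => q i]); rewrite pickleK/=; split=> // i j.
by rewrite mxE ord1 ffunE; exact: qP.
Qed.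

Lemma natSinv_lt (e : R) : (0 < e)%R -> exists n, (n.+1%:R^-1 < e)%R.
Proof.
by move=> e0; have [n _ /(_ n (leqnn n))] := near_infty_natSinv_lt (PosNum e0); exists n.
Qed.

End rV_separable.

Section support.
Context {R : realType} {N : nat} (P : probability (borelType 'rV[R]_N) R).
Local Notation V := 'rV[R]_N.

Definition support : set V := [set x | forall e : R, (0 < e)%R -> 0 < P (ball x e)].

Let mball (x : V) (e : R) : measurable (ball x e : set (borelType V)).
Proof. by apply: open_borel; exact: ball_open. Qed.

Lemma closed_support : closed support.
Proof.
rewrite -[support]setCK; apply: open_closedC; rewrite openE => x.
move=> /existsNP[e /not_implyP[e0 /negP]]; rewrite -leNgt => Pe.
have e20 : (0 < e / 2)%R by rewrite divr_gt0.
apply/nbhs_ballP; exists (e / 2)%R => // y xy /(_ _ e20); apply/negP; rewrite -leNgt.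
apply: le_trans Pe; rewrite le_measure ?inE// => z yz.
by rewrite [e]splitr; apply: ball_triangle yz.
Qed.

Lemma measurable_support : measurable (support : set (borelType V)).
Proof. by apply: closed_borel; exact: closed_support. Qed.

(** The complement of the support is covered by countably many null balls. *)
Lemma support_full : P support = 1.
Proof.
have [g gP] := @rV_dense_seq R N.
pose B n m : set (borelType V) := ball (g n) m.+1%:R^-1.
pose F n : set (borelType V) := \bigcup_m [set x | P (B n m) = 0 /\ B n m x].
have nF n : P.-negligible (F n).
  apply: negligible_bigcup => m; have [P0|P0] := pselect (P (B n m) = 0).
    exists (B n m); split => //; first exact: mball.
    by move=> x [].
  by exists set0; split => // x [].
have : P.-negligible (~` support).
  have [M [mM PM FM]] := negligible_bigcup nF.
  exists M; split=> // x /existsNP[e /not_implyP[e0 /negP]]; rewrite -leNgt => Pe.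
  have e20 : (0 < e / 2)%R by rewrite divr_gt0.
  have [m me] := natSinv_lt e20.
  have m0 : (0 < m.+1%:R^-1 :> R)%R by rewrite invr_gt0.
  have [n xn] := gP x _ m0.
  apply: FM; exists n => //; exists m => //; split=> //.
  apply/eqP; rewrite eq_le measure_ge0 andbT; apply: le_trans Pe.
  rewrite le_measure ?inE//; do 1?exact: mball.
  move=> y yn; rewrite [e]splitr.
  apply: le_ball (ball_triangle (ball_sym xn) yn).
  by rewrite lerD// ltW.
have mC := measurableC measurable_support.
move=> /(negligibleP _ mC) PC.
by rewrite -[support]setCK probability_setC// PC sube0.
Qed.

Lemma support_nonempty : support !=set0.
Proof.
apply/set0P/negP => /eqP s0; have := support_full; rewrite s0 measure0.
by move=> /eqP; rewrite eqe eq_sym oner_eq0.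
Qed.

End support.

(** The supports of laws, which are the carriers of coordinate gd-sets. The point is
the default value of the retraction [cs_proj]. *)
Record closed_subset (R : realType) (N : nat) := ClosedSubset {
  cs_set : set 'rV[R]_N ;
  cs_point : 'rV[R]_N ;
  cs_mem : cs_set cs_point ;
  cs_closed : closed cs_set
}.

Definition rV_seq (R : realType) N (v : 'rV[R]_N) (n : nat) : R :=
  oapp (v ord0) 0%R (insub n).

(** A vector is encoded by the sequence of its coordinates: the universe of the
carriers of gd-sets lies below the one of the matrix types. *)
Definition cs_type (R : realType) N (C : closed_subset R N) :=
  {w : nat -> R | exists2 v, cs_set C v & w = rV_seq v}.

HB.instance Definition _ (R : realType) N (C : closed_subset R N) :=
  gen_eqMixin (cs_type C).
HB.instance Definition _ (R : realType) N (C : closed_subset R N) :=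
  gen_choiceMixin (cs_type C).

Section cs_metric.
Context {R : realType} {N : nat} (C : closed_subset R N).
Implicit Types x y z : cs_type C.

Definition cs_val x : 'rV[R]_N := \row_i sval x i.

Let rV_seqK (v : 'rV[R]_N) : \row_i rV_seq v i = v.
Proof. by apply/rowP => i; rewrite mxE /rV_seq valK. Qed.

Lemma cs_valP x : cs_set C (cs_val x).
Proof. by rewrite /cs_val; have [v Cv ->] := svalP x; rewrite rV_seqK. Qed.

Lemma cs_val_inj : injective cs_val.
Proof.
move=> [a Ca] [b Cb]; rewrite /cs_val/= => ab.
have {ab} : a = b.
  move: ab; have [v _ ->] := Ca; have [w _ ->] := Cb.
  by rewrite !rV_seqK => ->.
by move=> ab; subst b; congr (exist _ _ _); exact: Prop_irrelevance.
Qed.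

Definition cs_proj (v : 'rV[R]_N) : cs_type C :=
  match pselect (cs_set C v) with
  | left Cv => exist _ (rV_seq v) (ex_intro2 _ _ v Cv erefl)
  | right _ => exist _ (rV_seq (cs_point C)) (ex_intro2 _ _ (cs_point C) (cs_mem C) erefl)
  end.

Lemma cs_projK v : cs_set C v -> cs_val (cs_proj v) = v.
Proof. by rewrite /cs_proj; case: pselect => // ? _; rewrite /cs_val/= rV_seqK. Qed.

Lemma cs_proj_out v : ~ cs_set C v -> cs_proj v = cs_proj (cs_point C).
Proof.
move=> Cv; apply: cs_val_inj; rewrite [RHS]cs_projK; last exact: cs_mem.
by rewrite /cs_proj; case: pselect => // ?; rewrite /cs_val/= rV_seqK.
Qed.

Lemma cs_valK x : cs_proj (cs_val x) = x.
Proof. by apply: cs_val_inj; apply: cs_projK; exact: cs_valP. Qed.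

Let dist x y : R := `|cs_val x - cs_val y|%R.

Let dist0 x : dist x x = 0%R.
Proof. by rewrite /dist subrr normr0. Qed.

Let dist_eq0 x y : dist x y = 0%R -> x = y.
Proof. by move=> /normr0_eq0/eqP; rewrite subr_eq0 => /eqP/cs_val_inj. Qed.

Let dist_sym x y : dist x y = dist y x.
Proof. exact: distrC. Qed.

Let dist_triangle y x z : (dist x z <= dist x y + dist y z)%R.
Proof. exact: ler_distD. Qed.

HB.instance Definition _ := isMetric.Build R (cs_type C) dist0 dist_eq0 dist_sym dist_triangle.
HB.instance Definition _ := isPointed.Build (cs_type C) (cs_proj (cs_point C)).

Lemma cs_mdistE x y : mdist x y = `|cs_val x - cs_val y|%R.
Proof. by []. Qed.

Lemma cs_ballE x e y : ball x e y = ball (cs_val x) e (cs_val y).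
Proof. by rewrite ballEmdist/= -ball_normE. Qed.

Let complete (F : set_system (cs_type C)) : ProperFilter F -> cauchy F -> cvg F.
Proof.
move=> FF Fc.
have : cauchy (cs_val @ F).
  apply/cauchy_exP => e e0; have /cauchyP/(_ e e0)[x Fx] := Fc.
  exists (cs_val x); suff : F (cs_val @^-1` ball (cs_val x) e) by [].
  by apply: filterS Fx => y; rewrite cs_ballE.
move=> /cauchy_cvg/cvg_ex[l /= Fl].
have Cl : cs_set C l.
  apply: (@closed_cvg _ _ F _ cs_val (cs_set C) (@cs_closed _ _ C) _ _ Fl).
  by apply: nearW => x; exact: cs_valP.
apply/cvg_ex; exists (cs_proj l); apply/cvg_ballP => e e0.
move/cvg_ballP : Fl => /(_ e e0) lF.
suff : F (ball (cs_proj l) e) by [].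
have {}lF : F (cs_val @^-1` ball l e) by [].
by apply: filterS lF => x lx; rewrite cs_ballE cs_projK.
Qed.

HB.instance Definition _ := Uniform_isComplete.Build (cs_type C) complete.

Lemma cs_separable : exists2 D : set (cs_type C), countable D & dense D.
Proof.
have [g gP] := @rV_dense_seq R N.
pose h (p : nat * nat) : cs_type C :=
  xget point [set y | ball (g p.1) p.2.+1%:R^-1 (cs_val y)].
exists (range h).
  by apply: (sub_countable (card_image_le _ _)); exact: countableP.
move=> O [y Oy]; rewrite openE => /(_ _ Oy)/nbhs_ballP[e e0 eO].
have e20 : (0 < e / 2)%R by rewrite divr_gt0.
have [m me] := natSinv_lt e20.
have m0 : (0 < m.+1%:R^-1 :> R)%R by rewrite invr_gt0.
have [n yn] := gP (cs_val y) _ m0.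
exists (h (n, m)); split; last by exists (n, m).
apply: eO; rewrite cs_ballE [e]splitr.
have hn : ball (g n) m.+1%:R^-1 (cs_val (h (n, m))).
  have := @xgetPex _ point [set y | ball (g n) m.+1%:R^-1 (cs_val y)].
  by apply; exists y.
by apply: le_ball (ball_triangle (ball_sym yn) hn); rewrite lerD// ltW.
Qed.

(** The retraction is the inverse of an isometry on the closed set and constant
outside. *)
Lemma borel_cs_proj : borel_map cs_proj.
Proof.
apply: (@measurability _ _ (borelType 'rV[R]_N) (borelType (cs_type C)) setT cs_proj open) => //.
move=> _ [U oU <-]; rewrite setTI.
pose W : set 'rV[R]_N := \bigcup_(p in [set p : cs_type C * R | ball p.1 p.2 `<=` U])
  ball (cs_val p.1) p.2.
have mW : measurable (W : set (borelType 'rV[R]_N)).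
  by apply: open_borel; apply: bigcup_open => p _; exact: ball_open.
have mC : measurable (cs_set C : set (borelType 'rV[R]_N)).
  by apply: closed_borel; exact: cs_closed.
have UW x : U x <-> W (cs_val x).
  split=> [Ux|[[y e]/= yU xy]].
    move: oU; rewrite openE => /(_ _ Ux)/nbhs_ballP[e e0 eU].
    by exists (x, e) => //=; exact: ballxx.
  by apply: yU; rewrite cs_ballE.
have [U0|U0] := pselect (U (cs_proj (cs_point C))).
- rewrite (_ : _ @^-1` _ = (W `&` cs_set C) `|` ~` cs_set C); last first.
    apply/seteqP; split=> v; rewrite /preimage/=.
      have [Cv|Cv] := pselect (cs_set C v); last by right.
      by move=> /UW; rewrite cs_projK// => Wv; left.
    have [Cv|Cv] := pselect (cs_set C v).
      by move=> [[Wv _]|//]; apply/UW; rewrite cs_projK.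
    by rewrite cs_proj_out.
  by apply: measurableU; [exact: measurableI|exact: measurableC].
- rewrite (_ : _ @^-1` _ = W `&` cs_set C); first exact: measurableI.
  apply/seteqP; split=> v; rewrite /preimage/=.
    have [Cv|Cv] := pselect (cs_set C v).
      by move=> /UW; rewrite cs_projK.
    by rewrite cs_proj_out.
  by move=> [Wv Cv]; apply/UW; rewrite cs_projK.
Qed.

End cs_metric.

Section coordinate_gdset.
Context {R : realType} (L : set (R -> R)).
Hypothesis monL : monoidal L.

Lemma monoidal_lip p : L p -> forall s t, (`|p s - p t| <= `|s - t|)%R.
Proof.
case: monL => L1 _ _ _ /L1 lp s t.
by have := lp (s, t) (conj I I); rewrite /= mul1r.
Qed.

(** The gd-set [(supp P, (p o x_i)_(p, i), P)], up to the embedding [v] of its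
carrier. The witness [q] retracts the whole space onto the support, so that the
measure is the image of [P] by a map that is defined everywhere. *)
Definition is_coordinate_gdset N (P : probability (borelType 'rV[R]_N) R)
    (Y : gdset R) (v : Y -> 'rV[R]_N) :=
  exists q : 'rV[R]_N -> Y,
  [/\ (forall x y e, ball x e y = ball (v x) e (v y)),
      gd_fam Y = [set f | exists p i, L p /\ f = fun y => p (v y ord0 i)],
      borel_map q, (forall A, gd_mu Y A = P (q @^-1` A)) &
      cancel v q /\ (forall x, support P x -> v (q x) = x)].

Section construction.
Context {N : nat} (N0 : (0 < N)%N) (P : probability (borelType 'rV[R]_N) R).

Let C : closed_subset R N :=
  ClosedSubset (svalP (cid (support_nonempty P))) (@closed_support R N P).

Let fam : set (cs_type C -> R) :=
  [set f | exists p i, L p /\ f = fun y => p (cs_val y ord0 i)].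

Let fam_nonempty : fam !=set0.
Proof.
exists (fun y => id (cs_val y ord0 (Ordinal N0))).
by exists id, (Ordinal N0); split=> //; case: monL.
Qed.

(** The coordinates alone realize the l^oo distance, and no 1-Lipschitz
function of a coordinate exceeds it. *)
Let fam_mdist x y : (mdist x y)%:E = fam_dist fam x y.
Proof.
apply/eqP; rewrite eq_le; apply/andP; split; last first.
  apply: ge_ereal_sup => _ [_ [p [i [Lp ->]]] <-]; rewrite lee_fin.
  apply: le_trans (monoidal_lip Lp _ _) _.
  rewrite cs_mdistE [leRHS]/Num.norm/= mx_normrE.
  apply: le_trans (le_bigmax _ (fun ij => `|(cs_val x - cs_val y) ij.1 ij.2|%R) (ord0, i)).
  by rewrite /= !mxE.
have h i : `|cs_val x ord0 i - cs_val y ord0 i|%:E <= fam_dist fam x y.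
  apply: (@fam_dist_ub _ _ _ (fun y => id (cs_val y ord0 i))).
  by exists id, i; split=> //; case: monL.
rewrite cs_mdistE; have [e|e] := eqVneq (mx_norm (cs_val x - cs_val y)) 0%R.
  rewrite [X in X%:E]e; apply: le_trans (h (Ordinal N0)).
  by rewrite lee_fin.
have [[i j]] := mx_norm_neq0 e; rewrite [X in X = _]/= => Ee.
by rewrite [X in X%:E]Ee/= ord1; have := h j; rewrite !mxE.
Qed.

Lemma coordinate_gdset_exists : exists (Y : gdset R) (v : Y -> 'rV[R]_N),
  is_coordinate_gdset P v.
Proof.
have bq : borel_map (@cs_proj _ _ C) by exact: borel_cs_proj.
have [mu muE] := pushforward_probability P bq.
have full (U : set (cs_type C)) : open U -> U !=set0 -> 0 < mu U.
  move=> oU [y Uy]; rewrite -muE /pushforward.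
  move: (oU); rewrite openE => /(_ _ Uy)/nbhs_ballP[e e0 eU].
  apply: lt_le_trans (cs_valP y _ e0) _.
  have mb : measurable (ball (cs_val y) e : set (borelType 'rV[R]_N)).
    by apply: open_borel; exact: ball_open.
  rewrite -(prob_setI_full (measurable_support P) mb (support_full P)).
  rewrite le_measure ?inE//.
  - by apply: measurableI => //; exact: measurable_support.
  - by apply: borel_preimage => //; exact: open_borel.
  by move=> x [yx sx]; apply: eU; rewrite cs_ballE cs_projK.
exists (@GDSet R (cs_type C : completeMetricType R) fam mu
  fam_nonempty fam_mdist (cs_separable C) full), (@cs_val _ _ C), (@cs_proj _ _ C).
split=> //=.
- by move=> x y e; exact: cs_ballE.
- by move=> A; rewrite -muE.
- split; first exact: cs_valK.
  by move=> x sx; rewrite cs_projK.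
Qed.

End construction.

Section theory.
Context {N : nat} (P : probability (borelType 'rV[R]_N) R) (Y : gdset R)
  (v : Y -> 'rV[R]_N) (cY : is_coordinate_gdset P v).

Lemma coord_nonexpansive : nonexpansive v.
Proof. by have [q [vb _ _ _ _]] := cY; move=> x y e; rewrite vb. Qed.

Lemma coord_borel : borel_map v.
Proof.
by apply: continuous_borel; apply: nonexpansive_continuous; exact: coord_nonexpansive.
Qed.

Lemma coord_fam p i : L p -> gd_fam Y (fun y => p (v y ord0 i)).
Proof. by have [q [_ -> _ _ _]] := cY; move=> Lp; exists p, i. Qed.

(** The retraction [q] moves only points outside the support, a null set. *)
Lemma coord_pushforward (A : set (borelType 'rV[R]_N)) : measurable A ->
  gd_mu Y (v @^-1` A) = P A.
Proof.
have [q [_ _ bq muY [_ vq]]] := cY; move=> mA; rewrite muY.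
have mS := measurable_support P.
have mqA : measurable (q @^-1` (v @^-1` A) : set (borelType 'rV[R]_N)).
  by apply: borel_preimage => //; apply: borel_preimage => //; exact: coord_borel.
rewrite -(prob_setI_full mS mA (support_full P)).
rewrite -(prob_setI_full mS mqA (support_full P)).
congr (P _); apply/seteqP; split=> x [Ax sx]; split=> //.
  by move: Ax; rewrite /preimage/= vq.
by rewrite /preimage/= vq.
Qed.

(** [L] is closed under composition, and composing with a 1-Lipschitz function is
continuous for pointwise convergence. *)
Lemma coord_LD : LD L Y.
Proof.
have [q [_ FY _ _ _]] := cY; move=> p f Lp clf; apply: gd_closure_idem => s e e0.
have /gd_closureP/(_ s e e0)[g Fg fg] := clf.
exists (p \o g); last by move=> x xs; exact: le_lt_trans (monoidal_lip Lp _ _) (fg _ xs).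
apply: gd_fam_closure; move: Fg; rewrite FY => -[p' [i [Lp' ->]]].
by exists (p \o p'), i; split=> //; case: monL => _ _ + _; exact.
Qed.

(** A space whose functions push its measure to [P] dominates the coordinate
gd-set of [P]: a continuous map sends a space of full support into the support
of the image measure, so that the domination is defined everywhere. *)
Lemma coord_le (B : gdset R) (h : 'I_N -> B -> R) : LD L B ->
  (forall i, gd_closure B (h i)) ->
  (forall A : set (borelType 'rV[R]_N), measurable A ->
     gd_mu B ((fun b => \row_i h i b) @^-1` A) = P A) ->
  gd_le Y B.
Proof.
move=> LB clh hP; have [q [vb FY bq muY [vK vq]]] := cY.
set w := fun b => \row_i h i b : 'rV[R]_N.
have nw : nonexpansive w by apply: nonexpansive_row => i; apply: gd_closure_lip1.
have sw b : support P (w b).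
  move=> e e0; have mb : measurable (ball (w b) e : set (borelType 'rV[R]_N)).
    by apply: open_borel; exact: ball_open.
  rewrite -hP//; apply: lt_le_trans (@gd_full_support _ B (ball b e) _ _) _.
  - exact: ball_mopen.
  - by exists b; exact: ballxx.
  rewrite le_measure ?inE//; first by apply: open_borel; exact: ball_mopen.
    by apply: borel_preimage => //; apply: continuous_borel; exact: nonexpansive_continuous.
  by move=> b'; exact: nw.
exists (q \o w); split.
- apply: continuous_borel; apply: nonexpansive_continuous => x y e xy.
  by rewrite vb /= !vq//; exact: nw.
- move=> A mA; rewrite muY -hP//.
  exact: borel_preimage.
- move=> _ [f + <-]; rewrite FY => -[p [i [Lp ->]]].
  rewrite (_ : _ \o _ = p \o h i); first exact: LB.
  by apply/funext => b /=; rewrite vq// mxE.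
Qed.

End theory.

End coordinate_gdset.

(** * Couplings with prescribed cell masses *)

Section matrix_coupling.
Context {R : realType} d1 d2 (T1 : measurableType d1) (T2 : measurableType d2).
Context (mu : probability T1 R) (nu : probability T2 R).
Context (K : nat) (C : nat -> set T1) (D : nat -> set T2) (m : nat -> nat -> R).
Hypotheses (mC : forall j, measurable (C j)) (mD : forall j, measurable (D j)).
Hypotheses (tC : trivIset setT C) (tD : trivIset setT D).
Hypotheses (CT : \bigcup_(j < K) C j = setT) (DT : \bigcup_(j < K) D j = setT).
Let a j : R := fine (mu (C j)).
Let b k : R := fine (nu (D k)).
Hypotheses (m_ge0 : forall j k, (0 <= m j k)%R).
Hypothesis m_row : forall j, (j < K)%N -> (\sum_(k < K) m j k = a j)%R.
Hypothesis m_col : forall k, (k < K)%N -> (\sum_(j < K) m j k = b k)%R.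

Let aE j : mu (C j) = (a j)%:E.
Proof. by rewrite fineK// fin_num_measure. Qed.

Let bE j : nu (D j) = (b j)%:E.
Proof. by rewrite fineK// fin_num_measure. Qed.

Let a_ge0 j : (0 <= a j)%R. Proof. exact: fine_ge0. Qed.
Let b_ge0 j : (0 <= b j)%R. Proof. exact: fine_ge0. Qed.

(** The density of the coupling with respect to [mu \x nu] on [C j `*` D k]: that
product has mass [a j * b k], and the coupling has to have mass [m j k]. *)
Let c j k : R := (m j k / (a j * b k))%R.

Let c_ge0 j k : (0 <= c j k)%R.
Proof. by rewrite divr_ge0// mulr_ge0. Qed.

Let m_row0 j k : (j < K)%N -> (k < K)%N -> a j = 0%R -> m j k = 0%R.
Proof.
move=> jK kK aj0; apply/eqP; rewrite eq_le m_ge0 andbT.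
have := m_row jK; rewrite aj0 (bigD1 (Ordinal kK))//= => h.
by rewrite -h lerDl; apply: sumr_ge0.
Qed.

Let m_col0 j k : (j < K)%N -> (k < K)%N -> b k = 0%R -> m j k = 0%R.
Proof.
move=> jK kK bk0; apply/eqP; rewrite eq_le m_ge0 andbT.
have := m_col kK; rewrite bk0 (bigD1 (Ordinal jK))//= => h.
by rewrite -h lerDl; apply: sumr_ge0.
Qed.

Let c_b j k : (j < K)%N -> (k < K)%N -> (c j k * b k = m j k / a j)%R.
Proof.
move=> jK kK; have [b0|b0] := eqVneq (b k) 0%R.
  by rewrite b0 mulr0 m_col0// mul0r.
by rewrite /c invfM mulrA -mulrA mulVf ?mulr1.
Qed.

Let c_a j k : (j < K)%N -> (k < K)%N -> (c j k * a j = m j k / b k)%R.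
Proof.
move=> jK kK; have [a0|a0] := eqVneq (a j) 0%R.
  by rewrite a0 mulr0 m_row0// mul0r.
by rewrite /c invfM mulrA mulrAC -[X in (X * _)%R]mulrA mulVf ?mulr1.
Qed.

Let mCD j k : measurable (C j `*` D k).
Proof. exact: measurableX. Qed.

Let piece j k : {measure set (T1 * T2) -> \bar R} :=
  mscale (NngNum (c_ge0 j k)) (mrestr (mu \x nu) (mCD j k)).

Let pi0 : {measure set (T1 * T2) -> \bar R} :=
  msum (fun j => msum (piece j) K) K.

Let pi0X (A : set T1) (B : set T2) : measurable A -> measurable B ->
  pi0 (A `*` B) =
  \sum_(j < K) \sum_(k < K) (c j k)%:E * (mu (A `&` C j) * nu (B `&` D k)).
Proof.
move=> mA mB; rewrite /pi0/= /msum/=; apply: eq_bigr => j _; apply: eq_bigr => k _.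
rewrite /piece/= /mscale/= /mrestr; congr (_ * _).
by rewrite -setXI product_measure1E//; exact: measurableI.
Qed.

Let sum_cells d (T : measurableType d) (rho : probability T R) (E : nat -> set T)
  (A : set T) : measurable A -> (forall j, measurable (E j)) -> trivIset setT E ->
  \bigcup_(j < K) E j = setT ->
  (\sum_(j < K) fine (rho (A `&` E j)) = fine (rho A))%R.
Proof.
move=> mA mE tE ET; apply: EFin_inj; rewrite fineK ?fin_num_measure//.
rewrite -sumEFin.
rewrite (eq_bigr (fun j : 'I_K => rho (A `&` E j))); last first.
  by move=> j _; rewrite fineK// fin_num_measure//; exact: measurableI.
rewrite -(measure_bigsetU rho (F := fun j => A `&` E j)).
- by rewrite -(bigcup_mkord K (fun j => A `&` E j)) -setI_bigcupr ET setIT.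
- by move=> j; exact: measurableI.
- exact: trivIset_setIl.
Qed.

Let pi0_fst (A : set T1) : measurable A -> pi0 (A `*` setT) = mu A.
Proof.
move=> mA; rewrite pi0X//.
pose x j := fine (mu (A `&` C j)).
have xE j : mu (A `&` C j) = (x j)%:E.
  by rewrite fineK// fin_num_measure//; exact: measurableI.
rewrite (eq_bigr (fun j : 'I_K => (x j)%:E)) => [|j _].
  by rewrite sumEFin /x sum_cells// fineK// fin_num_measure.
rewrite (eq_bigr (fun k : 'I_K => (x j * (m j k / a j))%:E)) => [|k _].
  rewrite sumEFin -mulr_sumr -mulr_suml m_row//; congr (_%:E).
  have [a0|a0] := eqVneq (a j) 0%R; last by rewrite divff// mulr1.
  rewrite a0 mul0r mulr0; apply/esym/eqP; rewrite eq_le fine_ge0 ?andbT//.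
  rewrite -lee_fin -xE -a0 -aE le_measure ?inE//; exact: measurableI.
by rewrite setTI bE xE -!EFinM mulrCA c_b.
Qed.

Let pi0_snd (B : set T2) : measurable B -> pi0 (setT `*` B) = nu B.
Proof.
move=> mB; rewrite pi0X// exchange_big/=.
pose x j := fine (nu (B `&` D j)).
have xE j : nu (B `&` D j) = (x j)%:E.
  by rewrite fineK// fin_num_measure//; exact: measurableI.
rewrite (eq_bigr (fun j : 'I_K => (x j)%:E)) => [|k _].
  by rewrite sumEFin /x sum_cells// fineK// fin_num_measure.
rewrite (eq_bigr (fun j : 'I_K => (x k * (m j k / b k))%:E)) => [|j _].
  rewrite sumEFin -mulr_sumr -mulr_suml m_col//; congr (_%:E).
  have [b0|b0] := eqVneq (b k) 0%R; last by rewrite divff// mulr1.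
  rewrite b0 mul0r mulr0; apply/esym/eqP; rewrite eq_le fine_ge0 ?andbT//.
  rewrite -lee_fin -xE -b0 -bE le_measure ?inE//; exact: measurableI.
by rewrite setTI aE xE -!EFinM mulrA c_a// mulrC.
Qed.

(** The coupling is a multiple of the product measure on each product of cells, so
its marginals on a cell are multiples of [mu] and [nu], with the right factor by
the conditions on the sums of the rows and columns of [m]. *)
Lemma matrix_coupling : exists pi : probability (T1 * T2)%type R,
  [/\ (forall A, measurable A -> pi (A `*` setT) = mu A),
      (forall B, measurable B -> pi (setT `*` B) = nu B) &
      (forall j k, (j < K)%N -> (k < K)%N -> (m j k)%:E <= pi (C j `*` D k))].
Proof.
have piT : pi0 setT = 1 by rewrite -setXTT pi0_fst// probability_setT.
pose H := Measure_isProbability.Build _ _ _ pi0 piT.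
pose pi := HB.pack_for (probability (T1 * T2)%type R) (pi0 : set _ -> _) pi0 H.
exists pi; split; [exact: pi0_fst|exact: pi0_snd|].
move=> j k jK kK; rewrite [leRHS]/= pi0X//.
rewrite (bigD1 (Ordinal jK))//= (bigD1 (Ordinal kK))//= -addeA -[leLHS]adde0.
apply: leeD; last first.
  by apply: adde_ge0; do ?(apply: sume_ge0 => ? _); rewrite ?mule_ge0 ?lee_fin.
rewrite !setIid aE bE -!EFinM lee_fin mulrA c_a//.
have [b0|b0] := eqVneq (b k) 0%R; first by rewrite m_col0// !mul0r.
by rewrite mulfVK.
Qed.

End matrix_coupling.

Section cell_coupling.
Context {R : realType} d1 d2 (T1 : measurableType d1) (T2 : measurableType d2).
Context (mu : probability T1 R) (nu : probability T2 R).

(** The complement of the cells is added as a last cell, of index [K]. *)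
Let complete d (T : measurableType d) K (C : nat -> set T) :
  (forall j, measurable (C j)) -> trivIset setT C ->
  let C' j := if (j < K)%N then C j else if j == K then ~` \bigcup_(i < K) C i else set0 in
  [/\ forall j, measurable (C' j), trivIset setT C' & \bigcup_(j < K.+1) C' j = setT].
Proof.
move=> mC tC; have mU : measurable (\bigcup_(i < K) C i).
  by apply: bigcup_measurable.
split=> [j||].
- by case: ifP => // _; case: ifP => // _; exact: measurableC.
- apply/trivIsetP => i j _ _ ij; apply/seteqP; split=> // x [].
  case: (ltnP i K) => iK; case: (ltnP j K) => jK.
  + move=> Ci Cj; move/trivIsetP : tC => /(_ i j I I ij)/seteqP[h _].
    exact: (h x (conj Ci Cj)).
  + have [_|_] := eqVneq j K; last by move=> _ h; exact h.
    by move=> Ci nC; case: nC; exists i.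
  + have [_|_] := eqVneq i K; last by move=> h _; exact h.
    by move=> nC Cj; case: nC; exists j.
  + have [iE|_] := eqVneq i K; last by move=> h _; exact h.
    have [jE|_] := eqVneq j K; last by move=> _ h; exact h.
    by rewrite iE jE eqxx in ij.
- apply/seteqP; split=> // x _; have [[j jK Cj]|nC] := pselect ((\bigcup_(i < K) C i) x).
    by exists j; [exact: ltnW|rewrite /= jK].
  by exists K => //=; rewrite ltnn eqxx.
Qed.

(** The largest possible mass is put on the pairs of matched cells: this is how
closeness of two laws becomes a coupling that keeps most of the mass near the
diagonal. *)
Lemma cell_coupling K (C : nat -> set T1) (D : nat -> set T2) :
  (forall j, measurable (C j)) -> (forall j, measurable (D j)) ->
  trivIset setT C -> trivIset setT D ->
  exists pi : probability (T1 * T2)%type R,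
  [/\ (forall A, measurable A -> pi (A `*` setT) = mu A),
      (forall B, measurable B -> pi (setT `*` B) = nu B) &
      (forall j, (j < K)%N -> mine (mu (C j)) (nu (D j)) <= pi (C j `*` D j))].
Proof.
move=> mC mD tC tD.
have [] := complete K mC tC; set C' := (fun j => if _ then _ else _) => mC' tC' CT.
have [] := complete K mD tD; set D' := (fun j => if _ then _ else _) => mD' tD' DT.
pose a j : R := fine (mu (C' j)); pose b j : R := fine (nu (D' j)).
pose w j : R := Num.min (a j) (b j).
have wa j : (w j <= a j)%R by rewrite ge_min lexx.
have wb j : (w j <= b j)%R by rewrite ge_min lexx orbT.
have w0 j : (0 <= w j)%R by rewrite le_min !fine_ge0.
pose r : R := (1 - \sum_(j < K.+1) w j)%R.
(* The smaller masses go on the diagonal; what each side has left, of total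
   mass [r], is coupled independently. If [r = 0] nothing is left, and the
   division by zero is harmless. *)
pose m j k : R := ((if j == k then w j else 0) + (a j - w j) * (b k - w k) / r)%R.
have suma : (\sum_(j < K.+1) a j = 1)%R.
  apply: EFin_inj; rewrite -sumEFin (eq_bigr (fun j : 'I_K.+1 => mu (C' j))).
    by rewrite -(measure_bigsetU mu mC' tC') -(bigcup_mkord K.+1 C') CT; exact: probability_setT.
  by move=> j _; rewrite fineK; [|apply: fin_num_measure; exact: mC'].
have sumb : (\sum_(j < K.+1) b j = 1)%R.
  apply: EFin_inj; rewrite -sumEFin (eq_bigr (fun j : 'I_K.+1 => nu (D' j))).
    by rewrite -(measure_bigsetU nu mD' tD') -(bigcup_mkord K.+1 D') DT; exact: probability_setT.
  by move=> j _; rewrite fineK; [|apply: fin_num_measure; exact: mD'].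
have sumaw : (\sum_(j < K.+1) (a j - w j) = r)%R by rewrite sumrB suma.
have sumbw : (\sum_(j < K.+1) (b j - w j) = r)%R by rewrite sumrB sumb.
have r0 : (0 <= r)%R by rewrite -sumaw sumr_ge0// => j _; rewrite subr_ge0.
have aw0 j : (j < K.+1)%N -> r = 0%R -> (a j - w j = 0)%R.
  move=> jK re; apply/eqP; rewrite eq_le subr_ge0 wa andbT.
  rewrite -re -sumaw (bigD1 (Ordinal jK))//= lerDl sumr_ge0// => i _.
  by rewrite subr_ge0.
have bw0 j : (j < K.+1)%N -> r = 0%R -> (b j - w j = 0)%R.
  move=> jK re; apply/eqP; rewrite eq_le subr_ge0 wb andbT.
  rewrite -re -sumbw (bigD1 (Ordinal jK))//= lerDl sumr_ge0// => i _.
  by rewrite subr_ge0.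
have [|||pi [pi1 pi2 pim]] := @matrix_coupling R _ _ T1 T2 mu nu K.+1 C' D' m
    mC' mD' tC' tD' CT DT.
- move=> j k; rewrite addr_ge0//; first by case: ifP.
  by rewrite divr_ge0// mulr_ge0// subr_ge0.
- move=> j jK; rewrite big_split/= -mulr_suml -mulr_sumr sumbw.
  rewrite (bigD1 (Ordinal jK))//= eqxx big1 ?addr0 => [|i ij]; last first.
    by case: eqP => // jE; move: ij; rewrite -val_eqE/= -jE eqxx.
  have [re|re] := eqVneq r 0%R; last by rewrite mulfK// addrC subrK.
  by rewrite re mulr0 mul0r addr0; apply/esym/subr0_eq; exact: aw0.
- move=> k kK; rewrite big_split/= -mulr_suml -mulr_suml sumaw.
  rewrite (bigD1 (Ordinal kK))//= eqxx big1 ?addr0 => [|i ij]; last first.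
    by case: eqP => // jE; move: ij; rewrite -val_eqE/= jE eqxx.
  have [re|re] := eqVneq r 0%R; last by rewrite mulrAC mulfV// mul1r addrC subrK.
  by rewrite re !mul0r addr0; apply/esym/subr0_eq; exact: bw0.
exists pi; split=> // j jK.
have jK1 : (j < K.+1)%N by exact: ltnW.
have := pim j j jK1 jK1; rewrite /C' /D' jK => /(le_trans _); apply.
have -> : mine (mu (C j)) (nu (D j)) = (w j)%:E.
  by rewrite /w EFin_min /a /b /C' /D' jK !fineK// fin_num_measure.
by rewrite lee_fin /m eqxx lerDl divr_ge0// mulr_ge0// subr_ge0.
Qed.

End cell_coupling.

Section gd_coupling.
Context {R : realType} (X Y : gdset R).

(** In separable spaces the Borel sets of the product belong to the product
sigma-algebra. *)
Lemma measurable_prod_borel :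
  measurable_fun setT
    (id : (borelType X * borelType Y)%type -> borelType (X * Y)%type).
Proof.
apply: (@measurability _ _ (borelType X * borelType Y)%type (borelType (X * Y)%type)
  setT id open) => //.
move=> _ [U oU <-]; rewrite setTI preimage_id.
have [g gP] := gd_dense_seq X; have [h hP] := gd_dense_seq Y.
pose Q i j k : set (borelType X * borelType Y)%type :=
  ball (g i) k.+1%:R^-1 `*` ball (h j) k.+1%:R^-1.
have -> : (U : set (borelType X * borelType Y)%type) =
    \bigcup_i \bigcup_j \bigcup_k (if pselect (Q i j k `<=` U) then Q i j k else set0).
  apply/seteqP; split=> [[x y] Uxy|z [i _ [j _ [k _]]]]; last first.
    by case: pselect => // QU; exact: QU.
  move: oU; rewrite openE => /(_ _ Uxy) [[A B]/= [nA nB] ABU].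
  have [e1 e10 eA] := (nbhs_ballP _ _).1 nA; have [e2 e20 eB] := (nbhs_ballP _ _).1 nB.
  have e0 : (0 < Num.min e1 e2 / 2)%R by rewrite divr_gt0// lt_min e10.
  have [k ke] := natSinv_lt e0.
  have k0 : (0 < k.+1%:R^-1 :> R)%R by rewrite invr_gt0.
  have [i xi] := gP x _ k0; have [j yj] := hP y _ k0.
  have k2 : (k.+1%:R^-1 + k.+1%:R^-1 <= Num.min e1 e2)%R.
    by rewrite [leRHS]splitr lerD// ltW.
  exists i => //; exists j => //; exists k => //; case: pselect => [_//|]; case.
  move=> [x' y'] [/= xi' yj']; apply: ABU; split=> /=.
    apply: eA; apply: le_ball (ball_triangle (ball_sym xi) xi').
    by apply: le_trans k2 _; rewrite ge_min lexx.
  apply: eB; apply: le_ball (ball_triangle (ball_sym yj) yj').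
  by apply: le_trans k2 _; rewrite ge_min lexx orbT.
apply: bigcupT_measurable => i; apply: bigcupT_measurable => j.
apply: bigcupT_measurable => k; case: (pselect (Q i j k `<=` U)) => QU; last exact: measurable0.
by rewrite /Q; apply: measurableX; apply: open_borel; exact: ball_mopen.
Qed.

Lemma gd_cell_coupling K (C : nat -> set X) (D : nat -> set Y) :
  (forall j, measurable (C j : set (borelType X))) ->
  (forall j, measurable (D j : set (borelType Y))) ->
  trivIset setT C -> trivIset setT D ->
  exists pi : probability (borelType (X * Y)%type) R, coupling pi /\
    forall j, (j < K)%N -> mine (gd_mu X (C j)) (gd_mu Y (D j)) <= pi (C j `*` D j).
Proof.
move=> mC mD tC tD.
have [pi [pi1 pi2 pim]] := @cell_coupling R _ _ (borelType X) (borelType Y)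
  (gd_mu X) (gd_mu Y) K C D mC mD tC tD.
have [nu nuE] := pushforward_probability pi measurable_prod_borel.
exists nu; split; last by move=> j jm; rewrite -nuE; exact: pim.
split=> [A mA|B mB].
  rewrite -pi1// -nuE /pushforward preimage_id; congr (pi _).
  by apply/seteqP; split=> z //= -[].
rewrite -pi2// -nuE /pushforward preimage_id; congr (pi _).
by apply/seteqP; split=> z //= -[].
Qed.

End gd_coupling.

(** * Cells that are stable under a small change of the law *)

Section cells.
Context {R : realType} {N : nat}.
Local Notation V := 'rV[R]_N.

(** A neighbourhood of the sphere of radius [rho] around [z]. *)
Definition shell (z : V) (rho w : R) : set V := [set x | (`| `|z - x| - rho | < w)%R].

Lemma open_shell z rho w : open (shell z rho w).
Proof.
rewrite openE => x xw; apply/nbhs_ballP.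
exists (w - `| `|z - x| - rho |)%R => /=; first by rewrite subr_gt0.
move=> y; rewrite -ball_normE/= => xy; rewrite /shell/=.
have h1 := ler_dist_dist (z - y)%R (z - x)%R.
have h2 := ler_distD `|z - x|%R `|z - y|%R rho.
have h3 : (`|z - y - (z - x)| = `|x - y|)%R.
  by congr Num.norm; rewrite opprB addrC subrKA.
move: h1; rewrite h3 => h1; lra.
Qed.

Lemma measurable_shell z rho w : measurable (shell z rho w : set (borelType V)).
Proof. by apply: open_borel; exact: open_shell. Qed.

(** Among [M] disjoint shells around [z], one has mass at most [1 / M]. *)
Lemma thin_shell (P : probability (borelType V) R) (z : V) (d w : R) (M : nat) :
  (0 < M)%N -> (0 < w)%R ->
  exists2 s, (s < M)%N & P (shell z (d + (s.*2.+1)%:R * w)%R w) <= (M%:R^-1)%:E.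
Proof.
move=> M0 w0; apply: contrapT => nP.
pose T s : set (borelType V) := shell z (d + (s.*2.+1)%:R * w)%R w.
have mT s : measurable (T s) by exact: measurable_shell.
have PT s : (s < M)%N -> (M%:R^-1)%:E < P (T s).
  by move=> sM; rewrite ltNge; apply/negP => h; apply: nP; exists s.
have tT : trivIset setT T.
  apply/trivIsetP => i j _ _; wlog ij : i j / (i < j)%N.
    move=> h /[dup]; rewrite {1}neq_ltn => /orP[ij|ji] ne; first exact: h.
    by rewrite setIC; apply: h => //; rewrite eq_sym.
  move=> _; apply/seteqP; split=> // x [].
  rewrite /T /shell/= !ltr_norml => /andP[i1 i2] /andP[j1 j2].
  have : ((i.*2.+1)%:R + 2 <= (j.*2.+1)%:R :> R)%R.
    by rewrite -natrD ler_nat addn2 ltnS -doubleS leq_double.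
  move/(ler_wpM2r (ltW w0)); lra.
have : P (\big[setU/set0]_(s < M) T s) <= 1.
  by apply: probability_le1; apply: bigsetU_measurable => i _.
rewrite (measure_bigsetU P mT tT) leNgt => /negP; apply.
apply: (@le_lt_trans _ _ (\sum_(s < M) (M%:R^-1)%:E)).
  by rewrite sumEFin sumr_const card_ord -[(_ *+ M)%R]mulr_natr mulVf// pnatr_eq0 -lt0n.
case: M M0 nP PT => // M _ _ PT; rewrite !big_ord_recl; apply: lte_leD => //.
- by rewrite sumEFin.
- exact: PT.
- by apply: lee_sum => i _; apply/ltW/PT; exact: ltn_ord (lift ord0 i).
Qed.

(** A ball whose boundary sphere has little mass near it is found among
finitely many concentric ones by [thin_shell]; the successive differences of such
balls are small cells whose boundaries carry little mass. A point of a cell that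
is away from all the boundaries stays in the cell after a small move, so every
law close to [P] gives the cell at least almost the same mass. *)
Lemma stable_cells (K : set V) (P : probability (borelType V) R) (e : R) :
  closed K -> P K = 1 -> (0 < e)%R ->
  exists (d : R) (m : nat) (C : nat -> set V),
  [/\ (0 < d)%R, (forall j, measurable (C j : set (borelType V))), trivIset setT C,
      (forall j x y, C j x -> C j y -> ball x e y) &
      forall nu, law_on K nu -> pclose K d P nu ->
        1 - e%:E <= \sum_(j < m) mine (P (C j)) (nu (C j))].
Proof.
move=> cK PK e0; have mK := closed_borel cK.
(* Radii range over [a, 2a], so that two points of a cell are within [4a = e]. *)
pose a : R := (e / 4)%R; have a0 : (0 < a)%R by rewrite divr_gt0.
have e30 : (0 < e / 3)%R by rewrite divr_gt0.
have [z zP] := @rV_dense_seq R N.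
pose B0 j : set (borelType V) := ball (z j) a.
have [||||m Pm] := @prob_increasing_cover R _ (borelType V) P
    (fun n => \big[setU/set0]_(j < n) B0 j) (e / 3)%R.
- move=> n; apply: bigsetU_measurable => j _.
  by apply: open_borel; exact: ball_open.
- by move=> n1 n2 n12; apply/subsetPset; exact: subset_bigsetU.
- rewrite (_ : \bigcup_n _ = setT) ?probability_setT//.
  apply/seteqP; split=> // x _; have [n xn] := zP x a a0.
  by exists n.+1 => //; rewrite -bigcup_mkord; exists n => /=.
- exact: e30.
(* [m] balls cover all but mass [e / 3]; the [m] boundaries and the [m]
   Prokhorov errors may then cost [c] each. *)
pose c : R := (e / 3 / m.+1%:R)%R; have c0 : (0 < c)%R by rewrite divr_gt0.
have mc : (m%:R * c <= e / 3)%R.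
  rewrite /c mulrCA -[leRHS]mulr1 ler_pM2l// ler_pdivrMr ?ltr0n// mul1r.
  by rewrite ler_nat.
have [n nc] := natSinv_lt c0.
pose M := n.+1.
pose w : R := (a / (M * 2)%:R)%R.
have w0 : (0 < w)%R by rewrite divr_gt0.
have /choice[s sP] : forall j, exists s, (s < M)%N /\
    P (shell (z j) (a + (s.*2.+1)%:R * w)%R w) <= (M%:R^-1)%:E.
  by move=> j; have [s sM Ps] := @thin_shell P (z j) a w M isT w0; exists s.
pose rho j : R := (a + ((s j).*2.+1)%:R * w)%R.
have rho_a j : (a <= rho j)%R by rewrite lerDl mulr_ge0// ltW.
have rho_2a j : (rho j <= a + a)%R.
  rewrite lerD2l /w mulrA ler_pdivrMr// mulrC ler_pM2l//.
  by rewrite ler_nat muln2 ltnW// -doubleS leq_double; have [] := sP j.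
pose F j : set (borelType V) := ball (z j) (rho j).
have mF j : measurable (F j) by apply: open_borel; exact: ball_open.
pose C := seqDU F.
pose T j : set (borelType V) := shell (z j) (rho j) w.
have mT j : measurable (T j) by exact: measurable_shell.
pose G : set (borelType V) := ~` \big[setU/set0]_(j < m) T j.
have mG : measurable G by apply: measurableC; apply: bigsetU_measurable => j _.
have mC j : measurable (C j) by apply: measurableD => //; exact: bigsetU_measurable.
pose d := Num.min w c.
have d0 : (0 < d)%R by rewrite lt_min w0.
exists d, m, C; split=> //.
- exact: trivIset_seqDU.
- move=> j x y [Fx _] [Fy _].
  apply: le_ball (ball_triangle (ball_sym Fx) Fy).
  by have := rho_2a j; rewrite /a; lra.
move=> nu lnu Pnu.
have core j : (j < m)%N -> P (C j `&` G) <= nu (C j) + d%:E.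
  move=> jm; have mCG : measurable (C j `&` G) by exact: measurableI.
  rewrite -(prob_setI_full mK mCG PK).
  have [+ _] := Pnu _ (measurableI _ _ mCG mK) (@subIsetr _ _ _).
  move/le_trans; apply; rewrite leeD2r//; apply: (law_le lnu) => //.
    exact: fatten_measurable.
  move=> y [_ [x [[[Fx nFx] Gx] _]]]; rewrite -ball_normE/= => xy.
  have xyw : (`|x - y| < w)%R by apply: lt_le_trans xy _; rewrite ge_min lexx.
  have noT k : (k < m)%N -> (w <= `| `|z k - x| - rho k|)%R.
    move=> km; rewrite leNgt; apply/negP => Tx; apply: Gx.
    by rewrite -(bigcup_mkord m T); exists k.
  split.
    have := noT j jm; move: Fx; rewrite /F -ball_normE/=.
    have := ler_distD x (z j) y; rewrite ler_normr; lra.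
  rewrite -(bigcup_mkord j F) => -[k /= kj Fy]; apply: nFx.
  rewrite -(bigcup_mkord j F); exists k => //.
  have := noT k (ltn_trans kj jm); move: Fy; rewrite /F -!ball_normE/=.
  have := ler_distD y (z k) x; rewrite (distrC y x) ler_normr; lra.
have core2 j : (j < m)%N -> P (C j `&` G) <= mine (P (C j)) (nu (C j)) + d%:E.
  move=> jm; rewrite /mine; case: ifP => _; last exact: core.
  apply: (@le_trans _ _ (P (C j))); last by rewrite leeDl// lee_fin ltW.
  by rewrite le_measure ?inE//; exact: measurableI.
have sumT : P (\big[setU/set0]_(j < m) T j) <= (e / 3)%:E.
  apply: le_trans (le_mu_bigsetU P (fun j _ => mT j)) _.
  apply: (@le_trans _ _ (\sum_(j < m) c%:E)).
    apply: lee_sum => j _; have [_] := sP j; move/le_trans; apply.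
    by rewrite lee_fin ltW.
  by rewrite sumEFin sumr_const card_ord lee_fin -[(c *+ m)%R]mulr_natl.
have sumCG : P (\big[setU/set0]_(j < m) (C j `&` G)) <=
    \sum_(j < m) mine (P (C j)) (nu (C j)) + (e / 3)%:E.
  rewrite (measure_bigsetU P (F := fun j => C j `&` G)).
  - apply: (@le_trans _ _ (\sum_(j < m) (mine (P (C j)) (nu (C j)) + d%:E))).
      by apply: lee_sum => j _; apply: core2.
    rewrite big_split/= leeD2l// sumEFin sumr_const card_ord lee_fin -[(d *+ m)%R]mulr_natl.
    by apply: le_trans mc; rewrite ler_wpM2l// ge_min lexx orbT.
  - by move=> j; exact: measurableI.
  - exact/trivIset_setIr/trivIset_seqDU.
rewrite leeBlDr//; move: Pm; rewrite lteBlDr// => /ltW/le_trans; apply.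
have -> : e%:E = (e / 3)%:E + (e / 3)%:E + (e / 3)%:E.
  by rewrite -!EFinD; congr EFin; lra.
rewrite !addeA; apply: leeD2r.
apply: le_trans (leeD sumCG sumT); last first.
apply: (@le_trans _ _ (P (\big[setU/set0]_(j < m) (C j `&` G) `|` \big[setU/set0]_(j < m) T j))).
  have mU1 : measurable (\big[setU/set0]_(j < m) (C j `&` G)).
    by apply: bigsetU_measurable => j _; exact: measurableI.
  have mU2 : measurable (\big[setU/set0]_(j < m) T j) by exact: bigsetU_measurable.
  rewrite le_measure ?inE//; first by apply: bigsetU_measurable => j _; apply: open_borel; exact: ball_open.
    exact: measurableU.
  move=> x Bx; have [Tx|nTx] := pselect ((\big[setU/set0]_(j < m) T j) x); [by right|left].
  have : (\big[setU/set0]_(j < m) F j) x.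
    move: Bx; rewrite -(bigcup_mkord m B0) -(bigcup_mkord m F) => -[j jm Bx].
    by exists j => //; apply: le_ball Bx; exact: rho_a.
  rewrite bigsetU_seqDU -(bigcup_mkord m (seqDU F)) => -[j jm Cx].
  by rewrite -(bigcup_mkord m (fun j => C j `&` G)); exists j.
apply: measureU2; first by apply: bigsetU_measurable => j _; exact: measurableI.
exact: bigsetU_measurable.
Qed.

End cells.

(** * Box approximation by finite measurements *)

Section finite_patterns.
Context {R : realType}.

(** Total boundedness of a bounded family of vectors, with a net inside the
family. *)
Lemma finite_patterns (T : Type) (F : set T) n (phi : T -> 'I_n -> R) (D e : R) :
  F !=set0 -> (0 < e)%R -> (forall h j, F h -> (`|phi h j| <= D)%R) ->
  exists N (f : 'I_N -> T), [/\ (0 < N)%N, (forall i, F (f i)) &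
    forall h, F h -> exists i, forall j, (`|phi h j - phi (f i) j| <= e)%R].
Proof.
move=> [f0 Ff0] e0 phiD.
pose q h j : R := ((phi h j + D) / e)%R.
have q0 h j : F h -> (0 <= q h j)%R.
  move=> /(phiD _ j); rewrite ler_norml => /andP[h1 _].
  by rewrite divr_ge0 ?(ltW e0)//; lra.
pose M := Num.truncn ((D + D) / e)%R.
have qM h j : F h -> (Num.truncn (q h j) <= M)%N.
  move=> /(phiD _ j); rewrite ler_norml => /andP[_ h2].
  by apply: le_truncn; rewrite ler_wpM2r ?invr_ge0 ?(ltW e0)// lerD2r.
(* vectors with the same integer parts of their rescaled coordinates are
   [e]-close *)
pose code h : {ffun 'I_n -> 'I_M.+1} := [ffun j => inord (Num.truncn (q h j))].
have /choice[pick pickP] : forall t, exists h, F h /\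
    forall k, F k -> code k = t -> code h = t.
  move=> t; have [[k [Fk kt]]|nk] := pselect (exists k, F k /\ code k = t).
    by exists k.
  by exists f0; split=> // k Fk kt; case: nk; exists k.
have Fpick t : F (pick t) by have [] := pickP t.
have pickE h : F h -> code (pick (code h)) = code h.
  by move=> Fh; have [_ /(_ h Fh)] := pickP (code h); exact.
exists #|{ffun 'I_n -> 'I_M.+1}|, (fun i => pick (enum_val i)).
split=> [|//|h Fh]; first by apply/card_gt0P; exists (code f0).
exists (enum_rank (code h)) => j; rewrite enum_rankK.
have /ffunP/(_ j) := pickE h Fh; rewrite !ffunE => /(congr1 val)/=.
rewrite !inordK ?ltnS ?qM// => qE.
have := Num.Theory.truncn_itv (q0 h j Fh).
have := Num.Theory.truncn_itv (q0 _ j (Fpick (code h))).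
rewrite qE => /andP[a1 a2] /andP[b1 b2].
have : (`|q h j - q (pick (code h)) j| <= 1)%R.
  by rewrite ler_norml; move: a2 b2; rewrite -natr1; lra.
have -> : (q h j - q (pick (code h)) j = (phi h j - phi (pick (code h)) j) / e)%R.
  by rewrite /q -mulrBl; congr (_ * _)%R; lra.
by rewrite normrM normfV (gtr0_norm e0) ler_pdivrMr// mul1r.
Qed.

End finite_patterns.

Section finite_approximation.
Context {R : realType} (L : set (R -> R)).
Hypothesis monL : monoidal L.
Hypothesis TBL : @TB R `<=` L.

Lemma translation_L c : L (fun t => t + c)%R.
Proof.
apply: TBL; exists c, -oo, +oo; split=> // t.
by rewrite /mine ltry /maxe ltNyr.
Qed.

Lemma truncation_L r : (0 <= r)%R -> L (truncation r).
Proof.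
move=> r0; apply: TBL; exists 0%R, (- r)%:E, r%:E; split=> //.
  by rewrite lee_fin; lra.
by move=> t; rewrite addr0 /truncation EFin_max EFin_min.
Qed.

(** The functions of [A] that vanish at [x0] are bounded on a finite net, because they
are 1-Lipschitz, so finitely many of them represent all up to [e]. *)
Lemma finite_functions (A : gdset R) (x0 : A) (s : seq A) (e : R) : (0 < e)%R ->
  exists N (f : 'I_N -> A -> R), [/\ (0 < N)%N, (forall i, gd_fam A (f i)) &
    forall h, gd_closure A h -> exists i c, forall x, near_seq s e x ->
      (`|h x - (f i x + c)| <= e *+ 5)%R].
Proof.
move=> e0.
pose phi (h : A -> R) (j : 'I_(size s)) : R := (h (nth x0 s j) - h x0)%R.
have [|N [f [N0 Ff fP]]] := @finite_patterns R _ (gd_fam A) (size s) phi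
   (\sum_(j < size s) mdist (nth x0 s j) x0)%R e (gd_fam_nonempty A) e0.
  move=> h j Fh; apply: le_trans (gd_fam_lip1 Fh _ _) _.
  rewrite (bigD1 j)//= lerDl; apply: sumr_ge0 => i _; exact: mdist_ge0.
exists N, f; split=> // h clh.
have [k Fk hk] := (gd_closureP h).1 clh (x0 :: s) _ e0.
have [i ki] := fP k Fk; exists i, (h x0 - f i x0)%R => x sx.
have lg : lip1 (fun y => f i y + (h x0 - f i x0))%R.
  move=> y z; rewrite opprD addrACA subrr addr0; exact: gd_fam_lip1.
have := lip1_near_seq (gd_closure_lip1 clh) lg (d := (e *+ 3)%R) _ sx.
rewrite -!mulr2n -mulrnDr; apply => y ys.
have hx0 : (`|h x0 - k x0| < e)%R by apply: hk; rewrite inE eqxx.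
have hy : (`|h y - k y| < e)%R by apply: hk; rewrite inE ys orbT.
have iy : (index y s < size s)%N by rewrite index_mem.
have := ki (Ordinal iy); rewrite /phi/= nth_index//.
move: hx0 hy; rewrite !ltr_norml !ler_norml -mulr_natr; lra.
Qed.

End finite_approximation.

Section box_approximation.
Context {R : realType} (L : set (R -> R)).
Hypothesis monL : monoidal L.
Hypothesis TBL : @TB R `<=` L.

Lemma LD_truncation (X : gdset R) r f : LD L X -> (0 <= r)%R ->
  gd_closure X f -> gd_closure X (truncation r \o f).
Proof. by move=> LX r0 clf; apply: LX => //; exact: truncation_L. Qed.

Lemma gd_closure_coord (A : gdset R) N r (f : 'I_N -> A -> R) p i :
  LD L A -> (0 <= r)%R -> (forall i, gd_fam A (f i)) -> L p ->
  gd_closure A (fun a => p (row_fun r f a ord0 i)).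
Proof.
move=> LA r0 Ff Lp.
rewrite (_ : (fun _ => _) = p \o (truncation r \o f i)).
  exact: (LA _ _ Lp (LD_truncation LA r0 (gd_fam_closure (Ff i)))).
by apply/funext => a; rewrite /= mxE.
Qed.

Lemma ball_coord N (v w : 'rV[R]_N) e i : ball v e w -> (`|v ord0 i - w ord0 i| < e)%R.
Proof. by case=> _; exact. Qed.

(** A function of [A] is close to some [f i + c], which corresponds to the
coordinate [i] followed by a translation. A function of [Y] agrees, on finitely many
points, with some [p o x_i], which corresponds to [p o f i]; the finitely many
points are chosen near the image of the net [s], which is all that [S] sees. *)
Lemma coordinate_hausdorff (A Y : gdset R) N r (f : 'I_N -> A -> R) (e : R)
    (P : probability (borelType 'rV[R]_N) R) (v : Y -> 'rV[R]_N) (s : seq A)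
    (S : set (A * Y)) :
  LD L A -> (0 < e)%R -> (0 <= r)%R -> (forall i, gd_fam A (f i)) ->
  (forall h, gd_closure A h -> exists i c, forall x, near_seq s e x ->
      (`|h x - (f i x + c)| <= e *+ 5)%R) ->
  (forall i x, near_seq s e x -> (- r <= f i x <= r)%R) ->
  is_coordinate_gdset L P v ->
  (forall z, S z -> near_seq s e z.1 /\ ball (row_fun r f z.1) (e + e)%R (v z.2)) ->
  hausdorff_sup_dist_on S
    [set h \o (fst : A * Y -> A) | h in gd_closure A]
    [set g \o (snd : A * Y -> Y) | g in gd_closure Y] <= (e *+ 20)%:E.
Proof.
move=> LA e0 r0 Ff fP fr cY SP; have [q [vb FY _ _ _]] := cY.
rewrite /hausdorff_sup_dist_on; case: ifPn => [_|/set0P[z0 Sz0]].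
  by rewrite lee_fin mulrn_wge0// ltW.
have nu : nonexpansive (row_fun r f).
  by apply: nonexpansive_row_fun => i; exact: gd_fam_lip1.
rewrite /hausdorff_dist ge_max; apply/andP; split; apply: ge_ereal_sup => _ [_ [h clh <-] <-].
- have [i [c hc]] := fP h clh.
  apply: (@le_trans _ _ (sup_dist_on S (h \o fst) ((fun y => v y ord0 i + c)%R \o snd))).
    apply: ereal_inf_lbound; exists ((fun y => v y ord0 i + c)%R \o snd) => //.
    exists (fun y => v y ord0 i + c)%R => //.
    apply: gd_fam_closure; apply: (coord_fam cY (p := fun t => (t + c)%R)).
    exact: translation_L.
  apply: ge_ereal_sup => _ [z Sz <-]; rewrite lee_fin /=.
  have [s1 /(ball_coord i)] := SP z Sz.
  rewrite mxE truncation_id; last exact: fr.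
  have := hc _ s1; rewrite ltr_norml !ler_norml.
  by move: (h z.1) (f i z.1) (v z.2 ord0 i) => h1 h2 h3; lra.
- pose near b y := ball (row_fun r f b) (e *+ 4)%R (v y).
  (* one point of [Y] for each point of the net that [S] relates to some point *)
  have /choice[yy yyP] : forall b, exists y0 : Y, forall y, near b y -> near b y0.
    move=> b; have [[y by0]|nb] := pselect (exists y, near b y); first by exists y.
    by exists point => y yb; case: nb; exists y.
  have [g Fg hg] := (gd_closureP h).1 clh [seq yy b | b <- s] _ e0.
  move: (Fg); rewrite FY => -[p [i [Lp gE]]].
  apply: (@le_trans _ _ (sup_dist_on S ((fun a => p (row_fun r f a ord0 i)) \o fst) (h \o snd))).
    apply: ereal_inf_lbound; exists ((fun a => p (row_fun r f a ord0 i)) \o fst) => //.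
    by exists (fun a => p (row_fun r f a ord0 i)) => //; exact: gd_closure_coord.
  apply: ge_ereal_sup => _ [[a y] Say <-]; rewrite lee_fin /=.
  have [[b bs ba] uv] := SP _ Say; rewrite /= in ba uv.
  have ba' : ball b (e + e)%R a by rewrite ballEmdist/=; lra.
  have nby : near b y.
    rewrite /near; apply: le_ball (ball_triangle (nu _ _ _ ba') uv).
    by lra.
  have nbyy := yyP b y nby.
  have vyy : ball (v y) (e *+ 8)%R (v (yy b)).
    apply: le_ball (ball_triangle (ball_sym nby) nbyy).
    by lra.
  have h1 : (`|h (yy b) - g (yy b)| < e)%R by apply: hg; exact: map_f.
  have h2 : (`|h y - h (yy b)| < e *+ 8)%R.
    apply: le_lt_trans (gd_closure_lip1 clh _ _) _.
    by move: vyy; rewrite -vb ballEmdist.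
  have h3 : (`|g y - g (yy b)| < e *+ 8)%R.
    apply: le_lt_trans (gd_fam_lip1 Fg _ _) _.
    by move: vyy; rewrite -vb ballEmdist.
  have h4 : (`|p (row_fun r f a ord0 i) - g y| < e + e)%R.
    rewrite gE; apply: le_lt_trans (monoidal_lip monL Lp _ _) _.
    exact: ball_coord.
  move: h1 h2 h3 h4; rewrite !ltr_norml ler_norml.
  by move: (h y) (h (yy b)) (g (yy b)) (g y) (p _) => h1 h2 h3 h4 h5; lra.
Qed.

(** With [f] a finite family that represents all functions of [A], the coordinate
gd-set [Y] of the law of [g] is box-close to [A]: the cells of [stable_cells]
couple the two laws so that the values of [f] are close to the coordinates of
[Y] with large probability, and [coordinate_hausdorff] applies. *)
Lemma box_from_measurement (A : gdset R) (e : R) : LD L A -> (0 < e)%R ->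
  exists N (r d : R) (f : 'I_N -> A -> R),
  [/\ (0 < N)%N, (0 < r)%R, (0 < d)%R, (forall i, gd_fam A (f i)) &
    forall (B : gdset R) (g : 'I_N -> B -> R), LD L B -> (forall i, gd_fam B (g i)) ->
      pclose (cube N r) d (gd_law r f) (gd_law r g) ->
      exists Y, [/\ LD L Y, gd_le Y B & box A Y < e%:E]].
Proof.
(* twice the bound [eta *+ 20] of [coordinate_hausdorff] has to be below [e] *)
move=> LA e0; pose eta : R := (e / 41)%R; have eta0 : (0 < eta)%R by rewrite divr_gt0.
have [s Ps] := gd_finite_net A eta0.
have [N [f [N0 Ff fP]]] := finite_functions point s eta0.
(* so large that the truncation does not affect [f] near the net *)
pose r : R := (1 + eta + \sum_(y <- s) \sum_i `|f i y|)%R.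
have sum0 t : (0 <= \sum_(y <- t) \sum_i `|f i y|)%R.
  by apply: sumr_ge0 => y _; exact: sumr_ge0.
have r0 : (0 < r)%R by have := sum0 s; rewrite /r; lra.
have fr i x : near_seq s eta x -> (- r <= f i x <= r)%R.
  move=> [y ys yx]; have := gd_fam_lip1 (Ff i) y x.
  have : (`|f i y| <= \sum_(y <- s) \sum_i `|f i y|)%R.
    rewrite (big_rem y)//= (bigD1 i)//= -addrA lerDl addr_ge0 ?sum0//.
    by apply: sumr_ge0 => z _.
  by rewrite /r !ler_norml; lra.
have lf i : lip1 (f i) by exact: gd_fam_lip1.
have bu := borel_row_fun r lf.
have nu : nonexpansive (row_fun r f) by exact: nonexpansive_row_fun.
have [P PE] := pushforward_probability (gd_mu A) bu.
have PK : P (cube N r) = 1.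
  have [P' P'E P'K] := gd_law_on (ltW r0) lf.
  by rewrite -PE -P'K -P'E.
have [d [m [C [d0 mC tC diamC CP]]]] := stable_cells (@closed_cube R N r) PK eta0.
exists N, r, d, f; split=> // B g LB Fg fg.
have lg i : lip1 (g i) by exact: gd_fam_lip1.
have [Q QE] := pushforward_probability (gd_mu B) (borel_row_fun r lg).
have [Y [v cY]] := coordinate_gdset_exists monL N0 Q.
have lawQ := gd_law_on (ltW r0) lg.
have bv := coord_borel cY.
exists Y; split; first exact: coord_LD cY.
  apply: (coord_le cY (h := fun i => truncation r \o g i)) => //.
    by move=> i; apply: LD_truncation => //; [exact: ltW|exact: (gd_fam_closure (Fg i))].
  by move=> M mM; rewrite -QE.
have mC1 j : measurable (row_fun r f @^-1` C j : set (borelType A)).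
  exact: borel_preimage.
have mC2 j : measurable (v @^-1` C j : set (borelType Y)) by exact: borel_preimage.
have tC1 : trivIset setT (fun j => row_fun r f @^-1` C j).
  apply/trivIsetP => i j _ _ ij; rewrite -preimage_setI.
  by move/trivIsetP : tC => /(_ i j I I ij) ->; rewrite preimage_set0.
have tC2 : trivIset setT (fun j => v @^-1` C j).
  apply/trivIsetP => i j _ _ ij; rewrite -preimage_setI.
  by move/trivIsetP : tC => /(_ i j I I ij) ->; rewrite preimage_set0.
have [pi [cpi piC]] := gd_cell_coupling m mC1 mC2 tC1 tC2.
pose S := [set z : A * Y | near_seq s eta z.1 /\
  (`|row_fun r f z.1 - v z.2| <= eta)%R].
have cS : closed S.
  have -> : S = (fst @^-1` near_seq s eta) `&`
      (fun z : A * Y => `|row_fun r f z.1 - v z.2|%R) @^-1` [set t | (t <= eta)%R].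
    by [].
  apply: closedI.
    by apply: closed_comp => [z _|]; [exact: cvg_fst|exact: closed_near_seq].
  apply: closed_comp => [z _|]; last exact: closed_le.
  apply: cvg_norm; apply: cvgB.
    apply: (@cvg_comp _ _ _ fst (row_fun r f)); first exact: cvg_fst.
    exact: (nonexpansive_continuous nu).
  apply: (@cvg_comp _ _ _ snd v); first exact: cvg_snd.
  by apply: nonexpansive_continuous; exact: coord_nonexpansive cY.
have mS : measurable (S : set (borelType (A * Y)%type)) by exact: closed_borel.
have [cpi1 cpi2] := cpi.
pose K1 : set (borelType (A * Y)%type) := fst @^-1` near_seq s eta.
have bfst : borel_map (fst : A * Y -> A) by apply: continuous_borel => z; exact: cvg_fst.
have bsnd : borel_map (snd : A * Y -> Y) by apply: continuous_borel => z; exact: cvg_snd.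
have mK1 : measurable K1.
  by apply: borel_preimage => //; exact: measurable_near_seq.
have piK1 : pi (~` K1) <= eta%:E.
  rewrite probability_setC// leeBlDr ?fin_num_measure// addeC -leeBlDr//.
  have -> : pi K1 = gd_mu A (near_seq s eta).
    by rewrite -cpi1//; exact: measurable_near_seq.
  exact: ltW.
pose W : set (borelType (A * Y)%type) :=
  \big[setU/set0]_(j < m) ((row_fun r f @^-1` C j) `*` (v @^-1` C j)).
have mX j : measurable ((row_fun r f @^-1` C j) `*` (v @^-1` C j) :
    set (borelType (A * Y)%type)).
  have -> : (row_fun r f @^-1` C j) `*` (v @^-1` C j) =
    fst @^-1` (row_fun r f @^-1` C j) `&` snd @^-1` (v @^-1` C j) :> set (A * Y) by [].
  by apply: measurableI; exact: borel_preimage.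
have mW : measurable W by apply: bigsetU_measurable => j _; exact: mX.
have piW : 1 - eta%:E <= pi W.
  have -> : pi W = \sum_(j < m) pi ((row_fun r f @^-1` C j) `*` (v @^-1` C j)).
    apply: (measure_bigsetU pi
      (F := fun j => (row_fun r f @^-1` C j) `*` (v @^-1` C j))) => //.
    apply/trivIsetP => i j _ _ ij; apply/seteqP; split=> // z [[z1 _] [z2 _]].
    by move/trivIsetP : tC1 => /(_ i j I I ij)/seteqP[h _]; exact: (h z.1).
  apply: le_trans (CP _ lawQ _) _.
    by rewrite -PE.
  apply: lee_sum => j _; apply: le_trans (piC j (ltn_ord j)).
  rewrite -PE (coord_pushforward cY)// -QE.
  exact: lexx.
have piS : 1 - pi S <= (eta + eta)%:E.
  rewrite leeBlDr ?fin_num_measure// addeC EFinD addeA -leeBlDr//.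
  apply: le_trans piW _.
  apply: (@le_trans _ _ (pi (S `|` ~` K1))).
    rewrite le_measure ?inE//; first by apply: measurableU => //; exact: measurableC.
    move=> z Wz; have [K1z|nK1z] := pselect (K1 z); [left; split=> //|by right].
    move: Wz; rewrite /W -(bigcup_mkord m (fun j => (row_fun r f @^-1` C j) `*` (v @^-1` C j))).
    move=> [j _ [z1 z2]]; have := diamC j _ _ z1 z2.
    by rewrite -ball_normE/= => /ltW.
  apply: le_trans (@measureU2 _ _ _ pi _ _ mS (measurableC mK1)) _.
  by rewrite leeD2l.
apply: (@le_lt_trans _ _ (eta *+ 40)%:E); last first.
  by rewrite lte_fin /eta; lra.
apply: (@le_trans _ _ (maxe (1 - pi S) (2%:E * hausdorff_sup_dist_on S
   [set h \o (fst : A * Y -> A) | h in gd_closure A]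
   [set g \o (snd : A * Y -> Y) | g in gd_closure Y]))).
  by apply: ereal_inf_lbound; exists pi, S.
rewrite ge_max; apply/andP; split.
  by apply: le_trans piS _; rewrite lee_fin; lra.
rewrite (_ : (eta *+ 40)%:E = 2%:E * (eta *+ 20)%:E); last first.
  by rewrite -EFinM; congr EFin; lra.
rewrite lee_pmul2l//; apply: (coordinate_hausdorff LA eta0 (ltW r0) Ff fP fr cY).
move=> z [z1 z2]; split=> //; rewrite -ball_normE/=.
by apply: le_lt_trans z2 _; rewrite ltrDl.
Qed.

End box_approximation.

(** * Compactness of the laws on a compact set *)

Lemma filter_forall_lt (F : set_system nat) (FF : Filter F) (P : nat -> nat -> Prop) k :
  (forall i, (i < k)%N -> F [set n | P i n]) ->
  F [set n | forall i, (i < k)%N -> P i n].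
Proof.
elim: k => [|k IH] h; first by apply: filterS filterT.
have h1 := IH (fun i ik => h i (ltnW ik)).
apply: filterS (filterI h1 (h k (leqnn _))) => n [/= a b] i.
by rewrite ltnS leq_eqVlt => /predU1P[->//|]; exact: a.
Qed.

Section ultralimits.
Context {R : realType} (U : set_system nat) (UU : UltraFilter U).

Lemma ultra_limit (a : nat -> R) (b : R) : U [set n | (`|a n| <= b)%R] ->
  exists l : R, forall e, (0 < e)%R -> U [set n | (`|a n - l| < e)%R].
Proof.
move=> Ub; have UP : ProperFilter U by exact: ultra_proper.
have Ua : U (a @^-1` `[(- b)%R, b]).
  by apply: filterS Ub => n; rewrite /preimage/= in_itv/= ler_norml.
have [l [_ cl]] := @segment_compact R (- b)%R b (a @ U) _ Ua.
exists l => e e0; have [//|Un] := @in_ultra_setVsetC _ U [set n | (`|a n - l| < e)%R] UU.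
have Un' : U (a @^-1` (a @` (~` [set n | (`|a n - l| < e)%R]))).
  by apply: filterS Un => n nn; exists n.
have [t [/= [n nn tn]]] := cl _ (ball l e) Un' (nbhsx_ballx _ _ e0).
by rewrite -tn /ball/= distrC => h; case: nn.
Qed.

Lemma ultra_nonempty (A : set nat) : U A -> exists n, A n.
Proof. by move=> UA; have UP : ProperFilter U := ultra_proper; have [n An] := filter_ex UA; exists n. Qed.

Lemma ultra_limit_unique (a b : nat -> R) (l m : R) :
  (forall e, (0 < e)%R -> U [set n | (`|a n - l| < e)%R]) ->
  (forall e, (0 < e)%R -> U [set n | (`|b n - m| < e)%R]) ->
  (forall n, a n = b n) -> l = m.
Proof.
move=> al bm ab; have UP : ProperFilter U by exact: ultra_proper.
apply/eqP; rewrite -subr_eq0 -normr_le0; apply/ler_addgt0Pr => e e0.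
have e20 : (0 < e / 2)%R by rewrite divr_gt0.
have [n [/= n1 n2]] := ultra_nonempty (filterI (al _ e20) (bm _ e20)).
by move: n1 n2; rewrite ab add0r !ltr_norml ler_norml; lra.
Qed.

End ultralimits.

Section binary_codes.
Context (T : Type) (D : nat -> set T).

(** The binary word of the memberships of [x] in [D 0], ..., [D (j - 1)], read as a
number below [2 ^ j]: the cells of level [j] are its fibers. *)
Fixpoint code (j : nat) (x : T) : nat :=
  if j is i.+1 then ((code i x).*2 + `[< D i x >])%N else 0.

Lemma codeS_half j x : (code j.+1 x)./2 = code j x.
Proof. by rewrite /= addnC half_bit_double. Qed.

Lemma code_mono i j x y : (i <= j)%N -> code j x = code j y -> code i x = code i y.
Proof.
move=> /subnK <-; elim: (j - i)%N => // k IH /(congr1 half).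
by rewrite !codeS_half.
Qed.

Lemma code_eq i j x y : (i < j)%N -> code j x = code j y -> D i x -> D i y.
Proof.
move=> ij /(code_mono ij)/(congr1 odd).
rewrite /= !oddD !odd_double/= !oddb => h /asboolP; rewrite h => /asboolP.
exact.
Qed.

Lemma code_lt j x : (code j x < 2 ^ j)%N.
Proof.
elim: j => //= j IH; rewrite expnS mul2n.
case: asboolP => _; rewrite ?addn1 ?addn0.
  by rewrite -doubleS leq_double.
by rewrite ltn_double.
Qed.

End binary_codes.

Lemma code_measurable d (T : measurableType d) (D : nat -> set T) :
  (forall j, measurable (D j)) -> forall j k, measurable [set x | code D j x = k].
Proof.
move=> mD; elim=> [|j IH] k.
  have [->|k0] := eqVneq k 0%N.
    by rewrite (_ : mkset _ = setT)//; apply/seteqP; split.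
  rewrite (_ : mkset _ = set0)//; apply/seteqP; split=> x //=.
  by move=> /esym/eqP; rewrite (negbTE k0).
rewrite (_ : mkset _ = [set x | code D j x = k./2] `&`
    (if odd k then D j else ~` D j)); last first.
  apply/seteqP; split=> x /=.
    move=> <-; rewrite addnC half_bit_double oddD odd_double addbF oddb.
    by split=> //; case: asboolP.
  move=> [->]; rewrite -[in RHS](odd_double_half k) addnC.
  by case: (odd k) => h; [rewrite asboolT|rewrite asboolF].
by apply: measurableI => //; case: (odd k) => //; exact: measurableC.
Qed.

(** All balls with rational centers and radii [1 / (m + 1)]: by compactness finitely
many balls of a given radius cover [K], so that from some level on the points of
a cell are close. *)
Lemma separating_balls (R : realType) N (K : set 'rV[R]_N) : compact K ->
  exists D : nat -> set 'rV[R]_N, (forall j, open (D j)) /\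
    forall e : R, (0 < e)%R -> exists j, forall x y, K x -> K y ->
      code D j x = code D j y -> ball x e y.
Proof.
move=> cK; have [g gP] := @rV_dense_seq R N.
pose B (p : nat * nat) : set 'rV[R]_N := ball (g p.1) p.2.+1%:R^-1.
exists (fun j => oapp B set0 (@unpickle (nat * nat)%type j)); split.
  move=> j; case: unpickle => [p|]/=; [exact: ball_open|exact: open0].
move=> e e0; have e20 : (0 < e / 2)%R by rewrite divr_gt0.
have [b be] := natSinv_lt e20.
have b0 : (0 < b.+1%:R^-1 :> R)%R by rewrite invr_gt0.
move: cK; rewrite compact_cover => /(_ nat setT (fun a => B (a, b))).
case=> [a _|x _|M _ KM].
- exact: ball_open.
- by have [n xn] := gP x _ b0; exists n.
pose j := (\max_(a <- finmap.enum_fset M) (@pickle (nat * nat)%type (a, b))).+1.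
exists j => x y Kx Ky xy; have [a aM xa] := KM x Kx.
have aj : (@pickle (nat * nat)%type (a, b) < j)%N.
  by rewrite ltnS; rewrite (big_rem a)/=; [exact: leq_maxl|exact: aM].
have := code_eq aj xy; rewrite /= pickleK/= => /(_ xa) ya.
apply: le_ball (ball_triangle (ball_sym xa) ya).
by rewrite [leRHS]splitr lerD// ltW.
Qed.

(** Skorokhod representation gives the limit law. The masses of the cells converge
along an ultrafilter. The limit masses need not come from a measure on the
original cells, since mass may move to the boundaries of cells, but they cut
[0, 1[ into nested intervals; sending [t] to a limit of points in the cells whose
intervals contain [t] defines a Borel map [h], and the limit law is the image of
the Lebesgue measure by [h]. *)
Section prokhorov_compactness.
Context {R : realType} {N : nat} (K : set 'rV[R]_N).
Local Notation V := 'rV[R]_N.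
Hypotheses (compK : compact K) (closedK : closed K).
Context (P_ : nat -> probability (borelType V) R) (PK : forall n, P_ n K = 1).
Context (U : set_system nat) (UU : UltraFilter U).
Context (D : nat -> set V) (oD : forall j, open (D j)).
Hypothesis sepD : forall e : R, (0 < e)%R -> exists j, forall x y, K x -> K y ->
  code D j x = code D j y -> ball x e y.

Let mK : measurable (K : set (borelType V)) := closed_borel closedK.

Let UP : ProperFilter U := ultra_proper.

Let cell j k : set (borelType V) := [set x | code D j x = k].

Let mcell j k : measurable (cell j k).
Proof.
by apply: (@code_measurable _ (borelType V)) => i; apply: open_borel; exact: oD.
Qed.

Let mass n j k : R := fine (P_ n (cell j k)).

Let massE n j k : P_ n (cell j k) = (mass n j k)%:E.
Proof. by rewrite fineK// fin_num_measure. Qed.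

Let mass_ge0 n j k : (0 <= mass n j k)%R.
Proof. exact: fine_ge0. Qed.

Let mass_le1 n j k : (mass n j k <= 1)%R.
Proof. by rewrite -lee_fin -massE probability_le1. Qed.

Let mass_split n j k :
  (mass n j k = mass n j.+1 k.*2 + mass n j.+1 k.*2.+1)%R.
Proof.
apply: EFin_inj; rewrite EFinD -!massE -measureU//.
  congr (P_ n _); apply/seteqP; split=> x.
    move=> xk; rewrite /cell/= xk.
    by case: asboolP => _; [right; rewrite /= addn1|left; rewrite /= addn0].
  have hx := codeS_half D j x.
  by move=> [h|h]; move: hx; rewrite [code D j.+1 x]h /= ?doubleK ?uphalf_double => /esym.
apply/seteqP; split=> // x [h1 h2].
have : code D j.+1 x = k.*2 by [].
by rewrite [code D j.+1 x]h2 => /esym/n_Sn.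
Qed.

Let limits : exists m : nat -> nat -> R, forall j k e, (0 < e)%R ->
  U [set n | (`|mass n j k - m j k| < e)%R].
Proof.
have /choice[m mP] : forall p : nat * nat, exists l, forall e, (0 < e)%R ->
    U [set n | (`|mass n p.1 p.2 - l| < e)%R].
  move=> [j k]; apply: (ultra_limit UU (b := 1%R)).
  apply: filterS filterT => n _ /=; rewrite ger0_norm//.
by exists (fun j k => m (j, k)) => j k; exact: mP (j, k).
Qed.

Let m : nat -> nat -> R := sval (cid limits).
Let mP : forall j k e, (0 < e)%R -> U [set n | (`|mass n j k - m j k| < e)%R].
Proof. exact: svalP (cid limits). Qed.

Let m_ge0 j k : (0 <= m j k)%R.
Proof.
rewrite leNgt; apply/negP => m0; have e0 : (0 < - m j k)%R by rewrite oppr_gt0.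
have [n /=] := ultra_nonempty UU (mP j k e0).
by have := mass_ge0 n j k; rewrite ltr_norml; lra.
Qed.

Let m_split j k : (m j k = m j.+1 k.*2 + m j.+1 k.*2.+1)%R.
Proof.
apply: (ultra_limit_unique UU (mP j k) (b := fun n => mass n j.+1 k.*2 + mass n j.+1 k.*2.+1)%R).
  move=> e e0; have e20 : (0 < e / 2)%R by rewrite divr_gt0.
  apply: filterS (filterI (mP j.+1 k.*2 e20) (mP j.+1 k.*2.+1 e20)) => n [/= h1 h2].
  by move: h1 h2; rewrite !ltr_norml; lra.
by move=> n; exact: mass_split.
Qed.

Let m_out j k : (2 ^ j <= k)%N -> m j k = 0%R.
Proof.
move=> jk; apply: (ultra_limit_unique UU (mP j k) (b := fun=> 0%R)) => [e e0|n].
  by apply: filterS filterT => n _ /=; rewrite subrr normr0.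
rewrite /mass (_ : cell j k = set0) ?measure0//.
by apply/seteqP; split=> // x /= xk; have := code_lt D j x; rewrite xk ltnNge jk.
Qed.

Let m00 : m 0 0 = 1%R.
Proof.
apply: (ultra_limit_unique UU (mP 0 0) (b := fun=> 1%R)) => [e e0|n].
  by apply: filterS filterT => n _ /=; rewrite subrr normr0.
by rewrite /mass (_ : cell 0 0 = setT) ?probability_setT//; apply/seteqP; split.
Qed.

Let m_pos j k : (0 < m j k)%R -> exists x, K x /\ cell j k x.
Proof.
move=> m0; have [n /=] := ultra_nonempty UU (mP j k m0).
rewrite ltr_norml => /andP[h _]; have {h} : 0 < P_ n (cell j k `&` K).
  by rewrite prob_setI_full// massE lte_fin; lra.
move=> h; have [x [cx Kx]] : (cell j k `&` K) !=set0.
  by apply/set0P/negP => /eqP E; move: h; rewrite E measure0 ltxx.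
by exists x.
Qed.

(** The left end of the interval of the cell [k] of level [j]; the intervals of the
level [j + 1] refine those of the level [j] by [c_double]. *)
Let c j k : R := (\sum_(i < k) m j i)%R.

Let cS j k : c j k.+1 = (c j k + m j k)%R.
Proof. by rewrite /c big_ord_recr. Qed.

Let c_mono j k l : (k <= l)%N -> (c j k <= c j l)%R.
Proof.
move=> /subnK <-; elim: (l - k)%N => // i IH; rewrite addSn cS.
by apply: le_trans IH _; rewrite lerDl.
Qed.

Let c_double j k : c j.+1 k.*2 = c j k.
Proof.
elim: k => [|k IH]; first by rewrite /c !big_ord0.
by rewrite doubleS !cS IH (m_split j k) addrA.
Qed.

Let c_top j : c j (2 ^ j) = 1%R.
Proof.
elim: j => [|j IH]; first by rewrite expn0 cS m00 /c big_ord0 add0r.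
by rewrite expnS mul2n c_double.
Qed.

Let c_ge0 j k : (0 <= c j k)%R.
Proof. by apply: sumr_ge0 => i _. Qed.

Let c_le1 j k : (c j k <= 1)%R.
Proof.
have [kj|jk] := leqP k (2 ^ j)%N; first by rewrite -(c_top j) c_mono.
rewrite -(c_top j); move: jk => /ltnW/subnK <-.
elim: (k - 2 ^ j)%N => // i IH; rewrite addSn cS m_out ?addr0//.
by rewrite leq_addl.
Qed.

Let J j k : set R := [set t | (c j k <= t < c j k.+1)%R].

Let in01 (t : R) := (0 <= t < 1)%R.

Let J_in01 j k t : J j k t -> in01 t.
Proof.
move=> /andP[h1 h2]; rewrite /in01 (le_trans (c_ge0 j k) h1)/=.
exact: lt_le_trans h2 (c_le1 _ _).
Qed.

Let J_exists t : in01 t -> forall j, exists k, J j k t.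
Proof.
move=> t01; elim=> [|j [k /andP[k1 k2]]].
  by exists 0%N; rewrite /J/= cS m00 /c big_ord0 add0r.
have [tk|kt] := ltP t (c j.+1 k.*2.+1).
  by exists k.*2; rewrite /J/= c_double k1.
exists k.*2.+1; rewrite /J/= kt/=.
by rewrite -doubleS c_double.
Qed.

Let J_unique j k l t : J j k t -> J j l t -> k = l.
Proof.
move=> /andP[k1 k2] /andP[l1 l2]; apply/eqP; rewrite eqn_leq; apply/andP; split.
  by rewrite leqNgt; apply/negP => /(c_mono j) h; have := lt_le_trans l2 (le_trans h k1); rewrite ltxx.
by rewrite leqNgt; apply/negP => /(c_mono j) h; have := lt_le_trans k2 (le_trans h l1); rewrite ltxx.
Qed.

Let J_half j k t : J j.+1 k t -> J j k./2 t.
Proof.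
move=> /andP[k1 k2]; apply/andP; split.
  apply: le_trans k1; rewrite -c_double; apply: c_mono.
  by rewrite -{2}(odd_double_half k) leq_addl.
apply: lt_le_trans k2 _; rewrite -[leRHS]c_double; apply: c_mono.
by rewrite doubleS -{1}(odd_double_half k) ltnS -add1n leq_add2r leq_b1.
Qed.

Let J_code i j x t : (j <= i)%N -> J i (code D i x) t -> J j (code D j x) t.
Proof.
move=> /subnK <-; elim: (i - j)%N => // k IH.
by rewrite addSn => /J_half; rewrite codeS_half; exact: IH.
Qed.

Let J_point j k t : J j k t -> exists x, K x /\ cell j k x.
Proof.
move=> /andP[h1 h2]; apply: m_pos.
by have := le_lt_trans h1 h2; rewrite cS ltrDl.
Qed.

Let sep (e : R) j := forall x y, K x -> K y -> code D j x = code D j y -> ball x e y.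

(** Points chosen in the cells that correspond to [t], one at each level, have a
cluster point by compactness of [K], and it is close to all of these cells. *)
Let point_exists t : exists l : V, K l /\ (in01 t -> forall e j x, (0 < e)%R ->
  sep e j -> K x -> J j (code D j x) t -> ball x (e + e)%R l).
Proof.
have [t01|nt01] := pselect (in01 t); last first.
  have [x [Kx _]] : exists x, K x /\ cell 0%N 0%N x by apply: m_pos; rewrite m00.
  by exists x.
have /choice[y yP] : forall j, exists x, K x /\ J j (code D j x) t.
  move=> j; have [k Jk] := J_exists t01 j; have [x [Kx xk]] := J_point Jk.
  by exists x; split=> //; rewrite xk.
have yK : (y @ \oo) K by exists 0%N => // j _; have [] := yP j.
have [l [Kl cl]] := compK (fmap_proper_filter y eventually_filter) yK.
exists l; split=> // _ e j x e0 sj Kx Jx.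
have Fy : (y @ \oo) [set z | exists2 i, (j <= i)%N & z = y i].
  by exists j => // i /= ji; exists i.
have [_ [[i ji ->] lyi]] := cl _ _ Fy (nbhsx_ballx l _ e0).
apply: ball_triangle (ball_sym lyi); apply: sj => //; first by have [] := yP i.
apply: J_unique Jx _; apply: J_code ji _.
by have [] := yP i.
Qed.

Let K_point : exists x, K x.
Proof. by have [x [Kx _]] := @m_pos 0%N 0%N ltac:(rewrite m00; exact: ltr01); exists x. Qed.

Let h (t : R) : V :=
  if in01 t then sval (cid (point_exists t)) else sval (cid K_point).

Let hK t : K (h t).
Proof.
rewrite /h; case: ifP => _; last exact: svalP (cid K_point).
by have [] := svalP (cid (point_exists t)).
Qed.

Let h_close t e j x : (0 < e)%R -> sep e j -> K x -> J j (code D j x) t ->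
  ball x (e + e)%R (h t).
Proof.
move=> e0 sj Kx Jx; have [_ hh] := svalP (cid (point_exists t)).
rewrite /h; case: ifPn => [_|/negP[]]; last exact: J_in01 Jx.
exact: (hh (J_in01 Jx) e j x e0 sj Kx Jx).
Qed.

Let mJ j k : measurable (J j k : set (measurableTypeR R)).
Proof.
rewrite (_ : J j k = `[c j k, c j k.+1[%classic); first exact: measurable_itv.
by apply/seteqP; split=> t; rewrite /J/= in_itv.
Qed.

Let pt j k : {x | (exists t, J j k t) -> K x /\ code D j x = k}.
Proof.
apply: cid; have [[t Jt]|nJ] := pselect (exists t, J j k t).
  by have [x [Kx xk]] := J_point Jt; exists x.
by exists 0%R => /nJ.
Qed.

Let m01 : measurable (`[0%R, 1%R[%classic : set (measurableTypeR R)).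
Proof. exact: measurable_itv. Qed.

(** On each level [h] is, up to a small error, a step function of the intervals. *)
Let mh : measurable_fun setT (h : measurableTypeR R -> borelType V).
Proof.
apply: (@measurability _ _ (measurableTypeR R) (borelType V) setT h open) => //.
move=> _ [G oG <-]; rewrite setTI.
have Sinv0 n : (0 < n.+1%:R^-1 :> R)%R by rewrite invr_gt0.
pose jn n := sval (cid (sepD (Sinv0 n))).
have jnP n : sep n.+1%:R^-1%R (jn n) by exact: svalP (cid (sepD (Sinv0 n))).
pose On n := [set y : V | ball y (n.+1%:R^-1 + n.+1%:R^-1)%R `<=` G].
pose A n k : set (measurableTypeR R) :=
  [set t | J (jn n) k t /\ On n (sval (pt (jn n) k))].
pose Z : set (measurableTypeR R) := [set t | ~ in01 t /\ G (sval (cid K_point))].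
have -> : h @^-1` G = Z `|` \bigcup_n \bigcup_k A n k.
  apply/seteqP; split=> t.
    rewrite /preimage/= => Ght; have [t01|t01] := pselect (in01 t); last first.
      by left; split=> //; move: Ght; rewrite /h; case: ifP => // /t01.
    right; move: oG; rewrite openE => /(_ _ Ght)/nbhs_ballP[e e0 eG].
    have e40 : (0 < e / 4)%R by rewrite divr_gt0.
    have [n ne] := natSinv_lt e40.
    have [k Jk] := J_exists t01 (jn n).
    have [Kx xk] := svalP (pt (jn n) k) (ex_intro _ t Jk).
    exists n => //; exists k => //; split=> // y xy; apply: eG.
    have xt := @h_close t n.+1%:R^-1%R (jn n) (sval (pt (jn n) k)) (Sinv0 n) (jnP n) Kx.
    rewrite xk in xt; apply: le_ball (ball_triangle (ball_sym (xt Jk)) xy).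
    by move: ne; move: (n.+1%:R^-1)%R => w; lra.
  move=> [[t01 Gp]|[n _ [k _ [Jk Ok]]]]; rewrite /preimage/=.
    by rewrite /h; case: ifP => // /t01.
  have [Kx xk] := svalP (pt (jn n) k) (ex_intro _ t Jk).
  by apply: Ok; apply: (h_close (Sinv0 n) (jnP n) Kx); rewrite xk.
apply: measurableU.
  have [Gp|nGp] := pselect (G (sval (cid K_point))).
    rewrite (_ : Z = ~` `[0%R, 1%R[%classic); first exact: measurableC.
    by apply/seteqP; split=> t; rewrite /Z/= /in01 in_itv/=; [case|].
  by rewrite (_ : Z = set0); [exact: measurable0|apply/seteqP; split=> t // -[_ /nGp]].
apply: bigcupT_measurable => n; apply: bigcupT_measurable => k.
have [Ok|nOk] := pselect (On n (sval (pt (jn n) k))).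
  rewrite (_ : A n k = J (jn n) k); first exact: mJ.
  by apply/seteqP; split=> t; [case|].
by rewrite (_ : A n k = set0); [exact: measurable0|apply/seteqP; split=> t // -[_ /nOk]].
Qed.

Let lambda_exists : exists l : probability (measurableTypeR R) R,
  forall A, l A = lebesgue_measure (A `&` `[0%R, 1%R[%classic).
Proof.
pose l0 : {measure set (measurableTypeR R) -> \bar R} := mrestr (@lebesgue_measure R) m01.
have l1 : l0 setT = 1.
  by rewrite /l0/= /mrestr setTI lebesgue_measure_itv/= lte_fin ltr01 oppr0 adde0.
pose H := Measure_isProbability.Build _ _ _ l0 l1.
pose l := HB.pack_for (probability (measurableTypeR R) R) (l0 : set _ -> _) l0 H.
by exists l.
Qed.

(** The laws [P_ n] and the Lebesgue measure are coupled by [cell_coupling]: a cell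
of [P_ n] and its interval have almost the same mass. *)
Lemma prokhorov_ultralimit : exists2 P : probability (borelType V) R, P K = 1 &
  forall e : R, (0 < e)%R -> U [set n | pclose K e (P_ n) P].
Proof.
have [l lE] := lambda_exists.
have lJ j k : l (J j k) = (m j k)%:E.
  rewrite lE (_ : _ `&` _ = `[c j k, c j k.+1[%classic).
    rewrite lebesgue_measure_itv/= lte_fin cS ltrDl.
    case: ifPn => [_|]; first by rewrite -EFinB addrAC subrr add0r.
    by rewrite -leNgt => m0; congr EFin; apply/eqP; rewrite eq_le m0 m_ge0.
  apply/seteqP; split=> t; rewrite /J/= !in_itv/=; first by case.
  by move=> Jt; split=> //; exact: (@J_in01 j k t Jt).
have [P PE] := pushforward_probability l mh.
exists P.
  rewrite -PE /pushforward (_ : h @^-1` K = setT); first exact: probability_setT.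
  by apply/seteqP; split=> // t _; exact: hK.
move=> e e0; have e30 : (0 < e / 3)%R by rewrite divr_gt0.
have [j sj] := sepD e30.
have d0 : (0 < e / (2 ^ j)%:R)%R by rewrite divr_gt0// ltr0n expn_gt0.
have := filter_forall_lt UP (fun k (_ : (k < 2 ^ j)%N) => mP j k d0).
apply: filterS => n /= hn.
have mC k : measurable (cell j k `&` K) by exact: measurableI.
have tC : trivIset setT (fun k => cell j k `&` K).
  by apply/trivIsetP => i k _ _ ik; apply/seteqP; split=> // x [[xi _] [xk _]];
    move: ik; rewrite -[i]xi -[k]xk eqxx.
have tJ : trivIset setT (J j).
  apply/trivIsetP => i k _ _ ik; apply/seteqP; split=> // x [xi xk].
  by move: ik; rewrite (J_unique xi xk) eqxx.
have [pi [pi1 pi2 pim]] := @cell_coupling R _ _ (borelType V) (measurableTypeR R)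
  (P_ n) l (2 ^ j)%N _ _ mC (mJ j) tC tJ.
pose S : set (borelType V * measurableTypeR R) :=
  \big[setU/set0]_(k < 2 ^ j) ((cell j k `&` K) `*` J j k).
have mX k : measurable ((cell j k `&` K) `*` J j k : set (borelType V * measurableTypeR R)).
  exact: measurableX.
have mS : measurable S by apply: bigsetU_measurable => k _.
have bfst : measurable_fun setT (fst : borelType V * measurableTypeR R -> borelType V).
  exact: measurable_fst.
have bsnd : measurable_fun setT ((h \o snd) : borelType V * measurableTypeR R -> borelType V).
  exact: (measurableT_comp mh measurable_snd).
apply: (@pclose_meq _ _ _ _ (pushforward pi (fst : _ -> borelType V))
   (pushforward pi (h \o snd : _ -> borelType V))) => //.
- move=> A mA; rewrite -pi1// /pushforward; congr (pi _).
  by apply/seteqP; split=> z //= -[].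
- move=> A mA; rewrite -PE /pushforward -pi2; last first.
    by rewrite -[X in measurable X]setTI; exact: mh.
  by congr (pi _); apply/seteqP; split=> z //= -[].
apply: (@pclose_coupling _ _ _ _ _ pi S) => //.
- rewrite /S (measure_bigsetU pi (F := fun k => (cell j k `&` K) `*` J j k))//; last first.
    apply/trivIsetP => i k _ _ ik; apply/seteqP; split=> // z [[_ zi] [_ zk]].
    by move: ik; rewrite (J_unique zi zk) eqxx.
  apply: (@le_trans _ _ (\sum_(k < 2 ^ j) (m j k - e / (2 ^ j)%:R)%:E)).
    rewrite sumEFin sumrB -/(c j (2 ^ j)) c_top sumr_const card_ord -[(_ *+ _)%R]mulr_natr.
    by rewrite divfK// pnatr_eq0 -lt0n expn_gt0.
  apply: lee_sum => k _; apply: le_trans (pim k (ltn_ord k)).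
  rewrite prob_setI_full// massE lJ le_min !lee_fin.
  have := hn k (ltn_ord k); rewrite /= ltr_norml => /andP[h1 h2].
  apply/andP; split; first by lra.
  by rewrite lerBlDr lerDl ltW.
- move=> [x t]; rewrite /S -(bigcup_mkord _ (fun k => (cell j k `&` K) `*` J j k)).
  move=> [k _ [[/= xk Kx] Jt]]; split; [exact: Kx|exact: (hK t)|].
  have xt := @h_close t (e / 3)%R j x e30 sj Kx; rewrite [code D j x]xk in xt.
  by apply: le_ball (xt Jt); lra.
Qed.

End prokhorov_compactness.

(** Along any infinite set [I] of indices, a sequence of laws on [K] has a limit
point: the limit along an ultrafilter that contains [I]. *)
Lemma prokhorov_compact (R : realType) N (K : set 'rV[R]_N)
    (P_ : nat -> probability (borelType 'rV[R]_N) R) (I : set nat) :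
  compact K -> closed K -> (forall n, P_ n K = 1) ->
  (forall n0, exists2 n, (n0 <= n)%N & I n) ->
  exists2 P : probability (borelType 'rV[R]_N) R, P K = 1 &
    forall e n0, (0 < e)%R -> exists n, [/\ (n0 <= n)%N, I n & pclose K e (P_ n) P].
Proof.
move=> compK clK PK frI.
have FI : ProperFilter (within I \oo).
  apply: Build_ProperFilter_ex.
  move=> A [n0 _ nA]; have [n n0n In] := frI n0.
  by exists n; exact: (nA n n0n In).
have [U [UU IU]] := ultraFilterLemma FI.
have [D [oD sepD]] := separating_balls compK.
have [P PK1 PU] := prokhorov_ultralimit compK clK PK UU oD sepD.
exists P => // e n0 e0.
have UP : ProperFilter U := ultra_proper.
have UI : U (I `&` [set n | (n0 <= n)%N]).
  by apply: IU; exists n0 => // n /= n0n In.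
have [n [/= [In n0n] nP]] := ultra_nonempty UU (filterI UI (PU e e0)).
by exists n.
Qed.

(** * Domination from the approximation of laws *)

Section metric_probabilities.
Context {R : realType} (T : completeMetricType R).
Implicit Types (mu nu : probability (borelType T) R) (C : set T).

Definition closeset C (e : R) : set T := [set a | exists2 y, C y & (mdist y a < e)%R].

Lemma open_closeset C e : open (closeset C e).
Proof.
rewrite openE => a [y Cy ya]; apply/nbhs_ballP; exists (e - mdist y a)%R => /=.
  by rewrite subr_gt0.
move=> b; rewrite ballEmdist/= => ab; exists y => //.
by apply: le_lt_trans (metric_triangle y a b) _; lra.
Qed.

Lemma closed_closeset C : closed C ->
  \bigcap_n closeset C n.+1%:R^-1 = C.
Proof.
move=> cC; apply/seteqP; split=> [a Ca|a Ca n _]; last first.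
  by exists a => //; rewrite mdistxx invr_gt0.
apply: cC => B /nbhs_ballP[e e0 eB]; have [n ne] := natSinv_lt e0.
have [y Cy ya] := Ca n I; exists y; split=> //; apply: eB.
by rewrite ballEmdist/= metric_sym; exact: lt_trans ne.
Qed.

Lemma le_closed_limit mu nu C : closed C ->
  (forall e : R, (0 < e)%R -> mu C <= nu (closeset C e) + e%:E) -> mu C <= nu C.
Proof.
move=> cC h; apply/lee_addgt0Pr => e e0.
have mC n : measurable (closeset C n.+1%:R^-1 : set (borelType T)).
  by apply: open_borel; exact: open_closeset.
have dC : nonincreasing_seq (fun n => closeset C n.+1%:R^-1 : set (borelType T)).
  move=> i j ij; apply/subsetPset => a [y Cy ya]; exists y => //.
  by apply: lt_le_trans ya _; rewrite lef_pV2 ?posrE ?ltr0n// ler_nat.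
have mI : measurable (\bigcap_n closeset C n.+1%:R^-1 : set (borelType T)).
  by rewrite closed_closeset//; exact: closed_borel.
have lim := @nonincreasing_cvg_mu _ (borelType T) R nu
  (fun n => closeset C n.+1%:R^-1)
  (le_lt_trans (probability_le1 _ (mC 0%N)) (ltry 1)) mC mI dC.
rewrite -leeBlDr//; rewrite -[X in _ <= nu X](closed_closeset cC).
rewrite -(cvg_lim _ lim)//.
apply: lime_ge; first by apply/cvg_ex; eexists; exact: lim.
have [n0 n0e] := natSinv_lt e0.
exists n0 => // n /= n0n; rewrite EFinN leeBlDr//.
have Sn : (0 < n.+1%:R^-1 :> R)%R by rewrite invr_gt0.
apply: le_trans (h _ Sn) _; rewrite leeD2l// lee_fin.
apply: le_trans (ltW n0e); rewrite lef_pV2 ?posrE ?ltr0n// ler_nat.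
by [].
Qed.

(** The hypothesis gives [mu C <= nu C] on closed sets. It is symmetric in [mu] and
[nu], by applying it to the complement of an open neighbourhood of [C], so that
the measures agree on the closed sets, which generate the Borel sets. *)
Lemma closed_le_eq mu nu :
  (forall C e, closed C -> (0 < e)%R -> mu C <= nu (closeset C e) + e%:E) ->
  forall A : set (borelType T), measurable A -> mu A = nu A.
Proof.
move=> h.
have le1 C : closed C -> mu C <= nu C.
  by move=> cC; apply: le_closed_limit => // e e0; exact: h.
have compl (rho : probability (borelType T) R) (A : set T) : open A ->
    rho A = 1 - rho (~` A).
  move=> oA; have := probability_setC rho (measurableC (open_borel oA)).
  by rewrite setCK.
have le2 C : closed C -> nu C <= mu C.
  move=> cC; apply: le_closed_limit => // e e0.
  have oC := open_closeset C e.
  apply: (@le_trans _ _ (nu (closeset C e))).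
    rewrite le_measure ?inE//; [exact: closed_borel|exact: open_borel|].
    by move=> a Ca; exists a => //; rewrite mdistxx.
  apply: (@le_trans _ _ (mu (closeset C e))); last by rewrite leeDl// lee_fin ltW.
  rewrite (compl mu _ oC) (compl nu _ oC) leeB//; apply: le1.
  exact: open_closedC.
move=> A mA.
apply: (@g_sigma_algebra_measure_unique _ R (borelType T) (@open T) _ (fun=> setT)) => //.
- by move=> B; exact: sub_sigma_algebra.
- by move=> _; exact: openT.
- by apply/seteqP; split=> // x _; exists 0%N.
- by move=> B1 B2; exact: openI.
- move=> B oB; have cB : closed (~` B) by exact: open_closedC.
  suff : mu B = nu B by [].
  by rewrite (compl mu _ oB) (compl nu _ oB); congr (_ - _); apply/eqP; rewrite eq_le le1// le2.
- by move=> _; rewrite (le_lt_trans (probability_le1 _ _))// ltry.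
Qed.

End metric_probabilities.

Section dense_functions.
Context {R : realType} (A : gdset R).

(** For each finite list of rationals and each precision, one function is chosen that
has these approximate values on the first points of a dense sequence; being
1-Lipschitz, the chosen functions approximate all others. *)
Lemma gd_dense_family : exists f : nat -> A -> R, (forall i, gd_fam A (f i)) /\
  forall h (s : seq A) (e : R), gd_fam A h -> (0 < e)%R ->
    exists i, forall x, x \in s -> (`|h x - f i x| < e)%R.
Proof.
have [a aP] := gd_dense_seq A; have [f0 Ff0] := gd_fam_nonempty A.
pose good (p : seq rat * nat) (k : A -> R) := gd_fam A k /\
  forall j, (j < size p.1)%N -> (`|k (a j) - ratr (nth 0%R p.1 j)| < p.2.+1%:R^-1)%R.
have /choice[g gP] : forall p, exists k, gd_fam A k /\
    ((exists k', good p k') -> good p k).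
  move=> p; have [[k' k'P]|np] := pselect (exists k', good p k').
    by exists k'; split=> //; case: k'P.
  by exists f0; split=> // /np.
exists (fun i => oapp g f0 (@unpickle (seq rat * nat)%type i)); split.
  by move=> i; case: unpickle => [p|] //=; have [] := gP p.
move=> h s e Fh e0; have e80 : (0 < e / 8)%R by rewrite divr_gt0.
have [k ke] := natSinv_lt e80.
have /choice[q qP] : forall j, exists q : rat, (`|h (a j) - ratr q| < k.+1%:R^-1)%R.
  move=> j; have k0 : (0 < k.+1%:R^-1 :> R)%R by rewrite invr_gt0.
  have /rat_in_itvoo[q] : (h (a j) - k.+1%:R^-1 < h (a j) + k.+1%:R^-1)%R.
    by rewrite ltrBlDr -addrA ltrDl addr_gt0.
  rewrite in_itv/= => /andP[q1 q2]; exists q.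
  by move: q1 q2; move: (k.+1%:R^-1)%R => w q1 q2; rewrite ltr_norml; lra.
have /choice[j jP] : forall x, exists j, ball (a j) (e / 8)%R x by move=> x; exact: aP.
pose n := (\max_(x <- s) j x).+1.
pose p : seq rat * nat := (mkseq q n, k).
exists (pickle p) => x xs; rewrite pickleK/=.
have [Fg goodg] := gP p.
have [_ /(_ (j x))] : good p (g p).
  apply: goodg; exists h; split=> // i; rewrite size_mkseq => ip.
  by rewrite nth_mkseq.
have jn : (j x < n)%N by rewrite ltnS (big_rem x)//= leq_maxl.
rewrite size_mkseq => /(_ jn); rewrite nth_mkseq//= => gj.
have := jP x; rewrite ballEmdist/= => ax.
have h1 := gd_fam_lip1 Fh (a (j x)) x; have h2 := gd_fam_lip1 Fg (a (j x)) x.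
have h3 := qP (j x); move: ke gj h1 h2 h3 ax.
move: (k.+1%:R^-1)%R (mdist _ _) (ratr _) (h (a (j x))) (g p (a (j x))) (h x) (g p x).
move=> *; rewrite ltr_norml.
by repeat match goal with H : is_true (Num.norm _ < _)%R |- _ => move: H
  | H : is_true (Num.norm _ <= _)%R |- _ => move: H end;
  rewrite !ltr_norml !ler_norml; lra.
Qed.

End dense_functions.

(** The domination is constructed from a dense sequence [f] of functions of [A]. For
each [n], functions [G n i] of [X] have almost the joint law of the [f i]; their
limits [gam i] along an ultrafilter belong to the closure of the family of [X].
The joint law of the [f i] is concentrated on the image of [A] by [f], so that
the values [gam i x] are, for almost all [x] and hence for all [x] by full
support and completeness, the values of the [f i] at a point [dom x] of [A]. *)
Section domination_from_laws.
Context {R : realType} (A X : gdset R).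

Definition laws_approximable := forall N (r e : R) (f : 'I_N -> A -> R),
  (0 < r)%R -> (0 < e)%R -> (forall i, gd_fam A (f i)) ->
  exists2 g : 'I_N -> X -> R, (forall i, gd_fam X (g i)) &
    pclose (cube N r) e (gd_law r f) (gd_law r g).

Hypothesis approx : laws_approximable.

Let f : nat -> A -> R := sval (cid (gd_dense_family A)).
Let Ff i : gd_fam A (f i).
Proof. by have [] := svalP (cid (gd_dense_family A)). Qed.
Let f_dense h (s : seq A) (e : R) : gd_fam A h -> (0 < e)%R ->
  exists i, forall x, x \in s -> (`|h x - f i x| < e)%R.
Proof. by have [_ h'] := svalP (cid (gd_dense_family A)); exact: h'. Qed.

Let lf i : lip1 (f i) := gd_fam_lip1 (Ff i).

Let mdist_le (a b : A) (d : R) : (forall i, (`|f i a - f i b| <= d)%R) ->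
  (mdist a b <= d)%R.
Proof.
move=> h; rewrite -lee_fin gd_mdistE; apply: ge_ereal_sup => _ [k Fk <-].
rewrite lee_fin; apply/ler_addgt0Pr => e e0.
have e20 : (0 < e / 2)%R by rewrite divr_gt0.
have [i hi] := f_dense [:: a; b] Fk e20.
have ha : (`|k a - f i a| < e / 2)%R by apply: hi; rewrite !inE eqxx.
have hb : (`|k b - f i b| < e / 2)%R by apply: hi; rewrite !inE eqxx orbT.
by have := h i; move: ha hb; rewrite !ltr_norml !ler_norml; lra.
Qed.

(** The number of functions and the range of truncation grow with [n]; a full sequence
[G n] is chosen although only its first [n + 1] functions are constrained. *)
Let G_exists : exists G : nat -> nat -> X -> R, (forall n i, gd_fam X (G n i)) /\
  forall n, pclose (cube n.+1 n.+1%:R) n.+1%:R^-1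
    (gd_law n.+1%:R (fun i : 'I_n.+1 => f i))
    (gd_law n.+1%:R (fun i : 'I_n.+1 => G n i)).
Proof.
have /choice[G GP] : forall n, exists g : nat -> X -> R, (forall i, gd_fam X (g i)) /\
    pclose (cube n.+1 n.+1%:R) n.+1%:R^-1
      (gd_law n.+1%:R (fun i : 'I_n.+1 => f i))
      (gd_law n.+1%:R (fun i : 'I_n.+1 => g i)).
  move=> n; have [||i|g Fg gP] :=
      @approx n.+1 n.+1%:R n.+1%:R^-1%R (fun i : 'I_n.+1 => f i).
  - by rewrite ltr0n.
  - by rewrite invr_gt0 ltr0n.
  - exact: Ff.
  exists (fun i => g (inord i)); split=> [i|]; first exact: Fg.
  suff -> : (fun i : 'I_n.+1 => g (inord i)) = g by [].
  by apply/funext => i; rewrite inord_val.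
by exists G; split=> n; [move=> i|]; have [] := GP n.
Qed.

Let G : nat -> nat -> X -> R := sval (cid G_exists).
Let FG n i : gd_fam X (G n i).
Proof. by have [] := svalP (cid G_exists). Qed.
Let GP n : pclose (cube n.+1 n.+1%:R) n.+1%:R^-1
    (gd_law n.+1%:R (fun i : 'I_n.+1 => f i))
    (gd_law n.+1%:R (fun i : 'I_n.+1 => G n i)).
Proof. by have [_] := svalP (cid G_exists). Qed.

(** The points at which [phi] takes, up to [d] and on the indices in [M], the values
of [f] at some point of [cs]. *)
Definition near_values (phi : nat -> X -> R) (M : set nat) (cs : seq A) (d : R) : set X :=
  [set x | exists2 c, c \in cs & forall i, M i -> (`|phi i x - f i c| <= d)%R].

Let closed_near_values phi M cs d : (forall i, lip1 (phi i)) ->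
  closed (near_values phi M cs d).
Proof.
move=> lphi; apply: closed_exists_in => c.
rewrite (_ : (fun _ => _) = \bigcap_(i in M)
    (fun x => `|phi i x - f i c|%R) @^-1` [set t | (t <= d)%R])//.
apply: closed_bigI => i _; apply: closed_comp => [x _|]; last exact: closed_le.
apply: (@nonexpansive_continuous R X R _ _) => y z e; rewrite ballEmdist/= => yz.
rewrite /ball/=; apply: le_lt_trans (ler_dist_dist _ _) _.
by rewrite opprB addrA subrK; apply: le_lt_trans (lphi i y z) yz.
Qed.

Let mnear_values phi M cs d : (forall i, lip1 (phi i)) ->
  measurable (near_values phi M cs d : set (borelType X)).
Proof. by move=> lphi; apply: closed_borel; exact: closed_near_values. Qed.

(** The law approximation, expressed by events that involve finitely many
points of [A]; the truncation is invisible for a large index. *)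
Let transfer n (cs : seq A) (M : set nat) (d : R) :
  (forall i, M i -> (i <= n)%N) -> (n.+1%:R^-1 <= d)%R ->
  (forall c i, c \in cs -> M i -> (`|f i c| + (d + d) <= n.+1%:R)%R) ->
  gd_mu A (near_seq cs d) <=
    gd_mu X (near_values (G n) M cs (d + d)%R) + (n.+1%:R^-1)%:E.
Proof.
move=> Mn nd csn; set r : R := n.+1%:R.
have r0 : (0 <= r)%R by [].
pose B : set 'rV[R]_n.+1 := cube n.+1 r `&` [set v | exists2 c, c \in cs &
  forall i : 'I_n.+1, M i -> (`|v ord0 i - truncation r (f i c)| <= d)%R].
have cB : closed B.
  apply: closedI; first exact: closed_cube.
  apply: closed_exists_in => c.
  rewrite (_ : (fun _ => _) = \bigcap_(i in [set i : 'I_n.+1 | M i])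
    (fun v : 'rV[R]_n.+1 => `|v ord0 i - truncation r (f i c)|%R)
      @^-1` [set t | (t <= d)%R])//.
  apply: closed_bigI => i _; apply: closed_comp => [x _|]; last exact: closed_le.
  apply: (@nonexpansive_continuous R 'rV[R]_n.+1 R _ _) => v w e /(ball_coord i) vw.
  rewrite /ball/=; apply: le_lt_trans (ler_dist_dist _ _) _.
  by rewrite opprB addrA subrK.
have mB := closed_borel cB.
have [+ _] := GP mB (@subIsetl _ _ _).
rewrite /gd_law /pushforward => h.
have lG i : lip1 (G n i) by exact: gd_fam_lip1.
apply: (@le_trans _ _ (gd_mu A (row_fun r (fun i : 'I_n.+1 => f i) @^-1` B))).
  rewrite le_measure ?inE//; first exact: measurable_near_seq.
    by apply: borel_preimage => //; apply: borel_row_fun => i; exact: lf.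
  move=> a [c ccs ca]; split; first exact: row_fun_cube.
  exists c => // i Mi; rewrite mxE; apply: le_trans (truncation_lip _ _ _) _.
  by rewrite distrC; exact: le_trans (lf _ _ _) ca.
apply: le_trans h _; rewrite leeD2r// le_measure ?inE//.
- apply: borel_preimage; first by apply: borel_row_fun => i; exact: lG.
  by apply: fatten_measurable; exact: borel_cube.
- exact: mnear_values.
move=> x [_ [v [_ [c ccs vc]] vx]]; exists c => // i Mi.
have iE : (inord i : 'I_n.+1) = i :> nat by rewrite inordK// ltnS; exact: Mn.
have := ball_coord (inord i) vx; have := vc (inord i); rewrite !mxE iE => /(_ Mi).
have := csn c i ccs Mi.
have d0 : (0 <= d)%R by apply: le_trans nd; rewrite invr_ge0.
have fc : (`|f i c| <= r - (d + d))%R by rewrite lerBrDr; exact: csn.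
rewrite (_ : truncation r (f i c) = f i c); last first.
  by apply: truncation_id; rewrite -ler_norml; apply: le_trans fc _; lra.
move: (v _ _) => y cn yc yx.
have h : (`|truncation r (G n i x) - f i c| < d + d)%R.
  have {}yx : (`|y - truncation r (G n i x)| < d)%R by exact: lt_le_trans nd.
  by move: yc yx; rewrite !ltr_norml !ler_norml; lra.
have := h; rewrite truncation_inv; first exact: ltW.
by move: h fc; rewrite !ltr_norml !ler_norml; lra.
Qed.

Let U_exists : exists U : set_system nat, UltraFilter U /\ \oo `<=` U.
Proof. exact: ultraFilterLemma. Qed.

Let U : set_system nat := sval (cid U_exists).
Let UU : UltraFilter U. Proof. by have [] := svalP (cid U_exists). Qed.
Let Uoo : \oo `<=` U. Proof. by have [] := svalP (cid U_exists). Qed.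
Let UP : ProperFilter U := @ultra_proper _ _ UU.
#[local] Existing Instance UP.

Let Uge k : U [set n | (k <= n)%N].
Proof. by apply: Uoo; exists k. Qed.

Let Uinv (e : R) : (0 < e)%R -> U [set n | (n.+1%:R^-1 <= e)%R].
Proof.
move=> e0; have [k ke] := natSinv_lt e0; apply: filterS (Uge k) => n /= kn.
by apply: le_trans (ltW ke); rewrite lef_pV2 ?posrE ?ltr0n// ler_nat ltnS.
Qed.

Let Ularge (e : R) : U [set n | (e <= n.+1%:R)%R].
Proof.
apply: filterS (Uge (Num.truncn e)) => n /= kn.
by apply: le_trans (ltW (truncnS_gt e)) _; rewrite ler_nat ltnS.
Qed.

Let Ulist (cs : seq A) (k : nat) (b : R) :
  U [set n | forall c i, c \in cs -> (i <= k)%N -> (`|f i c| + b <= n.+1%:R)%R].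
Proof.
apply: filterS (Ularge (\sum_(c <- cs) \sum_(i < k.+1) `|f i c| + b)%R) => n /= h c i ccs ik.
apply: le_trans h; rewrite lerD2r (big_rem c)//= (bigD1 (Ordinal (ik : (i < k.+1)%N)))//=.
rewrite -addrA lerDl addr_ge0//; first by apply: sumr_ge0.
by apply: sumr_ge0 => a _; apply: sumr_ge0.
Qed.

Let meets (B C : set (borelType X)) (b c : R) : measurable B -> measurable C ->
  1 - b%:E < gd_mu X B -> 1 - c%:E < gd_mu X C -> (b + c <= 1)%R -> B `&` C !=set0.
Proof.
move=> mB mC hB hC bc; apply/set0P/negP => /eqP BC0.
have : gd_mu X (B `|` C) <= 1 by apply: probability_le1; exact: measurableU.
rewrite measureU// leNgt => /negP; apply.
apply: le_lt_trans (lteD hB hC); rewrite -!EFinB -EFinD lee_fin; lra.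
Qed.

(** [G n i] is bounded at some point close to a fixed finite net, because its law is
close to that of [f i]; being 1-Lipschitz it is bounded at [x]. *)
Let bounded i x : exists b : R, U [set n | (`|G n i x| <= b)%R].
Proof.
have [cs Pcs] := @gd_finite_net R A (1 / 4)%R ltac:(by rewrite divr_gt0).
have [zs Pzs] := @gd_finite_net R X (1 / 4)%R ltac:(by rewrite divr_gt0).
pose b : R := (1 + 1 / 4 + \sum_(c <- cs) `|f i c| + \sum_(z <- zs) mdist z x)%R.
exists b.
have q0 : (0 < 1 / 4 :> R)%R by rewrite divr_gt0.
apply: filterS (filterI (filterI (Uge i) (Uinv q0)) (Ulist cs i (1 / 4 + 1 / 4)%R)).
move=> n [[/= ni nq] ncs].
have lG j : lip1 (G n j) by exact: gd_fam_lip1.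
have tr := @transfer n cs [set i] (1 / 4)%R
  (fun j (ji : j = i) => ltac:(by rewrite ji)) nq
  (fun c j ccs (ji : j = i) => ncs c j ccs ltac:(by rewrite ji)).
have big : 1 - (1 / 2)%:E < gd_mu X (near_values (G n) [set i] cs (1 / 4 + 1 / 4)%R).
  have := lt_le_trans Pcs tr; rewrite -lteBlDr//; apply: le_lt_trans.
  by rewrite -!EFinB lee_fin; move: nq; move: (n.+1%:R^-1)%R => w; lra.
have [y [[c ccs yc] [z zzs zy]]] := @meets _ _ (1 / 2)%R (1 / 4)%R
  (mnear_values [set i] cs (1 / 4 + 1 / 4)%R lG) (measurable_near_seq zs (1 / 4)%R) big Pzs ltac:(lra).
have h1 := yc i erefl.
have h2 : (`|f i c| <= \sum_(c <- cs) `|f i c|)%R.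
  by rewrite (big_rem c)//= lerDl; apply: sumr_ge0.
have h3 : (mdist z x <= \sum_(z <- zs) mdist z x)%R.
  by rewrite (big_rem z)//= lerDl; apply: sumr_ge0 => a _; exact: mdist_ge0.
have h4 := lG i y x; have h5 := metric_triangle y z x.
rewrite (metric_sym y z) in h5; rewrite /b.
move: h1 h2 h3 h4 h5 zy; move: (\sum_(_ <- _) _)%R (\sum_(_ <- _) _)%R.
move: (mdist y x) (mdist z x) (mdist z y) (f i c) (G n i y) (G n i x) => *.
by repeat match goal with H : is_true (Num.norm _ <= _)%R |- _ => move: H end;
  rewrite !ler_norml; lra.
Qed.

Let gamma_exists : exists gam : nat -> X -> R, forall i x e, (0 < e)%R ->
  U [set n | (`|G n i x - gam i x| < e)%R].
Proof.
have /choice[g gP] : forall p : nat * X, exists l, forall e, (0 < e)%R ->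
    U [set n | (`|G n p.1 p.2 - l| < e)%R].
  by move=> [i x]; have [b Ub] := bounded i x; exact: (ultra_limit UU (a := fun n => G n i x) Ub).
by exists (fun i x => g (i, x)) => i x; exact: gP (i, x).
Qed.

Let gam : nat -> X -> R := sval (cid gamma_exists).
Let gamP i x e : (0 < e)%R -> U [set n | (`|G n i x - gam i x| < e)%R].
Proof. exact: (svalP (cid gamma_exists)). Qed.

Let Useq (zs : seq X) (i : nat) (e : R) : (0 < e)%R ->
  U [set n | forall x, x \in zs -> (`|G n i x - gam i x| < e)%R].
Proof.
move=> e0; elim: zs => [|z zs IH]; first by apply: filterS filterT.
apply: filterS (filterI (gamP i z e0) IH) => n [/= h1 h2] x.
by rewrite inE => /orP[/eqP->//|]; exact: h2.
Qed.

Let clgam i : gd_closure X (gam i).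
Proof.
apply/gd_closureP => s e e0; have [n nP] := ultra_nonempty UU (Useq s i e0).
by exists (G n i); [exact: FG|move=> x xs; rewrite distrC; exact: nP].
Qed.

Let lgam i : lip1 (gam i) := gd_closure_lip1 (@clgam i).

(** The event for all indices is the decreasing intersection of the events for the
indices up to [k], and on a finite net of [X] the functions [G n i] with [i <= k]
are close to their limits for some large [n]. *)
Let transfer_limit (cs : seq A) (d : R) : (0 < d)%R ->
  gd_mu A (near_seq cs d) <= gd_mu X (near_values gam setT cs (d *+ 5)%R).
Proof.
move=> d0; set T := fun k => near_values gam [set i | (i <= k)%N] cs (d *+ 5)%R.
have mT k : measurable (T k : set (borelType X)) by exact: mnear_values.
have dT : nonincreasing_seq (T : nat -> set (borelType X)).
  by move=> k l kl; apply/subsetPset => x [c ccs h]; exists c => // i ik; apply: h; exact: leq_trans kl.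
have IT : \bigcap_k T k = near_values gam setT cs (d *+ 5)%R.
  apply/seteqP; split=> [x Tx|x [c ccs h] k _]; last by exists c => // i _; exact: h.
  apply: contrapT => nx.
  have /choice[k kP] : forall c, exists k, c \in cs -> ~ (`|gam k x - f k c| <= d *+ 5)%R.
    move=> c; have [ccs|ncs] := boolP (c \in cs); last by exists 0%N.
    apply: contrapT => /forallNP h; apply: nx; exists c => // i _.
    by apply: contrapT => h'; apply: (h i).
  have [c ccs h] := Tx (\max_(c <- cs) k c) I.
  by apply: (kP c ccs); apply: h; rewrite /= (big_rem c)//= leq_maxl.
have mI : measurable (\bigcap_k T k : set (borelType X)) by rewrite IT; exact: mnear_values.
have lim := @nonincreasing_cvg_mu _ (borelType X) R (gd_mu X) T
  (le_lt_trans (probability_le1 _ (mT 0%N)) (ltry 1)) mT mI dT.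
rewrite -IT -(cvg_lim _ lim)//.
apply: lime_ge; first by apply/cvg_ex; eexists; exact: lim.
apply: nearW => k /=; apply/lee_addgt0Pr => e e0.
have e20 : (0 < e / 2)%R by rewrite divr_gt0.
pose d' := Num.min d (e / 2)%R.
have d'0 : (0 < d')%R by rewrite lt_min d0.
have [zs Pzs] := gd_finite_net X d'0.
have Uk := filter_forall_lt UP (fun i (_ : (i < k.+1)%N) => Useq zs i d0).
have [n [[[/= kn nd] ncs] nk]] := ultra_nonempty UU (filterI (filterI
  (filterI (Uge k) (Uinv d'0)) (Ulist cs k (d + d)%R)) Uk).
have nd1 : (n.+1%:R^-1 <= d)%R by apply: le_trans nd _; rewrite ge_min lexx.
have nd2 : (n.+1%:R^-1 <= e / 2)%R by apply: le_trans nd _; rewrite ge_min lexx orbT.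
apply: le_trans (@transfer n cs [set i | (i <= k)%N] d _ nd1 _) _.
- by move=> i /= ik; exact: leq_trans kn.
- by move=> c i ccs ik; exact: ncs.
have lG j : lip1 (G n j) by exact: gd_fam_lip1.
have mN := mnear_values [set i | (i <= k)%N] cs (d + d)%R lG.
have mz := measurable_near_seq zs d'.
have zle : gd_mu X (~` near_seq zs d') <= (e / 2)%:E.
  rewrite probability_setC// leeBlDr ?fin_num_measure// addeC -leeBlDr//.
  by apply: le_trans (ltW Pzs); rewrite -!EFinB lee_fin lerB// ge_min lexx orbT.
have sub : near_values (G n) [set i | (i <= k)%N] cs (d + d)%R `<=` T k `|` ~` near_seq zs d'.
  move=> x [c ccs xc]; have [zx|nzx] := pselect (near_seq zs d' x); [left|by right].
  exists c => // i ik.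
  have := lip1_near_seq (lgam i) (lG i) (d := d) _ zx.
  have := xc i ik; have dd : (d' <= d)%R by rewrite ge_min lexx.
  move=> h1 h2; have {}h2 := h2 (fun y yz => ltac:(rewrite distrC; exact: ltW (nk i ik y yz))).
  by move: h1 h2; rewrite !ler_norml; lra.
have h1 : gd_mu X (near_values (G n) [set i | (i <= k)%N] cs (d + d)%R) <=
    gd_mu X (T k) + (e / 2)%:E.
  apply: (@le_trans _ _ (gd_mu X (T k `|` ~` near_seq zs d'))).
    by rewrite le_measure ?inE//; apply: measurableU => //; exact: measurableC.
  apply: le_trans (@measureU2 _ _ _ (gd_mu X) _ _ (mT k) (measurableC mz)) _.
  by rewrite leeD2l.
rewrite [e]splitr EFinD addeA; apply: leeD => //.
Qed.

(** Otherwise a ball around [x], of positive measure, would avoid the events of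
[transfer_limit], whose measure is arbitrarily close to 1. *)
Let near_exists x (e : R) : (0 < e)%R -> exists a, forall i, (`|gam i x - f i a| <= e)%R.
Proof.
move=> e0; have e20 : (0 < e / 2)%R by rewrite divr_gt0.
have mb : measurable (ball x (e / 2)%R : set (borelType X)).
  by apply: open_borel; exact: ball_mopen.
have Pb : 0 < gd_mu X (ball x (e / 2)%R).
  by apply: gd_full_support; [exact: ball_mopen|exists x; exact: ballxx].
have [p p0 pb] : exists2 p : R, (0 < p)%R & p%:E <= gd_mu X (ball x (e / 2)%R).
  exists (fine (gd_mu X (ball x (e / 2)%R))); last by rewrite fineK// fin_num_measure.
  by rewrite fine_gt0// Pb (le_lt_trans (probability_le1 _ mb))// ltry.
pose d := Num.min p (e / 10)%R.
have d0 : (0 < d)%R by rewrite lt_min p0 divr_gt0.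
have [cs Pcs] := gd_finite_net A d0.
have h := lt_le_trans Pcs (transfer_limit cs d0).
have mN := mnear_values setT cs (d *+ 5)%R lgam.
have [y [[c ccs yc] xy]] : near_values gam setT cs (d *+ 5)%R `&` ball x (e / 2)%R !=set0.
  apply/set0P/negP => /eqP BC0.
  have : gd_mu X (near_values gam setT cs (d *+ 5)%R `|` ball x (e / 2)%R) <= 1.
    by apply: probability_le1; exact: measurableU.
  rewrite measureU// leNgt => /negP; apply.
  have pd : (d <= p)%R by rewrite ge_min lexx.
  apply: le_lt_trans (lte_leD _ h pb); last by [].
  by rewrite -!EFinB -EFinD lee_fin; lra.
exists c => i; have := yc i I; have := lgam i x y.
move: xy; rewrite ballEmdist/=.
have : (d <= e / 10)%R by rewrite ge_min lexx orbT.
by rewrite !ler_norml; lra.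
Qed.

(** The points of [near_exists] form a Cauchy sequence since the [f i] determine
the distance of [A]. *)
Let point_exists x : exists a, forall i, f i a = gam i x.
Proof.
have /choice[a aP] : forall n, exists a, forall i, (`|gam i x - f i a| <= n.+1%:R^-1)%R.
  by move=> n; apply: near_exists; rewrite invr_gt0.
have Sn_le k n : (k <= n)%N -> (n.+1%:R^-1 <= k.+1%:R^-1 :> R)%R.
  by move=> kn; rewrite lef_pV2 ?posrE ?ltr0n// ler_nat ltnS.
have da k n : (k <= n)%N -> (mdist (a k) (a n) <= k.+1%:R^-1 + k.+1%:R^-1)%R.
  move=> kn; apply: mdist_le => i.
  have := aP k i; have := aP n i; have := Sn_le k n kn.
  by move: (n.+1%:R^-1)%R (k.+1%:R^-1)%R => u w; rewrite !ler_norml; lra.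
have ca : cauchy (a @ \oo).
  apply/cauchy_exP => e e0; have e20 : (0 < e / 2)%R by rewrite divr_gt0.
  have [k ke] := natSinv_lt e20; exists (a k); exists k => // n /= kn.
  rewrite ballEmdist/=; apply: le_lt_trans (da k n kn) _.
  by rewrite [e]splitr ltrD.
have [l al] : exists l : A, a n @[n --> \oo] --> l by apply/cvg_ex; exact: cauchy_cvg.
exists l => i; apply/eqP; rewrite -subr_eq0 -normr_le0; apply/ler_addgt0Pr => e e0.
have e20 : (0 < e / 2)%R by rewrite divr_gt0.
have [k ke] := natSinv_lt e20.
have al' : \forall n \near \oo, ball l (e / 2)%R (a n) by move/cvg_ballP : al; exact.
have [n0 _ n0P] := al'.
have := n0P (maxn n0 k) (leq_maxl _ _); rewrite ballEmdist/= => h1.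
have := aP (maxn n0 k) i; have := lf i l (a (maxn n0 k)).
have := Sn_le k _ (leq_maxr n0 k); move: ke.
move: ((maxn n0 k).+1%:R^-1)%R (k.+1%:R^-1)%R => u w.
by rewrite !ler_norml; lra.
Qed.

Let dom x : A := sval (cid (point_exists x)).
Let domP x i : f i (dom x) = gam i x.
Proof. by move: i; exact: (svalP (cid (point_exists x))). Qed.

Let dom_nonexpansive : nonexpansive dom.
Proof.
move=> x y e; rewrite !ballEmdist/=; apply: le_lt_trans.
by apply: mdist_le => i; rewrite !domP; exact: lgam.
Qed.

Let dom_borel : borel_map dom.
Proof. by apply: continuous_borel; exact: nonexpansive_continuous dom_nonexpansive. Qed.

(** The image measure is identified by [closed_le_eq]: up to a small mass, a closed
set is covered by small balls around finitely many points, and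
[transfer_limit] bounds the measure of these balls. *)
Lemma gd_le_of_laws : gd_le A X.
Proof.
exists dom; split; first exact: dom_borel.
- have [nu nuE] := pushforward_probability (gd_mu X) dom_borel.
  move=> B mB; rewrite nuE; apply/esym.
  apply: closed_le_eq mB => C e cC e0.
  have e80 : (0 < e / 8)%R by rewrite divr_gt0.
  have [cs Pcs] := gd_finite_net A e80.
  pose ds := [seq c <- cs | `[< exists2 y, C y & (mdist c y <= e / 8)%R >]].
  have mC : measurable (C : set (borelType A)) by exact: closed_borel.
  have mcs := measurable_near_seq cs (e / 8)%R.
  have mds := measurable_near_seq ds (e / 8)%R.
  have ncs : gd_mu A (~` near_seq cs (e / 8)%R) <= e%:E.
    rewrite probability_setC// leeBlDr ?fin_num_measure// addeC -leeBlDr//.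
    by apply: le_trans (ltW Pcs); rewrite -!EFinB lee_fin; lra.
  apply: (@le_trans _ _ (gd_mu A (near_seq ds (e / 8)%R) + e%:E)).
    apply: (@le_trans _ _ (gd_mu A (near_seq ds (e / 8)%R `|` ~` near_seq cs (e / 8)%R))).
      rewrite le_measure ?inE//; first by apply: measurableU => //; exact: measurableC.
      move=> a Ca; have [[c ccs ca]|] := pselect (near_seq cs (e / 8)%R a); [left|by right].
      exists c => //; rewrite mem_filter ccs andbT; apply/asboolP.
      by exists a.
    apply: le_trans (@measureU2 _ _ _ (gd_mu A) _ _ mds (measurableC mcs)) _.
    by rewrite leeD2l.
  rewrite leeD2r//; apply: le_trans (transfer_limit ds e80) _.
  rewrite -nuE /pushforward le_measure ?inE//.
  - exact: mnear_values.
  - by apply: borel_preimage => //; apply: open_borel; exact: open_closeset.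
  move=> x [c]; rewrite mem_filter => /andP[/asboolP[y Cy cy] _] xc.
  exists y => //.
  have h : (mdist (dom x) c <= e / 8 *+ 5)%R.
    by apply: mdist_le => i; rewrite domP; exact: xc.
  have := metric_triangle y c (dom x).
  by rewrite (metric_sym y c) (metric_sym c (dom x)); lra.
- move=> _ [h Fh <-]; apply: gd_closure_idem => s e e0.
  have [i hi] := f_dense [seq dom x | x <- s] Fh e0.
  exists (gam i) => // x xs; rewrite /= -domP.
  by apply: hi; exact: map_f.
Qed.

End domination_from_laws.

(** * The Hausdorff distance of families of laws *)

Section hausdorff.
Context {R : realType} (T : Type) (d : T -> T -> \bar R).
Implicit Types (A B C : set T).

Lemma hausdorff_dist_le A B (e : R) :
  (forall a, A a -> forall e' : R, (e < e')%R -> exists2 b, B b & d a b <= e'%:E) ->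
  (forall b, B b -> forall e' : R, (e < e')%R -> exists2 a, A a & d a b <= e'%:E) ->
  hausdorff_dist d A B <= e%:E.
Proof.
move=> h1 h2; rewrite /hausdorff_dist ge_max; apply/andP; split.
  apply: ge_ereal_sup => _ [a Aa <-]; apply/lee_addgt0Pr => r r0.
  have [|b Bb db] := h1 a Aa (e + r)%R; first by rewrite ltrDl.
  by rewrite -EFinD; apply: le_trans db; apply: ereal_inf_lbound; exists b.
apply: ge_ereal_sup => _ [b Bb <-]; apply/lee_addgt0Pr => r r0.
have [|a Aa da] := h2 b Bb (e + r)%R; first by rewrite ltrDl.
by rewrite -EFinD; apply: le_trans da; apply: ereal_inf_lbound; exists a.
Qed.

Lemma hausdorff_dist_ltl A B (e : \bar R) a : hausdorff_dist d A B < e -> A a ->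
  exists2 b, B b & d a b < e.
Proof.
rewrite /hausdorff_dist gt_max => /andP[h _] Aa.
have : ereal_inf [set d a b | b in B] < e.
  by apply: le_lt_trans h; apply: ereal_sup_ubound; exists a.
by move=> /ereal_inf_lt[_ [b Bb <-] db]; exists b.
Qed.

Lemma hausdorff_dist_ge0 A B : (forall a b, 0 <= d a b) -> A !=set0 ->
  0 <= hausdorff_dist d A B.
Proof.
move=> d0 [a Aa]; rewrite /hausdorff_dist le_max; apply/orP; left.
apply: (@le_trans _ _ (ereal_inf [set d a b | b in B])).
  by apply: le_ereal_inf_tmp => _ [b _ <-].
by apply: ereal_sup_ubound; exists a.
Qed.

Lemma hausdorff_dist_sym A B : (forall a b, d a b = d b a) ->
  hausdorff_dist d A B = hausdorff_dist d B A.
Proof.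
move=> ds; rewrite /hausdorff_dist maxC; congr maxe; congr ereal_sup.
  by apply: eq_imagel => b _; congr ereal_inf; apply: eq_imagel.
by apply: eq_imagel => b _; congr ereal_inf; apply: eq_imagel.
Qed.

End hausdorff.

Section prokhorov_hausdorff.
Context {R : realType} (N : nat) (r : R) (r0 : (0 < r)%R).
Local Notation Laws := (set (set (borelType 'rV[R]_N) -> \bar R)).
Local Notation K := (cube N r).
Implicit Types M : Laws.

Definition law_family M := M !=set0 /\ forall nu, M nu -> law_on K nu.

Let mK : measurable (K : set (borelType 'rV[R]_N)) := @borel_cube R N r.

Lemma PH_ge0 M1 M2 : law_family M1 -> 0 <= prokhorov_hausdorff r M1 M2.
Proof.
by move=> [M0 _]; apply: hausdorff_dist_ge0 => // *; exact: prokhorov_ge0.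
Qed.

Lemma PH_sym M1 M2 : prokhorov_hausdorff r M1 M2 = prokhorov_hausdorff r M2 M1.
Proof. by apply: hausdorff_dist_sym => *; exact: prokhorov_sym. Qed.

Lemma PH_le M1 M2 (e : R) : (0 <= e)%R ->
  (forall a, M1 a -> forall e' : R, (e < e')%R -> exists2 b, M2 b & pclose K e' a b) ->
  (forall b, M2 b -> forall e' : R, (e < e')%R -> exists2 a, M1 a & pclose K e' a b) ->
  prokhorov_hausdorff r M1 M2 <= e%:E.
Proof.
move=> e0 h1 h2; apply: hausdorff_dist_le.
  move=> a Ma e' ee'; have [b Mb ab] := h1 a Ma e' ee'; exists b => //.
  by apply: prokhorov_le => //; exact: le_lt_trans ee'.
move=> b Mb e' ee'; have [a Ma ab] := h2 b Mb e' ee'; exists a => //.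
by apply: prokhorov_le => //; exact: le_lt_trans ee'.
Qed.

Lemma PH_le1 M1 M2 : law_family M1 -> law_family M2 ->
  prokhorov_hausdorff r M1 M2 <= 1.
Proof.
move=> [[a Ma] l1] [[b Mb] l2]; apply: hausdorff_dist_le.
  move=> c Mc e e1; exists b => //; apply: le_trans (prokhorov_le1 mK (l1 _ Mc) (l2 _ Mb)) _.
  by rewrite lee_fin ltW.
move=> c Mc e e1; exists a => //; apply: le_trans (prokhorov_le1 mK (l1 _ Ma) (l2 _ Mc)) _.
by rewrite lee_fin ltW.
Qed.

Lemma PH_ltl M1 M2 (e : R) a : law_family M1 -> law_family M2 ->
  prokhorov_hausdorff r M1 M2 < e%:E -> M1 a -> exists2 b, M2 b & pclose K e a b.
Proof.
move=> [_ l1] [_ l2] h Ma; have [b Mb ab] := hausdorff_dist_ltl h Ma.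
exists b => //.
by have [] := prokhorov_lt mK (l1 a Ma) (l2 b Mb) ab.
Qed.

Lemma PH_ltr M1 M2 (e : R) b : law_family M1 -> law_family M2 ->
  prokhorov_hausdorff r M1 M2 < e%:E -> M2 b -> exists2 a, M1 a & pclose K e a b.
Proof.
move=> l1 l2; rewrite PH_sym => h Mb; have [a Ma ab] := PH_ltl l2 l1 h Mb.
by exists a => //; exact: pclose_sym.
Qed.

Lemma PH_fin M1 M2 : law_family M1 -> law_family M2 ->
  prokhorov_hausdorff r M1 M2 \is a fin_num.
Proof.
move=> l1 l2; rewrite ge0_fin_numE ?PH_ge0//.
by apply: le_lt_trans (PH_le1 l1 l2) _; rewrite ltry.
Qed.

Lemma PH_triangle M1 M2 M3 : law_family M1 -> law_family M2 -> law_family M3 ->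
  prokhorov_hausdorff r M1 M3 <=
  prokhorov_hausdorff r M1 M2 + prokhorov_hausdorff r M2 M3.
Proof.
move=> l1 l2 l3; have [_ L1] := l1; have [_ L2] := l2; have [_ L3] := l3.
rewrite -(fineK (PH_fin l1 l2)) -(fineK (PH_fin l2 l3)) -EFinD.
set x := fine _; set y := fine _.
have x0 : (0 <= x)%R by rewrite fine_ge0 ?PH_ge0.
have y0 : (0 <= y)%R by rewrite fine_ge0 ?PH_ge0.
have hx (e : R) : (x < e)%R -> prokhorov_hausdorff r M1 M2 < e%:E.
  by rewrite -lte_fin fineK ?PH_fin.
have hy (e : R) : (y < e)%R -> prokhorov_hausdorff r M2 M3 < e%:E.
  by rewrite -lte_fin fineK ?PH_fin.
apply: PH_le; first exact: addr_ge0.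
- move=> a Ma e xye; pose t := ((e - x - y) / 2)%R.
  have [|b Mb ab] := @PH_ltl M1 M2 (x + t)%R a l1 l2 _ Ma.
    by apply: hx; rewrite /t; lra.
  have [|c Mc bc] := @PH_ltl M2 M3 (y + t)%R b l2 l3 _ Mb.
    by apply: hy; rewrite /t; lra.
  exists c => //; rewrite (_ : e = (x + t) + (y + t))%R; last by rewrite /t; lra.
  exact: pclose_trans mK (L1 _ Ma) (L2 _ Mb) (L3 _ Mc) ab bc.
- move=> c Mc e xye; pose t := ((e - x - y) / 2)%R.
  have [|b Mb bc] := @PH_ltr M2 M3 (y + t)%R c l2 l3 _ Mc.
    by apply: hy; rewrite /t; lra.
  have [|a Ma ab] := @PH_ltr M1 M2 (x + t)%R b l1 l2 _ Mb.
    by apply: hx; rewrite /t; lra.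
  exists a => //; rewrite (_ : e = (x + t) + (y + t))%R; last by rewrite /t; lra.
  exact: pclose_trans mK (L1 _ Ma) (L2 _ Mb) (L3 _ Mc) ab bc.
Qed.

Lemma PH_eq0 M1 M2 : law_family M1 ->
  (forall a, M1 a -> forall e : R, (0 < e)%R -> exists2 b, M2 b & pclose K e a b) ->
  (forall b, M2 b -> forall e : R, (0 < e)%R -> exists2 a, M1 a & pclose K e a b) ->
  prokhorov_hausdorff r M1 M2 = 0.
Proof.
move=> l1 h1 h2; apply/eqP; rewrite eq_le PH_ge0// andbT.
exact: PH_le.
Qed.

Lemma PH_refl M : law_family M -> prokhorov_hausdorff r M M = 0.
Proof.
move=> lM; have [_ l] := lM; apply: PH_eq0 => // a Ma e e0; exists a => //.
  by apply: pclose_refl => //; exact: l.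
by apply: pclose_refl => //; exact: l.
Qed.

Lemma law_family_measurement (X : gdset R) : law_family (measurement X N r).
Proof.
split; first exact: measurement_nonempty.
by move=> nu; apply: measurement_law; exact: ltW.
Qed.

Lemma law_family_measurements (E : set (gdset R)) : E !=set0 ->
  law_family (measurements E N r).
Proof.
move=> [X EX]; split.
  have [nu Xnu] := measurement_nonempty X N r.
  by exists nu; exact: measurement_sub EX _ Xnu.
by move=> nu; apply: measurements_law; exact: ltW.
Qed.

End prokhorov_hausdorff.

(** * Associated pyramids *)

Section associated_pyramid.
Context {R : realType} (L : set (R -> R)).
Hypothesis monL : monoidal L.
Hypothesis TBL : @TB R `<=` L.
Implicit Types (X Y Z : gdset R).

Lemma gd_closure_comp X Y (u : X -> Y) :
  [set f \o u | f in gd_fam Y] `<=` gd_closure X ->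
  forall g, gd_closure Y g -> gd_closure X (g \o u).
Proof.
move=> uF g /gd_closureP clg; apply: gd_closure_idem => s e e0.
have [k Fk gk] := clg [seq u x | x <- s] e e0.
exists (k \o u); first by apply: uF; exists k.
by move=> x xs; apply: gk; exact: map_f.
Qed.

Lemma gd_le_refl X : gd_le X X.
Proof.
exists id; split; first exact: measurable_id.
  by move=> A mA.
by move=> _ [f Ff <-]; exact: gd_fam_closure.
Qed.

Lemma gd_le_trans X Y Z : gd_le X Y -> gd_le Y Z -> gd_le X Z.
Proof.
move=> [v [bv pv vF]] [u [bu pu uF]]; exists (v \o u); split.
- exact: borel_comp.
- move=> A mA; rewrite -pv// /pushforward -pu//.
  exact: borel_preimage.
- move=> _ [f Ff <-]; apply: (gd_closure_comp uF (g := f \o v)).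
  by apply: vF; exists f.
Qed.

(** For closedness: the laws of the functions of a limit are limits of laws of functions
of [X], and [gd_le_of_laws] turns them into a domination. *)
Lemma pyramid_assoc X : LD L X -> pyramid L (assoc_pyramid L X).
Proof.
move=> LX; split.
- by move=> Y [].
- by exists X; split=> //; exact: gd_le_refl.
- by move=> Y Z [LY YX] LZ ZY; split=> //; exact: gd_le_trans ZY YX.
- move=> A LA hA; split=> //; apply: gd_le_of_laws => N r e f r0 e0 Ff.
  pose d := Num.min (e / 3)%R 1%R.
  have d01 : (0 < d <= 1)%R by rewrite lt_min divr_gt0//= ltr01 ge_min lexx orbT.
  have d0 : (0 < d)%R by case/andP: d01.
  have de : (d + (d + d) <= e)%R.
    by have : (d <= e / 3)%R; [rewrite ge_min lexx|lra].
  have [B [LB BX] AB] := hA d d0.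
  have clf i : gd_closure A (f i) by apply: gd_fam_closure; exact: Ff.
  have [g1 clg1 fg1] := gd_law_box (ltW r0) d01 AB clf.
  have [g2 Fg2 g12] := gd_law_closure (ltW r0) d0 clg1.
  have [g Fg g2g] := gd_law_le (ltW r0) d0 BX Fg2.
  exists g => //.
  have mK := @borel_cube R N r.
  have l0 : law_on (cube N r) (gd_law r f) by exact: gd_fam_law.
  have l1 : law_on (cube N r) (gd_law r g1).
    by apply: gd_law_on => [|i]; [exact: ltW|exact: (gd_closure_lip1 (clg1 i))].
  have l2 : law_on (cube N r) (gd_law r g2) by exact: gd_fam_law.
  have l3 : law_on (cube N r) (gd_law r g) by exact: gd_fam_law.
  apply: (pclose_mono mK l0 l3 de).
  apply: (pclose_trans mK l0 l1 l3 fg1).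
  exact: (pclose_trans mK l1 l2 l3 g12 g2g).
- by move=> Y Z [LY YX] [LZ ZX]; exists X; split=> //; split=> //; exact: gd_le_refl.
Qed.

(** A function of a dominated gd-set has, up to closure, the law of a function of
[X]. *)
Lemma PH_assoc X N r : (0 < r)%R -> LD L X ->
  prokhorov_hausdorff r (measurement X N r) (measurements (assoc_pyramid L X) N r) = 0.
Proof.
move=> r0 LX.
have aX : assoc_pyramid L X X by split=> //; exact: gd_le_refl.
have lX := @law_family_measurement R N r r0 X.
apply: PH_eq0 => // a Ma e e0.
  exists a; first exact: measurement_sub aX _ Ma.
  by apply: pclose_refl => //; [exact: borel_cube|case: lX => _; exact].
have e20 : (0 < e / 2)%R by rewrite divr_gt0.
have [W [LW WX] [f Ff af]] := measurements_approx (ltW r0) e20 Ma.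
have [g Fg fg] := gd_law_le (ltW r0) e20 WX Ff.
exists (gd_law r g); first by exists g.
apply: pclose_sym; rewrite [e]splitr.
have la := measurements_law (ltW r0) Ma.
by apply: (pclose_trans (@borel_cube R N r) la _ _ af fg); exact: gd_fam_law.
Qed.

End associated_pyramid.

(** * Weak convergence and convergence of measurements *)

Section sequences_ereal.
Context {R : realType}.
Implicit Types u : nat -> \bar R.

Lemma cvg_ereal0P u : (forall n, 0 <= u n) ->
  u @ \oo --> 0 <-> forall e : R, (0 < e)%R -> \forall n \near \oo, u n <= e%:E.
Proof.
move=> u0; split=> [cu e e0|h].
  have : nbhs (0 : \bar R) [set y : \bar R | y <= e%:E].
    rewrite /nbhs/=; apply/nbhs_ballP; exists e => //= y.
    by rewrite /ball/= sub0r normrN => /(le_lt_trans (ler_norm _)) /ltW.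
  exact: cu.
move=> B; rewrite {1}/nbhs/= => /nbhs_ballP[e /= e0 eB].
have e20 : (0 < e / 2)%R by rewrite divr_gt0.
apply: filterS (h _ e20) => n un.
have fu : u n \is a fin_num by rewrite ge0_fin_numE// (le_lt_trans un) ?ltry.
rewrite /= -(fineK fu); apply: eB; rewrite /ball/= sub0r normrN.
rewrite ger0_norm ?fine_ge0//; apply: (@le_lt_trans _ _ (e / 2)%R).
  by rewrite -lee_fin fineK.
by rewrite ltr_pdivrMr// ltr_pMr// ltr1n.
Qed.

Lemma limn_einf_gt0 u : 0 < limn_einf u ->
  exists2 c : R, (0 < c)%R & \forall n \near \oo, c%:E <= u n.
Proof.
move=> lu; apply: contrapT => nc; move: lu; rewrite limn_einf_lim ltNge => /negP; apply.
apply: lime_le; first exact: is_cvg_einfs.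
apply: nearW => n; rewrite leNgt; apply/negP => h.
have [c c0 cu] : exists2 c : R, (0 < c)%R & c%:E <= einfs u n.
  case: (einfs u n) h => [x| |]// x0; first by exists x.
  by exists 1%R => //; rewrite leey.
apply: nc; exists c => //; exists n => // m /= nm.
by apply: le_trans cu _; apply: ereal_inf_lbound; exists m.
Qed.

Lemma gt0_limn_einf u (c : R) : (0 < c)%R -> (\forall n \near \oo, c%:E <= u n) ->
  0 < limn_einf u.
Proof.
move=> c0 cu; rewrite limn_einf_lim; apply: (@lt_le_trans _ _ c%:E); first by rewrite lte_fin.
apply: lime_ge; first exact: is_cvg_einfs.
have [n0 _ h] := cu; exists n0 => // n /= n0n.
by apply: le_ereal_inf_tmp => _ [m /= nm <-]; apply: h; exact: leq_trans nm.
Qed.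

Lemma not_near_frequently (P : nat -> Prop) : ~ (\forall n \near \oo, P n) ->
  forall n0, exists2 n, (n0 <= n)%N & ~ P n.
Proof.
move=> nP n0; apply: contrapT => h; apply: nP; exists n0 => // n /= n0n.
by apply: contrapT => Pn; apply: h; exists n.
Qed.

Lemma frequently_or (P Q : nat -> Prop) :
  (forall n0, exists2 n, (n0 <= n)%N & P n \/ Q n) ->
  (forall n0, exists2 n, (n0 <= n)%N & P n) \/ (forall n0, exists2 n, (n0 <= n)%N & Q n).
Proof.
move=> h; have [hP|/existsNP[n0 nP]] := pselect (forall n0, exists2 n, (n0 <= n)%N & P n).
  by left.
right=> n1; have [n + [Pn|Qn]] := h (maxn n0 n1); rewrite geq_max => /andP[n0n n1n].
  by case: nP; exists n.
by exists n.
Qed.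

End sequences_ereal.

Section weak_convergence.
Context {R : realType} (L : set (R -> R)).
Hypothesis monL : monoidal L.
Hypothesis TBL : @TB R `<=` L.

Lemma box_ge0 (X Y : gdset R) : 0 <= box X Y.
Proof.
apply: le_ereal_inf_tmp => _ [pi [S [_ cS ->]]]; rewrite le_max.
rewrite sube_ge0 ?probability_le1//; first exact: closed_borel.
by rewrite fin_num_measure//; exact: closed_borel.
Qed.

Lemma box_to_ge0 (A : gdset R) E : 0 <= box_to A E.
Proof. by apply: le_ereal_inf_tmp => _ [B _ <-]; exact: box_ge0. Qed.

Lemma law_of_box (A B : gdset R) N (r e : R) (f : 'I_N -> A -> R) : (0 < r)%R ->
  (0 < e <= 1)%R -> box A B < e%:E -> (forall i, gd_fam A (f i)) ->
  exists2 g : 'I_N -> B -> R, (forall i, gd_fam B (g i)) &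
    pclose (cube N r) (e + e)%R (gd_law r f) (gd_law r g).
Proof.
move=> r0 e01 AB Ff; have e0 : (0 < e)%R by case/andP: e01.
have clf i : gd_closure A (f i) by apply: gd_fam_closure; exact: Ff.
have [g1 clg1 fg1] := gd_law_box (ltW r0) e01 AB clf.
have [g Fg g1g] := gd_law_closure (ltW r0) e0 clg1.
exists g => //; apply: (pclose_trans (@borel_cube R N r) _ _ _ fg1 g1g).
- exact: gd_fam_law.
- by apply: gd_law_on => [|i]; [exact: ltW|exact: (gd_closure_lip1 (clg1 i))].
- exact: gd_fam_law.
Qed.

Lemma law_in_measurements (P : set (gdset R)) N r (X : gdset R) (f : 'I_N -> X -> R) : P X ->
  (forall i, gd_fam X (f i)) -> measurements P N r (gd_law r f).
Proof. by move=> PX Ff; apply: (measurement_sub PX); exists f. Qed.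

(** The coordinate gd-sets of [box_from_measurement] are dominated by a member of the
pyramid, so they belong to it. *)
Lemma box_from_pyramid (A : gdset R) (e : R) : LD L A -> (0 < e)%R ->
  exists N (r d : R) (f : 'I_N -> A -> R),
  [/\ (0 < N)%N, (0 < r)%R, (0 < d)%R, (forall i, gd_fam A (f i)) &
    forall P b, pyramid L P -> measurements P N r b ->
      pclose (cube N r) d (gd_law r f) b -> exists2 Y, P Y & box A Y < e%:E].
Proof.
move=> LA e0; have [N [r [d [f [N0 r0 d0 Ff key]]]]] := box_from_measurement monL TBL LA e0.
have d20 : (0 < d / 2)%R by rewrite divr_gt0.
exists N, r, (d / 2)%R, f; split=> // P b pyP Pb fb.
have [PL _ Pdown _ _] := pyP.
have [X PX [g Fg bg]] := measurements_approx (ltW r0) d20 Pb.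
have [|Y [LY YX AY]] := key X g (PL X PX) Fg.
  rewrite [d]splitr; apply: (pclose_trans (@borel_cube R N r) _ _ _ fb bg).
  - exact: gd_fam_law.
  - exact: measurements_law (ltW r0) Pb.
  - exact: gd_fam_law.
by exists Y => //; exact: Pdown PX LY YX.
Qed.

Lemma pyramid_law_family P N r : pyramid L P -> (0 < r)%R ->
  law_family r (measurements P N r).
Proof. by move=> [_ P0 _ _ _] r0; exact: law_family_measurements. Qed.

Section laws_to_weak.
Context (P_ : nat -> set (gdset R)) (P : set (gdset R)).
Hypotheses (pyP_ : forall n, pyramid L (P_ n)) (pyP : pyramid L P).
Hypothesis laws : forall (N : nat) (r : R), (0 < N)%N -> (0 < r)%R ->
  (fun n => prokhorov_hausdorff r (measurements (P_ n) N r) (measurements P N r))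
    @ \oo --> 0.

Let near_laws N r (e : R) : (0 < N)%N -> (0 < r)%R -> (0 < e)%R ->
  \forall n \near \oo,
    prokhorov_hausdorff r (measurements (P_ n) N r) (measurements P N r) < e%:E.
Proof.
move=> N0 r0 e0; have e20 : (0 < e / 2)%R by rewrite divr_gt0.
have := (cvg_ereal0P _).1 (laws N0 r0) _ e20.
move=> h; apply: filterS (h _) => [n hn|n].
  by apply: le_lt_trans hn _; rewrite lte_fin ltr_pdivrMr// ltr_pMr// ltr1n.
by apply: PH_ge0 => //; exact: pyramid_law_family.
Qed.

(** If [A] is not in [P] it keeps a positive box distance to [P]. A member of [P_ n]
too close to [A] would have measurements close to some of [A], hence, by
convergence of the measurements, [P] would have such measurements too and
[box_from_pyramid] would give a member of [P] close to [A]. *)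
Lemma laws_weak : weakly_converges L P_ P.
Proof.
have [PL _ _ Pcl _] := pyP.
split=> A.
- move=> PA; apply/cvg_ereal0P => [n|e e0]; first exact: box_to_ge0.
  have [N [r [d [f [N0 r0 d0 Ff key]]]]] := box_from_pyramid (PL A PA) e0.
  apply: filterS (near_laws N0 r0 d0) => n hn.
  have [b Pnb fb] := PH_ltr (pyramid_law_family N (pyP_ n) r0)
    (pyramid_law_family N pyP r0) hn (law_in_measurements r PA Ff).
  have [Y PY AY] := key (P_ n) b (pyP_ n) Pnb (pclose_sym fb).
  by apply: le_trans (ltW AY); apply: ereal_inf_lbound; exists Y.
- move=> LA nPA.
  have [e e0 he] : exists2 e : R, (0 < e)%R & forall B, P B -> ~ box A B < e%:E.
    apply: contrapT => h; apply: nPA; apply: Pcl => // e e0.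
    apply: contrapT => h'; apply: h; exists e => // B PB AB.
    by apply: h'; exists B.
  have [N [r [d [f [N0 r0 d0 Ff key]]]]] := box_from_pyramid LA e0.
  pose c := Num.min (d / 8)%R 1%R.
  have c0 : (0 < c)%R by rewrite lt_min divr_gt0/=.
  have c01 : (0 < c <= 1)%R by rewrite c0 ge_min lexx orbT.
  have d40 : (0 < d / 4)%R by rewrite divr_gt0.
  apply: (gt0_limn_einf c0); apply: filterS (near_laws N0 r0 d40) => n hn.
  rewrite leNgt; apply/negP => /ereal_inf_lt[_ [B PnB <-] AB].
  have [g Fg fg] := law_of_box r0 c01 AB Ff.
  have [b Pb gb] := PH_ltl (pyramid_law_family N (pyP_ n) r0)
    (pyramid_law_family N pyP r0) hn (law_in_measurements r PnB Fg).
  have lf : law_on (cube N r) (gd_law r f) by exact: gd_fam_law.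
  have lg : law_on (cube N r) (gd_law r g) by exact: gd_fam_law.
  have lb : law_on (cube N r) b by exact: measurements_law (ltW r0) Pb.
  have mK := @borel_cube R N r.
  have [|Y PY AY] := key P b pyP Pb.
    apply: (pclose_mono mK lf lb _ (pclose_trans mK lf lg lb fg gb)).
    have : (c <= d / 8)%R by rewrite ge_min lexx.
    by lra.
  exact: he PY AY.
Qed.

End laws_to_weak.

(** Passing to the closure of the family absorbs the isomorphism exactly. *)
Lemma measurements_exact (E : set (gdset R)) N r nu : (0 < r)%R ->
  measurements E N r nu ->
  exists2 X, E X & exists2 h : 'I_N -> X -> R, (forall i, gd_closure X (h i)) &
    forall A : set (borelType 'rV[R]_N), measurable A -> gd_law r h A = nu A.
Proof.
move=> r0 [X [Y EY [u [bu pu uF]]] [f Ff <-]]; exists Y => //.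
have /choice[h hP] : forall i, exists h, gd_closure Y h /\ h \o u = f i.
  move=> i; have : gd_closure X (f i) by apply: gd_fam_closure; exact: Ff.
  by rewrite -uF => -[h clh hu]; exists h.
exists h => [i|A mA]; first by have [] := hP i.
have fE : f = fun i => h i \o u by apply/funext => i; have [_ ->] := hP i.
have := @gd_law_comp R X Y N r u h bu pu _ A mA; rewrite -fE => <- //.
by move=> i; apply: gd_closure_lip1; have [] := hP i.
Qed.

Lemma coordinate_in_pyramid (P : set (gdset R)) N r
    (Q : probability (borelType 'rV[R]_N) R) (Y : gdset R) (v : Y -> 'rV[R]_N) :
  pyramid L P -> (0 < r)%R -> measurements P N r Q -> is_coordinate_gdset L Q v -> P Y.
Proof.
move=> pyP r0 PQ cY; have [PL _ Pdown _ _] := pyP.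
have [X PX [h clh hQ]] := measurements_exact r0 PQ.
apply: (Pdown _ _ PX (coord_LD monL cY)).
apply: (coord_le cY (h := fun i => truncation r \o h i)); first exact: (PL X PX).
  by move=> i; apply: (LD_truncation TBL (PL X PX) (ltW r0)); exact: clh.
by move=> A mA; rewrite -hQ.
Qed.

(** The functions of a coordinate gd-set are functions of the coordinates, so their
law is an explicit nonexpansive image of [Q]. *)
Lemma coordinate_law N N' (r : R) (Q : probability (borelType 'rV[R]_N) R) (Y : gdset R)
    (v : Y -> 'rV[R]_N) (p : 'I_N' -> R -> R) (i : 'I_N' -> 'I_N) :
  is_coordinate_gdset L Q v -> (forall j, L (p j)) ->
  let T (w : 'rV[R]_N) : 'rV[R]_N' := \row_j truncation r (p j (w ord0 (i j))) in
  nonexpansive T /\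
  forall A : set (borelType 'rV[R]_N'), measurable A ->
    gd_law r (fun j y => p j (v y ord0 (i j))) A =
    pushforward Q (T : borelType 'rV[R]_N -> borelType 'rV[R]_N') A.
Proof.
move=> cY Lp T; have nT : nonexpansive T.
  move=> w w' e [e0 ww']; split=> // a j; rewrite !mxE.
  apply: le_lt_trans (truncation_lip _ _ _) _.
  by apply: le_lt_trans (monoidal_lip monL (Lp j) _ _) _; exact: ww'.
split=> // A mA; rewrite /pushforward -(coord_pushforward cY)//.
by apply: borel_preimage => //; apply: continuous_borel; exact: nonexpansive_continuous.
Qed.

Lemma compact_cube N (r : R) : compact (cube N r).
Proof.
have -> : cube N r = [set v : 'rV[R]_N | forall i, `[(- r)%R, r]%classic (v ord0 i)].
  by apply/seteqP; split=> w h i; have := h i; rewrite /= in_itv.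
by apply: (@rV_compact R N (fun=> `[(- r)%R, r]%classic)) => i; exact: segment_compact.
Qed.

Lemma coordinate_law_id N (r : R) (Q : probability (borelType 'rV[R]_N) R) (Y : gdset R)
    (v : Y -> 'rV[R]_N) : Q (cube N r) = 1 -> is_coordinate_gdset L Q v ->
  forall A : set (borelType 'rV[R]_N), measurable A ->
    gd_law r (fun j y => v y ord0 j) A = Q A.
Proof.
move=> QK cY A mA; have Lid : L id by case: monL.
have [nT ->//] := @coordinate_law N N r Q Y v (fun=> id) id cY (fun=> Lid).
rewrite /pushforward; set T := (fun w => \row_j _) in nT *.
have mK := @borel_cube R N r.
have mT : measurable (T @^-1` A : set (borelType 'rV[R]_N)).
  by apply: borel_preimage => //; apply: continuous_borel; exact: nonexpansive_continuous.
rewrite -(prob_setI_full mK mA QK) -(prob_setI_full mK mT QK); congr (Q _).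
have TK w : cube N r w -> T w = w.
  by move=> Kw; apply/rowP => j; rewrite mxE truncation_id//; exact: Kw.
by apply/seteqP; split=> w [Aw Kw]; split=> //; move: Aw; rewrite /preimage/= TK.
Qed.

Section weak_to_laws.
Context (P_ : nat -> set (gdset R)) (P : set (gdset R)).
Hypotheses (pyP_ : forall n, pyramid L (P_ n)) (pyP : pyramid L P).
Hypothesis weak : weakly_converges L P_ P.
Context (N : nat) (r : R) (N0 : (0 < N)%N) (r0 : (0 < r)%R).
Local Notation K := (cube N r).

Let mK : measurable (K : set (borelType 'rV[R]_N)) := @borel_cube R N r.

Let compact_laws (nu_ : nat -> set (borelType 'rV[R]_N) -> \bar R) (I : set nat) :
  (forall n, law_on K (nu_ n)) -> (forall n0, exists2 n, (n0 <= n)%N & I n) ->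
  exists2 Q : probability (borelType 'rV[R]_N) R, Q K = 1 &
    forall (e : R) n0, (0 < e)%R -> exists n, [/\ (n0 <= n)%N, I n & pclose K e (nu_ n) Q].
Proof.
move=> lnu frI.
have /choice[p pP] : forall n, exists p : probability (borelType 'rV[R]_N) R,
    nu_ n = p /\ p K = 1.
  by move=> n; have [p pE pK] := lnu n; exists p.
have [Q QK QP] := prokhorov_compact (P_ := p) (@compact_cube N r) (@closed_cube R N r)
  (fun n => (pP n).2) frI.
exists Q => // e n0 e0; have [n [n0n In nQ]] := QP e n0 e0.
by exists n; split=> //; rewrite (pP n).1.
Qed.

(** Limits of measurements of the [P_ n] are measurements of [P]: the coordinate gd-set
[Y] of the limit [Q] is box-approximated by members of [P_ n], because the law of
each finite family of its functions is the image of [Q] by a nonexpansive map,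
and the same map applied to [nu_ n] gives a measurement of [P_ n] close to it. *)
Let upper (nu_ : nat -> set (borelType 'rV[R]_N) -> \bar R) (I : set nat)
    (Q : probability (borelType 'rV[R]_N) R) :
  (forall n, measurements (P_ n) N r (nu_ n)) -> Q K = 1 ->
  (forall (e : R) n0, (0 < e)%R -> exists n, [/\ (n0 <= n)%N, I n & pclose K e (nu_ n) Q]) ->
  exists2 b, measurements P N r b &
    forall A : set (borelType 'rV[R]_N), measurable A -> b A = Q A.
Proof.
move=> Pnu QK QP; have [_ weak2] := weak.
have [Y [v cY]] := coordinate_gdset_exists monL N0 Q.
have LY := coord_LD monL cY.
have lnu n : law_on K (nu_ n) by exact: measurements_law (ltW r0) (Pnu n).
have Lid : L id by case: monL.
suff PY : P Y.
  exists (gd_law r (fun j y => v y ord0 j)); last exact: coordinate_law_id QK cY.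
  by apply: (law_in_measurements r PY) => i; exact: (coord_fam cY i Lid).
apply: contrapT => nPY.
have [c c0 [n0 _ cn]] := limn_einf_gt0 (weak2 Y LY nPY).
have [N' [r' [d [f [N'0 r'0 d0 Ff key]]]]] := box_from_measurement monL TBL LY c0.
have /choice[p pP] : forall j, exists pi : (R -> R) * 'I_N, L pi.1 /\
    f j = fun y => pi.1 (v y ord0 pi.2).
  move=> j; have [q [_ FY _ _ _]] := cY.
  by move: (Ff j); rewrite FY => -[p [i [Lp ->]]]; exists (p, i).
have Lp j : L (p j).1 by have [] := pP j.
have fE : f = fun j y => (p j).1 (v y ord0 (p j).2).
  by apply/funext => j; have [_] := pP j.
have [n [n0n In nuQ]] := QP d n0 d0.
have [p_n nuE pK] := lnu n.
have [Z [w cZ]] := coordinate_gdset_exists monL N0 p_n.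
have PZ : P_ n Z.
  by apply: (coordinate_in_pyramid (pyP_ n) r0 _ cZ); rewrite -nuE.
have [nT fT] := @coordinate_law N N' r' Q Y v (fun j => (p j).1) (fun j => (p j).2) cY Lp.
have [_ gT] := @coordinate_law N N' r' p_n Z w (fun j => (p j).1) (fun j => (p j).2) cZ Lp.
set T := (fun w => \row_j _) in nT fT gT.
pose g j z := (p j).1 (w z ord0 (p j).2).
have [PL _ Pdown _ _] := pyP_ n.
have [||Y' [LY' Y'Z YY']] := key Z g (PL Z PZ).
- by move=> j; exact: (coord_fam cZ).
- apply: (pclose_meq (@borel_cube R N' r') (mu := pushforward Q (T : borelType 'rV[R]_N -> borelType 'rV[R]_N'))
    (nu := pushforward p_n (T : borelType 'rV[R]_N -> borelType 'rV[R]_N'))).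
  + by move=> A mA; rewrite fE fT.
  + by move=> A mA; rewrite gT.
  apply: (pclose_pushforward (@closed_cube R N r) (@closed_cube R N' r') nT).
  + by move=> x _ j; rewrite mxE; apply: truncation_bound; exact: ltW.
  + by exists Q.
  + by exists p_n.
  + by rewrite -nuE; exact: pclose_sym.
have : box_to Y (P_ n) < c%:E.
  apply: le_lt_trans YY'; apply: ereal_inf_lbound; exists Y' => //.
  exact: Pdown PZ LY' Y'Z.
by rewrite ltNge cn.
Qed.

Lemma weak_laws :
  (fun n => prokhorov_hausdorff r (measurements (P_ n) N r) (measurements P N r))
    @ \oo --> 0.
Proof.
have [weak1 _] := weak.
have lP := pyramid_law_family N pyP r0.
have lP_ n := pyramid_law_family N (pyP_ n) r0.
apply/cvg_ereal0P => [n|e e0]; first exact: PH_ge0.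
apply: contrapT => /not_near_frequently bad.
(* if the distance is infinitely often above [e], then infinitely often one of
   the two sides of the Hausdorff distance is *)
pose bad1 n := exists2 a, measurements (P_ n) N r a &
  forall b, measurements P N r b -> ~ pclose K e a b.
pose bad2 n := exists2 b, measurements P N r b &
  forall a, measurements (P_ n) N r a -> ~ pclose K e a b.
have {}bad : forall n0, exists2 n, (n0 <= n)%N & bad1 n \/ bad2 n.
  move=> n0; have [n n0n nn] := bad n0; exists n => //.
  apply: contrapT => /not_orP[b1 b2]; apply: nn; apply: PH_le => //; first exact: ltW.
    move=> a Pa e' ee'; apply: contrapT => h; apply: b1; exists a => // b Pb ab.
    apply: h; exists b => //; apply: (pclose_mono mK _ _ (ltW ee') ab).
      by case: (lP_ n) => _; apply.
    by case: lP => _; apply.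
  move=> b Pb e' ee'; apply: contrapT => h; apply: b2; exists b => // a Pa ab.
  apply: h; exists a => //; apply: (pclose_mono mK _ _ (ltW ee') ab).
    by case: (lP_ n) => _; apply.
  by case: lP => _; apply.
have [{}bad|{}bad] := frequently_or bad.
- have /choice[nu nuP] : forall n, exists a, measurements (P_ n) N r a /\
      (bad1 n -> forall b, measurements P N r b -> ~ pclose K e a b).
    move=> n; have [[a Pa ha]|nb] := pselect (bad1 n); first by exists a.
    by have [[a Pa] _] := lP_ n; exists a.
  have Pnu n : measurements (P_ n) N r (nu n) by have [] := nuP n.
  have lnu n : law_on K (nu n) by have [_] := lP_ n; apply.
  have [Q QK QP] := compact_laws lnu bad.
  have [b Pb bQ] := upper Pnu QK QP.
  have [n [_ bn nQ]] := QP e 0%N e0.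
  have [_ /(_ bn b Pb)] := nuP n; apply.
  by apply: (pclose_meq mK _ _ nQ) => // A mA; rewrite bQ.
- have /choice[nu nuP] : forall n, exists b, measurements P N r b /\
      (bad2 n -> forall a, measurements (P_ n) N r a -> ~ pclose K e a b).
    move=> n; have [[b Pb hb]|nb] := pselect (bad2 n); first by exists b.
    by have [[b Pb] _] := lP; exists b.
  have Pnu n : measurements P N r (nu n) by have [] := nuP n.
  have lnu n : law_on K (nu n) by have [_] := lP; apply.
  have [Q QK QP] := compact_laws lnu bad.
  have lQ : law_on K Q by exists Q.
  have e60 : (0 < e / 6)%R by rewrite divr_gt0.
  have [m [_ _ mQ]] := QP _ 0%N e60.
  have [X PX [f Ff mf]] := measurements_approx (ltW r0) e60 (Pnu m).
  pose c := Num.min (e / 6)%R 1%R.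
  have c0 : (0 < c)%R by rewrite lt_min e60/=.
  have c01 : (0 < c <= 1)%R by rewrite c0 ge_min lexx orbT.
  have c20 : (0 < c / 2)%R by rewrite divr_gt0.
  have := (cvg_ereal0P (fun n => box_to_ge0 X (P_ n))).1 (weak1 X PX) _ c20.
  move=> [n0 _ n0P]; have [n [n0n bn nQ]] := QP _ n0 e60.
  have : box_to X (P_ n) < c%:E.
    apply: le_lt_trans (n0P n n0n) _.
    by rewrite lte_fin ltr_pdivrMr// ltr_pMr// ltr1n.
  move=> /ereal_inf_lt[_ [B PB <-] XB].
  have [g Fg fg] := law_of_box r0 c01 XB Ff.
  have [_ /(_ bn _ (law_in_measurements r PB Fg))] := nuP n; apply.
  have lf : law_on K (gd_law r f) by exact: gd_fam_law.
  have lg : law_on K (gd_law r g) by exact: gd_fam_law.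
  have h1 := pclose_trans mK lg lf (lnu m) (pclose_sym fg) (pclose_sym mf).
  have h2 := pclose_trans mK lg (lnu m) lQ h1 mQ.
  have h3 := pclose_trans mK lg lQ (lnu n) h2 (pclose_sym nQ).
  apply: (pclose_mono mK lg (lnu n) _ h3).
  have : (c <= e / 6)%R by rewrite ge_min lexx.
  by lra.
Qed.

End weak_to_laws.

End weak_convergence.

(** * The series metric *)

Section series_metric.
Context {R : realType}.
Implicit Types (P Q S : set (gdset R)).

(** Truncating the leading coordinates is nonexpansive and maps the measurements
of large dimension and range onto the smaller ones. *)
Lemma PH_contraction P Q N N' (r r' : R) : (0 < N)%N -> (N <= N')%N ->
  (0 < r)%R -> (r <= r')%R -> P !=set0 -> Q !=set0 ->
  prokhorov_hausdorff r (measurements P N r) (measurements Q N r) <=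
  prokhorov_hausdorff r' (measurements P N' r') (measurements Q N' r').
Proof.
move=> N0 NN' r0 rr' P0 Q0; have r'0 : (0 < r')%R by exact: lt_le_trans rr'.
have lP := law_family_measurements N' r'0 P0.
have lQ := law_family_measurements N' r'0 Q0.
pose T (w : 'rV[R]_N') : 'rV[R]_N := \row_i truncation r (w ord0 (widen_ord NN' i)).
have nT : nonexpansive T.
  move=> w w' e [e0 ww']; split=> // a j; rewrite !mxE.
  by apply: le_lt_trans (truncation_lip _ _ _) _; exact: ww'.
have TK w : cube N' r' w -> cube N r (T w).
  by move=> _ i; rewrite mxE; apply: truncation_bound; exact: ltW.
pose TM (nu : set (borelType 'rV[R]_N') -> \bar R) :=
  pushforward nu (T : borelType 'rV[R]_N' -> borelType 'rV[R]_N).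
have Trow (X : gdset R) (f : 'I_N' -> X -> R) :
    T \o row_fun r' f = row_fun r (fun i => f (widen_ord NN' i)).
  apply/funext => x; apply/rowP => i; rewrite !mxE.
  by apply: truncation_truncation; rewrite (ltW r0).
have Tlaw (X : gdset R) (f : 'I_N' -> X -> R) :
    TM (gd_law r' f) = gd_law r (fun i => f (widen_ord NN' i)).
  by rewrite /gd_law -Trow.
have down E b : measurements E N' r' b -> measurements E N r (TM b).
  move=> [X XE [f Ff <-]]; exists X => //.
  by exists (fun i => f (widen_ord NN' i)) => //; exact: esym (Tlaw X f).
have up E a : measurements E N r a -> exists2 a', measurements E N' r' a' & TM a' = a.
  move=> [X XE [f Ff <-]].
  (* The coordinates beyond [N] repeat the coordinate 0. *)
  pose f' (j : 'I_N') := f (insubd (Ordinal N0) (val j)).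
  have f'E i : f' (widen_ord NN' i) = f i.
    by rewrite /f'; congr f; apply: val_inj; rewrite val_insubd/= (ltn_ord i).
  exists (gd_law r' f'); first by exists X => //; exists f' => // j; exact: Ff.
  rewrite Tlaw; congr gd_law; apply/funext => i; exact: f'E.
have PHf := PH_fin lP lQ.
rewrite -(fineK PHf); apply: PH_le.
- by rewrite fine_ge0// PH_ge0.
- move=> _ /up[a Ma <-] e ee; rewrite -lte_fin fineK// in ee.
  have [b Mb ab] := PH_ltl lP lQ ee Ma.
  exists (TM b); first exact: down.
  exact: (pclose_pushforward (@closed_cube _ _ _) (@closed_cube _ _ _) nT TK
    (lP.2 _ Ma) (lQ.2 _ Mb) ab).
- move=> _ /up[b Mb <-] e ee; rewrite -lte_fin fineK// in ee.
  have [a Ma ab] := PH_ltr lP lQ ee Mb.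
  exists (TM a); first exact: down.
  exact: (pclose_pushforward (@closed_cube _ _ _) (@closed_cube _ _ _) nT TK
    (lP.2 _ Ma) (lQ.2 _ Mb) ab).
Qed.

Definition weight (k : nat) : R := ((k%:R * 2 ^+ k)^-1)%R.

Lemma weight_ge0 k : (0 <= weight k)%R.
Proof. by rewrite invr_ge0 mulr_ge0// exprn_ge0. Qed.

Lemma weight_gt0 k : (0 < k)%N -> (0 < weight k)%R.
Proof. by move=> k0; rewrite invr_gt0 mulr_gt0 ?ltr0n// exprn_gt0. Qed.

(** The weight of [k] is at most [2 ^- k]. *)
Lemma weight_sum n : (\sum_(1 <= k < n.+1) weight k <= 1 - (2 ^+ n)^-1)%R.
Proof.
elim: n => [|n ih]; first by rewrite big_geq// expr0 invr1 subrr.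
rewrite big_nat_recr//=; have -> : (1 - (2 ^+ n.+1)^-1 = (1 - (2 ^+ n)^-1) + (2 ^+ n.+1)^-1 :> R)%R.
  by rewrite exprS invfM; set x := ((2 ^+ n)^-1)%R; lra.
apply: lerD => //; rewrite /weight lef_pV2 ?posrE ?mulr_gt0 ?exprn_gt0 ?ltr0n//.
by rewrite ler_peMl ?exprn_ge0// ler1n.
Qed.

Lemma weight_sum_le1 n : \sum_(1 <= k < n) (weight k)%:E <= 1.
Proof.
case: n => [|n]; first by rewrite big_geq// lee_fin.
rewrite sumEFin lee_fin; apply: le_trans (weight_sum n) _.
by rewrite lerBlDr lerDl invr_ge0 exprn_ge0.
Qed.

Lemma weight_series_le1 : \sum_(1 <= k <oo) (weight k)%:E <= 1.
Proof.
apply: lime_le; first by apply: is_cvg_nneseries => n _ _; rewrite lee_fin weight_ge0.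
by apply: nearW => n; exact: weight_sum_le1.
Qed.

Lemma weight_tail (e : R) : (0 < e)%R ->
  exists m, \sum_(1 + m <= k <oo) (weight k)%:E <= e%:E.
Proof.
move=> e0; have w0 k : 0 <= (weight k)%:E by rewrite lee_fin weight_ge0.
have : \sum_(0 <= k <oo) (weight k)%:E < +oo.
  rewrite (nneseries_split 0%N 1%N)// add0n big_nat1 {1}/weight mul0r invr0 add0e.
  by apply: le_lt_trans weight_series_le1 _; rewrite ltry.
move=> /nneseries_tail_cvg/(_ (fun k _ => w0 k)) /cvg_ereal0P.
have t0 n : 0 <= \sum_(n <= k <oo) (weight k)%:E by exact: nneseries_ge0.
move=> /(_ t0)/(_ e e0)[m _ h].
by exists m; apply: h => /=; rewrite leq_addl.
Qed.

Definition cube_dist P Q (k : nat) : \bar R :=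
  prokhorov_hausdorff k%:R (measurements P k k%:R) (measurements Q k k%:R).

Lemma dPiME P Q : dPiM P Q = \sum_(1 <= k <oo) (weight k)%:E * cube_dist P Q k.
Proof. by []. Qed.

Lemma weight0E x : (weight 0)%:E * x = 0.
Proof. by rewrite /weight mul0r invr0 mul0e. Qed.

Lemma cube_dist_ge0 P Q k : (0 < k)%N -> P !=set0 -> 0 <= cube_dist P Q k.
Proof.
move=> k0 P0; have k0R : (0 < k%:R :> R)%R by rewrite ltr0n.
by apply: PH_ge0 => //; exact: law_family_measurements.
Qed.

Lemma cube_dist_le1 P Q k : (0 < k)%N -> P !=set0 -> Q !=set0 -> cube_dist P Q k <= 1.
Proof.
move=> k0 P0 Q0; have k0R : (0 < k%:R :> R)%R by rewrite ltr0n.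
by apply: PH_le1 => //; exact: law_family_measurements.
Qed.

Lemma series_term_ge0 P Q k : P !=set0 -> 0 <= (weight k)%:E * cube_dist P Q k.
Proof.
move=> P0; have [->|k0] := posnP k; first by rewrite weight0E.
by rewrite mule_ge0 ?cube_dist_ge0// lee_fin weight_ge0.
Qed.

Lemma series_term_le P Q k : P !=set0 -> Q !=set0 ->
  (weight k)%:E * cube_dist P Q k <= (weight k)%:E.
Proof.
move=> P0 Q0; have [->|k0] := posnP k.
  by rewrite weight0E lee_fin weight_ge0.
by rewrite -[leRHS]mule1 lee_wpmul2l ?cube_dist_le1// lee_fin weight_ge0.
Qed.

Lemma dPiM_ge0 P Q : P !=set0 -> 0 <= dPiM P Q.
Proof. by move=> P0; apply: nneseries_ge0 => k _ _; exact: series_term_ge0. Qed.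

Lemma dPiM_fin P Q : P !=set0 -> Q !=set0 -> dPiM P Q \is a fin_num.
Proof.
move=> P0 Q0; rewrite ge0_fin_numE ?dPiM_ge0//.
apply: (@le_lt_trans _ _ 1); last by rewrite ltry.
apply: le_trans weight_series_le1; apply: lee_nneseries => [k _ _|k _].
  exact: series_term_ge0.
exact: series_term_le.
Qed.

Lemma dPiM_sym P Q : dPiM P Q = dPiM Q P.
Proof. by apply: eq_eseriesr => k _; rewrite PH_sym. Qed.

Lemma dPiM_triangle P Q S : P !=set0 -> Q !=set0 -> S !=set0 ->
  dPiM P S <= dPiM P Q + dPiM Q S.
Proof.
move=> P0 Q0 S0; rewrite !dPiME -nneseriesD; try by move=> *; exact: series_term_ge0.
apply: lee_nneseries => [k _ _|k _]; first exact: series_term_ge0.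
have [->|k0] := posnP k; first by rewrite !weight0E adde0.
have k0R : (0 < k%:R :> R)%R by rewrite ltr0n.
rewrite -ge0_muleDr ?cube_dist_ge0//; apply: lee_wpmul2l; first by rewrite lee_fin weight_ge0.
by apply: PH_triangle => //; exact: law_family_measurements.
Qed.

Lemma dPiM_refl P : P !=set0 -> dPiM P P = 0.
Proof.
move=> P0; rewrite dPiME eseries0// => k k0 _.
have k0R : (0 < k%:R :> R)%R by rewrite ltr0n.
by rewrite /cube_dist PH_refl ?mule0//; exact: law_family_measurements.
Qed.

(** Dominated convergence for the series, whose terms are dominated by the
summable weights. *)
Lemma laws_dPiM (Pn : nat -> set (gdset R)) P : (forall n, Pn n !=set0) -> P !=set0 ->
  (forall (N : nat) (r : R), (0 < N)%N -> (0 < r)%R ->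
    (fun n => prokhorov_hausdorff r (measurements (Pn n) N r) (measurements P N r))
      @ \oo --> 0) ->
  (fun n => dPiM (Pn n) P) @ \oo --> 0.
Proof.
move=> Pn0 P0 h; apply/cvg_ereal0P => [n|e e0]; first exact: dPiM_ge0.
have e20 : (0 < e / 2)%R by rewrite divr_gt0.
have [m tm] := weight_tail e20.
have : \forall n \near \oo, forall k, (k < 1 + m)%N -> (0 < k)%N ->
    cube_dist (Pn n) P k <= (e / 2)%:E.
  apply: (@filter_forall_lt _ _
    (fun k n => (0 < k)%N -> cube_dist (Pn n) P k <= (e / 2)%:E)) => k _.
  have [->|k0] := posnP k; first by exists 0%N => // n _ /=.
  have k0R : (0 < k%:R :> R)%R by rewrite ltr0n.
  have /cvg_ereal0P hk := h k k%:R%R k0 k0R.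
  by apply: filterS (hk (fun n => cube_dist_ge0 P k0 (Pn0 n)) _ e20) => n hn _.
apply: filterS => n hn.
rewrite dPiME (nneseries_split 1%N m); last by move=> k _; exact: series_term_ge0.
rewrite [e]splitr EFinD; apply: leeD.
  apply: (@le_trans _ _ (\sum_(1 <= k < 1 + m) ((weight k)%:E * (e / 2)%:E))).
    rewrite big_nat_cond [leRHS]big_nat_cond; apply: lee_sum => k /andP[km _].
    by case/andP: km => k0 km; apply: lee_wpmul2l; [rewrite lee_fin weight_ge0|exact: hn].
  rewrite -ge0_sume_distrl; last by move=> k _; rewrite lee_fin weight_ge0.
  rewrite -[leRHS]mul1e; apply: lee_wpmul2r; first by rewrite lee_fin ltW.
  exact: weight_sum_le1.
apply: le_trans tm; apply: lee_nneseries => [k _ _|k _]; first exact: series_term_ge0.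
exact: series_term_le.
Qed.

Lemma weight_PH_le P Q k : (0 < k)%N -> P !=set0 ->
  (weight k)%:E * cube_dist P Q k <= dPiM P Q.
Proof.
move=> k0 P0; rewrite dPiME.
apply: le_trans (nneseries_lim_ge k.+1 (fun n _ _ => series_term_ge0 Q n P0)).
rewrite big_nat_recr//= leeDr// sume_ge0// => i _; exact: series_term_ge0.
Qed.

(** One term of the series, of large index, controls a given measurement. *)
Lemma dPiM_laws (Pn : nat -> set (gdset R)) P : (forall n, Pn n !=set0) -> P !=set0 ->
  (fun n => dPiM (Pn n) P) @ \oo --> 0 ->
  forall (N : nat) (r : R), (0 < N)%N -> (0 < r)%R ->
    (fun n => prokhorov_hausdorff r (measurements (Pn n) N r) (measurements P N r))
      @ \oo --> 0.
Proof.
move=> Pn0 P0 /cvg_ereal0P h N r N0 r0.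
have {}h := h (fun n => dPiM_ge0 P (Pn0 n)).
apply/cvg_ereal0P => [n|e e0]; first by apply: PH_ge0 => //; exact: law_family_measurements.
pose k := maxn N (Num.truncn r).+1.
have k0 : (0 < k)%N by rewrite leq_max N0.
have rk : (r <= k%:R)%R.
  apply: (@le_trans _ _ (Num.truncn r).+1%:R); last by rewrite ler_nat leq_maxr.
  by apply: ltW; exact: truncnS_gt.
have w0 := weight_gt0 k0.
apply: filterS (h (weight k * e)%R _) => [n hn|]; last exact: mulr_gt0.
apply: le_trans (PH_contraction (N' := k) N0 _ r0 rk (Pn0 n) P0) _; first by rewrite leq_maxl.
have : (weight k)%:E * cube_dist (Pn n) P k <= (weight k)%:E * e%:E.
  by apply: le_trans (weight_PH_le _ k0 (Pn0 n)) _; rewrite -EFinM.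
by rewrite lee_pmul2l// lte_fin.
Qed.

End series_metric.

Section pyramid_metric.
Context {R : realType} (L : set (R -> R)).
Hypothesis monL : monoidal L.
Hypothesis TBL : @TB R `<=` L.

Lemma pyramid_nonempty (P : set (gdset R)) : pyramid L P -> P !=set0.
Proof. by case. Qed.

(** A zero distance makes the constant sequence [Q] converge weakly to [P], so
every member of [P] is approximated in the closed set [Q]. *)
Lemma dPiM_eq0_sub P Q : pyramid L P -> pyramid L Q -> dPiM Q P = 0 -> P `<=` Q.
Proof.
move=> pyP pyQ QP A PA.
have P0 := pyramid_nonempty pyP; have Q0 := pyramid_nonempty pyQ.
have : weakly_converges L (fun=> Q) P.
  apply: (laws_weak monL TBL) => // N r N0 r0.
  apply: (dPiM_laws (Pn := fun=> Q)) => //.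
  by rewrite QP; exact: cvg_cst.
move=> [/(_ A PA) + _] => /cvg_ereal0P cA.
have [PLD _ _ _ _] := pyP; have [_ _ _ Qcl _] := pyQ.
apply: Qcl => [|e e0]; first exact: PLD.
have e20 : (0 < e / 2)%R by rewrite divr_gt0.
have [n _ /(_ n (leqnn n)) /= AQ] := cA (fun=> box_to_ge0 A Q) _ e20.
have : box_to A Q < e%:E.
  by apply: le_lt_trans AQ _; rewrite lte_fin ltr_pdivrMr// ltr_pMr// ltr1n.
by move=> /ereal_inf_lt[_ [B QB <-] AB]; exists B.
Qed.

Lemma dPiM_metric : is_metric_on [set P | pyramid L P] (@dPiM R).
Proof.
split=> [P Q|P Q|P Q _ _|P Q S] /=; last 2 first.
- exact: dPiM_sym.
- move=> /pyramid_nonempty P0 /pyramid_nonempty Q0 /pyramid_nonempty S0.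
  exact: dPiM_triangle.
- move=> /pyramid_nonempty P0 /pyramid_nonempty Q0.
  by split; [exact: dPiM_fin|exact: dPiM_ge0].
- move=> pyP pyQ; split=> [PQ|->]; last exact: dPiM_refl (pyramid_nonempty pyQ).
  apply/seteqP; split; apply: dPiM_eq0_sub => //.
  by rewrite dPiM_sym.
Qed.

(** By [PH_assoc] and the triangle inequality both sequences of distances are the
same. *)
Lemma cvg_assoc (Xn : nat -> gdset R) (X : gdset R) N (r : R) : (0 < r)%R ->
  (forall n, LD L (Xn n)) -> LD L X ->
  (fun n => prokhorov_hausdorff r (measurement (Xn n) N r) (measurement X N r))
    @ \oo --> 0 <->
  (fun n => prokhorov_hausdorff r (measurements (assoc_pyramid L (Xn n)) N r)
    (measurements (assoc_pyramid L X) N r)) @ \oo --> 0.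
Proof.
move=> r0 LXn LX.
suff eqPH n : prokhorov_hausdorff r (measurement (Xn n) N r) (measurement X N r) =
    prokhorov_hausdorff r (measurements (assoc_pyramid L (Xn n)) N r)
      (measurements (assoc_pyramid L X) N r).
  by rewrite (_ : (fun n => _) = (fun n => prokhorov_hausdorff r
    (measurements (assoc_pyramid L (Xn n)) N r)
    (measurements (assoc_pyramid L X) N r))) //; exact/funext.
have lm Y : law_family r (measurement Y N r) by exact: law_family_measurement.
have la Y : LD L Y -> law_family r (measurements (assoc_pyramid L Y) N r).
  by move=> LY; apply: pyramid_law_family r0; exact: pyramid_assoc.
apply/eqP; rewrite eq_le; apply/andP; split.
  apply: le_trans (PH_triangle (lm (Xn n)) (la _ (LXn n)) (lm X)) _.
  rewrite PH_assoc// add0e.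
  apply: le_trans (PH_triangle (la _ (LXn n)) (la _ LX) (lm X)) _.
  by rewrite (PH_sym _ _ (measurement X N r)) PH_assoc// adde0.
apply: le_trans (PH_triangle (la _ (LXn n)) (lm (Xn n)) (la _ LX)) _.
rewrite PH_sym PH_assoc// add0e.
apply: le_trans (PH_triangle (lm (Xn n)) (lm X) (la _ LX)) _.
by rewrite PH_assoc// adde0.
Qed.

End pyramid_metric.

Theorem theoremB5 (R : realType) (L : set (R -> R))
    (L_monoidal : monoidal L) (TB_L : @TB R `<=` L) :
  is_metric_on [set P | pyramid L P] (@dPiM R) /\
  (forall (Pn : nat -> set (gdset R)) (P : set (gdset R)),
    (forall n, pyramid L (Pn n)) -> pyramid L P ->
    [<-> weakly_converges L Pn P;
         forall (N : nat) (r : R), (0 < N)%N -> (0 < r)%R ->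
           (fun n => prokhorov_hausdorff r
              (measurements (Pn n) N r) (measurements P N r)) @ \oo --> 0;
         (fun n => dPiM (Pn n) P) @ \oo --> 0]) /\
  (forall (Xn : nat -> gdset R) (X : gdset R),
    (forall n, LD L (Xn n)) -> LD L X ->
    [<-> forall (N : nat) (r : R), (0 < N)%N -> (0 < r)%R ->
           (fun n => prokhorov_hausdorff r
              (measurement (Xn n) N r) (measurement X N r)) @ \oo --> 0;
         weakly_converges L (fun n => assoc_pyramid L (Xn n))
           (assoc_pyramid L X);
         (fun n => dPiM (assoc_pyramid L (Xn n)) (assoc_pyramid L X))
           @ \oo --> 0]).
Proof.
split; first exact: dPiM_metric.
have equiv (Pn : nat -> set (gdset R)) (P : set (gdset R)) :
    (forall n, pyramid L (Pn n)) -> pyramid L P ->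
    [<-> weakly_converges L Pn P;
         forall (N : nat) (r : R), (0 < N)%N -> (0 < r)%R ->
           (fun n => prokhorov_hausdorff r
              (measurements (Pn n) N r) (measurements P N r)) @ \oo --> 0;
         (fun n => dPiM (Pn n) P) @ \oo --> 0].
  move=> pyPn pyP.
  have P0 := pyramid_nonempty pyP.
  have Pn0 n := pyramid_nonempty (pyPn n).
  tfae=> [weak N r N0 r0|laws|cvgd].
  - exact: (weak_laws L_monoidal TB_L pyPn pyP weak N0 r0).
  - exact: laws_dPiM.
  - apply: laws_weak => //; exact: dPiM_laws.
split=> // Xn X LXn LX.
have pyXn n : pyramid L (assoc_pyramid L (Xn n)) by exact: pyramid_assoc.
have pyX : pyramid L (assoc_pyramid L X) by exact: pyramid_assoc.
have /= E := equiv _ _ pyXn pyX.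
tfae=> [laws|weak|cvgd N r N0 r0].
- apply/(E 0%N 1%N) => N r N0 r0.
  by apply/cvg_assoc => //; exact: laws.
- exact/(E 2%N 0%N).
- apply/(cvg_assoc N r0 LXn LX).
  by have /(E 2%N 1%N) := cvgd; exact.
Qed.
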